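(* Let $\Gamma$ be a standard hyper curve in $\mathbb{R}^n\times\mathbb{R}^n$, let $T\in CZO_{\gamma}$ and let $1<p<\infty$. Then there is some constant $C>0$ such that $$\|Tf\|_{L^{1,\infty}}\le C\|f\|_{L^1}\qquad\text{for all } f\in L^1(\mathbb{R}^n)$$ and $$\|Tf\|_{L^p}\le C\|f\|_{L^p}\qquad\text{for all } f\in L^p(\mathbb{R}^n).$$
   Context: Standard hyper curves. $\Gamma\subset\mathbb{R}^n\times\mathbb{R}^n$ is called a standard hyper curve ($\Gamma\in SHC$) if $\Gamma=\bigcup_{i=1}^r\Gamma_i$ for finitely many sets $\Gamma_i$ such that: (1) $\Gamma_i=\{(x,\gamma_i(x)): x\in\mathcal{D}_i\}$, where $\gamma_i$ is a mapping from a closed domain $\mathcal{D}_i\subset\mathbb{R}^n$ to $\mathbb{R}^n$ (the $\mathcal{D}_i$ may coincide for different $i$); (2) each $\gamma_i$ is differentiable and its Jacobian (determinant) $J_{\gamma_i}(x)$ has no zero in the interior of $\mathcal{D}_i$; (3) for $1\le i<i'\le r$, the equation $\gamma_i(x)=\gamma_{i'}(x)$ has at most finitely many solutions $x$; (4) both $\gamma_i$ and $\gamma_i^{-1}$ are Lipschitz: there is a constant $c_\gamma>1$ such that $|\gamma_i(x)-\gamma_i(x')|\le c_\gamma|x-x'|$ and $|\gamma_i^{-1}(y)-\gamma_i^{-1}(y')|\le c_\gamma|y-y'|$ for all $x,x'\in\mathcal{D}_i$, $y,y'\in\gamma_i(\mathcal{D}_i)$, $1\le i\le r$. For $E\subset\mathbb{R}^n$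 put $\gamma^{-1}(E)=\bigcup_{i=1}^r\{x\in\mathcal{D}_i:\gamma_i(x)\in E\}$. Put $\rho_i(x,y)=\inf_{(x',y')\in\Gamma_i}|(x,y)-(x',y')|$ (Euclidean distance) and $\rho(x,y)=\min_{1\le i\le r}\rho_i(x,y)$. The class $CZO_\gamma$. $T\in CZO_\gamma$ means: $T$ is a continuous linear operator from $C_c^\infty(\mathbb{R}^n)$ into $\mathcal{D}'(\mathbb{R}^n)$ that extends to a bounded operator on $L^2(\mathbb{R}^n)$, and whose distribution kernel $K$ coincides with a function $K(x,y)$ defined on $\Gamma^c=(\mathbb{R}^n\times\mathbb{R}^n)\setminus\Gamma$ such that, for some $A,\delta>0$ and all $(x,y)\in\Gamma^c$, $|K(x,y)|\le A\rho(x,y)^{-n}$; $|K(x,y)-K(x,y')|\le A|y-y'|^\delta\rho(x,y)^{-n-\delta}$ whenever $|y-y'|\le\frac12\rho(x,y)$; $|K(x,y)-K(x',y)|\le A|x-x'|^\delta\rho(x,y)^{-n-\delta}$ whenever $|x-x'|\le\frac12\rho(x,y)$; and, for every $f\in C_c^\infty(\mathbb{R}^n)$, $Tf(x)=\int_{\mathbb{R}^n}K(x,y)f(y)\,dy$ for $x\notin\gamma^{-1}(\operatorname{supp}f)$. Here $\|g\|_{L^{1,\infty}}=\sup_{\lambda>0}\lambda\,|\{x:|g(x)|\ge\lambda\}|$. For $f\in L^1$ (resp. $f\in L^p$), $Tf$ denotes the value at $f$ of the extension of $T$ by density from $L^1\cap L^2$ (resp. $L^p\cap L^2$), on which $T$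 is given by its bounded extension to $L^2(\mathbb{R}^n)$; for $L^1$ the limit is taken in measure. *)

(* Defs.v *)
From HB Require Import structures.
From mathcomp Require Import all_boot all_order all_algebra complex.
From mathcomp Require Import all_classical all_reals all_analysis.

Set Implicit Arguments.
Unset Strict Implicit.
Unset Printing Implicit Defensive.

Import Order.TTheory GRing.Theory Num.Theory.
Import numFieldNormedType.Exports.

Local Open Scope classical_set_scope.
Local Open Scope ring_scope.

Notation normc := ComplexField.Normc.normc.

(* The sigma-algebra of 'rV[R]_n is generated by the n coordinate maps: it is
   the product sigma-algebra, that is the Borel one. *)
Definition measure_rV_display : measure_display. Proof. exact. Qed.

Section measurable_rV.
Context (R : realType) (n : nat).

Definition coord_rV (i : 'I_n) (x : 'rV[R]_n) : measurableTypeR R := x ord0 i.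

Let rV_set0 : g_sigma_preimage coord_rV set0.
Proof. exact: sigma_algebra0. Qed.

Let rV_setC A : g_sigma_preimage coord_rV A -> g_sigma_preimage coord_rV (~` A).
Proof. exact: sigma_algebraC. Qed.

Let rV_bigcup (F : _^nat) : (forall i, g_sigma_preimage coord_rV (F i)) ->
  g_sigma_preimage coord_rV (\bigcup_i F i).
Proof. exact: sigma_algebra_bigcup. Qed.

HB.instance Definition _ := @isMeasurable.Build measure_rV_display
  'rV[R]_n (g_sigma_preimage coord_rV) rV_set0 rV_setC rV_bigcup.

Lemma measurable_coord_rV (i : 'I_n) : measurable_fun setT (coord_rV i).
Proof.
move=> _ Y mY; rewrite setTI; apply: sub_sigma_algebra => /=.
rewrite -bigcup_seq/=; exists i => /=; first by rewrite mem_index_enum.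
by exists Y => //; rewrite setTI.
Qed.

Lemma measurable_fun_rVP (d : measure_display) (T : measurableType d) (f : T -> 'rV[R]_n) :
  (forall i, measurable_fun setT (coord_rV i \o f)) -> measurable_fun setT f.
Proof.
move=> mf _ A mA; rewrite setTI.
have : preimage_set_system setT f (g_sigma_preimage coord_rV) (f @^-1` A).
  by exists A => //; rewrite setTI.
rewrite -g_sigma_preimage_comp.
apply: smallest_sub; first exact: sigma_algebra_measurable.
rewrite -bigcup_seq => B [i _] [C mC <-].
by have := mf i measurableT C mC.
Qed.

End measurable_rV.

Section lebesgue_rV.
Context {R : realType}.

(* (x, a) |-> the vector whose first coordinate is a, followed by those of x *)
Definition cons_rV n (xa : 'rV[R]_n * measurableTypeR R) : 'rV[R]_n.+1 :=
  \row_i oapp (fun j => xa.1 ord0 j) xa.2 (unlift ord0 i).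

Lemma measurable_cons_rV n : measurable_fun setT (@cons_rV n).
Proof.
apply: measurable_fun_rVP => i.
case: (unliftP ord0 i) => [j ->|->].
- rewrite (_ : _ \o _ = coord_rV j \o fst); last first.
    by apply/funext => xa; rewrite /= /coord_rV mxE liftK.
  by apply: measurableT_comp => //; exact: measurable_coord_rV.
- rewrite (_ : _ \o _ = snd); first exact: measurable_snd.
  by apply/funext => xa; rewrite /= /coord_rV mxE unlift_none.
Qed.

(* n-dimensional Lebesgue measure, as an iterated product of the
   one-dimensional one; lebesgue_rV_box below gives its value on boxes. *)
Fixpoint lebesgue_rV n : set 'rV[R]_n -> \bar R :=
  match n with
  | 0 => dirac (0 : 'rV[R]_0)
  | n'.+1 => pushforward (@lebesgue_rV n' \x lebesgue_measure)%E (@cons_rV n')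
  end.

Let lebesgue_rV_measure n :
  exists m : {measure set 'rV[R]_n -> \bar R}, @lebesgue_rV n = m.
Proof.
elim: n => [|n [m mE]]; first by exists (dirac (0 : 'rV[R]_0)).
have pE := measurable_cons_rV (n := n).
exists (measure_function_pushforward__canonical__measure_function_Measure
  (m \x lebesgue_measure)%E pE).
by rewrite /= mE.
Qed.

Let lebesgue_rV0 n : @lebesgue_rV n set0 = 0%E.
Proof. by have [m ->] := lebesgue_rV_measure n; exact: measure0. Qed.

Let lebesgue_rV_ge0 n A : (0 <= @lebesgue_rV n A)%E.
Proof. by have [m ->] := lebesgue_rV_measure n; exact: measure_ge0. Qed.

Let lebesgue_rV_sigma_additive n : semi_sigma_additive (@lebesgue_rV n).
Proof.
by have [m ->] := lebesgue_rV_measure n; exact: measure_semi_sigma_additive.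
Qed.

HB.instance Definition _ n := isMeasure.Build _ _ _ (@lebesgue_rV n)
  (@lebesgue_rV0 n) (@lebesgue_rV_ge0 n) (@lebesgue_rV_sigma_additive n).

Lemma lebesgue_rV_box n (a b : 'rV[R]_n) : (forall i, a ord0 i <= b ord0 i) ->
  lebesgue_rV [set x : 'rV[R]_n | forall i, a ord0 i <= x ord0 i <= b ord0 i] =
  (\prod_(i < n) (b ord0 i - a ord0 i))%:E.
Proof.
elim: n => [|n IH] in a b *; move=> ab.
  rewrite big_ord0 /= diracE mem_set//=.
  by case.
have mbox (c d : 'rV[R]_n) : measurable
    [set x : 'rV[R]_n | forall i, c ord0 i <= x ord0 i <= d ord0 i].
  rewrite (_ : [set _ | _] = \big[setI/setT]_(i < n)
      (@coord_rV R n i @^-1` `[c ord0 i, d ord0 i])); last first.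
    rewrite -bigcap_seq; apply/seteqP; split => x /= h.
      by move=> i _ /=; rewrite in_itv/=; exact: h.
    move=> i; have := h i (mem_index_enum i).
    by rewrite /= in_itv.
  apply: bigsetI_measurable => i _.
  by rewrite -[X in measurable X]setTI; exact: measurable_coord_rV.
pose tl (c : 'rV[R]_n.+1) : 'rV[R]_n := \row_i c ord0 (lift ord0 i).
rewrite /= /pushforward.
rewrite (_ : _ @^-1` _ =
    [set x : 'rV[R]_n | forall i, tl a ord0 i <= x ord0 i <= tl b ord0 i] `*`
    `[a ord0 ord0, b ord0 ord0]); last first.
  apply/seteqP; split => -[x t] /= h.
    split; last by have := h ord0; rewrite mxE unlift_none in_itv.
    by move=> i; have := h (lift ord0 i); rewrite !mxE liftK.
  case: h => h; rewrite in_itv/= => ht i; rewrite mxE.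
  case: unliftP => [j ->|->] //=.
  by have := h j; rewrite !mxE.
rewrite product_measure1E//.
rewrite [X in (X * _)%E]IH; last by move=> i; rewrite !mxE; exact: ab.
have ab0 : lebesgue_measure `[a ord0 ord0, b ord0 ord0]%classic =
    (b ord0 ord0 - a ord0 ord0)%:E.
  rewrite lebesgue_measure_itv/= lte_fin; case: ltP => // h.
  by rewrite (@le_anti _ _ (a ord0 ord0) (b ord0 ord0)) ?ab ?h// subrr.
rewrite [X in (_ * X)%E](_ : _ = (b ord0 ord0 - a ord0 ord0)%:E)//.
rewrite big_ord_recl/= -EFinM mulrC; congr (_ * _)%:E.
by apply: eq_bigr => i _; rewrite !mxE.
Qed.

End lebesgue_rV.

Section complex_functions.
Context {R : realType} {m : nat}.
Implicit Types (f g : 'rV[R]_m -> R[i]) (p : R).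

Definition cmeasurable f :=
  measurable_fun setT (fun x => complex.Re (f x)) /\
  measurable_fun setT (fun x => complex.Im (f x)).

Definition cintegral f : R[i] :=
  Complex (Rintegral (@lebesgue_rV R m) setT (fun x => complex.Re (f x)))
          (Rintegral (@lebesgue_rV R m) setT (fun x => complex.Im (f x))).

Definition Lp_norm p f : \bar R :=
  Lnorm (@lebesgue_rV R m) p%:E (fun x => (normc (f x))%:E).

Definition in_Lp p f := cmeasurable f /\ (Lp_norm p f < +oo)%E.

Definition weak_L1_norm f : \bar R :=
  ereal_sup [set (l%:E * lebesgue_rV [set x | (l <= normc (f x))%R])%E
            | l in [set l : R | 0 < l]].

Definition cvg_in_measure (h : nat -> 'rV[R]_m -> R[i]) f :=
  forall e : R, 0 < e ->
    lebesgue_rV [set x | e <= normc (h k x - f x)] @[k --> \oo] --> 0%E.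

End complex_functions.

Section distributions.
Context {R : realType} {m : nat}.
Implicit Types (f phi : 'rV[R]_m -> R[i]) (u : ('rV[R]_m -> R[i]) -> R[i]).

Definition partial (s : seq 'I_m) (f : 'rV[R]_m -> R) : 'rV[R]_m -> R :=
  foldr (fun i g => 'D_(delta_mx ord0 i) g) f s.

Definition smooth (f : 'rV[R]_m -> R) :=
  forall s : seq 'I_m, continuous (partial s f) /\
    forall (i : 'I_m) x, derivable (partial s f) x (delta_mx ord0 i).

Definition cpartial (s : seq 'I_m) f : 'rV[R]_m -> R[i] := fun x =>
  Complex (partial s (fun y => complex.Re (f y)) x)
          (partial s (fun y => complex.Im (f y)) x).

Definition supp f : set 'rV[R]_m := closure [set x | f x != 0].

Definition test_fun f :=
  [/\ smooth (fun x => complex.Re (f x)), smooth (fun x => complex.Im (f x))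
    & compact (supp f)].

Definition test_cvg0 (phi : nat -> 'rV[R]_m -> R[i]) :=
  [/\ forall k, test_fun (phi k),
      exists2 L : set 'rV[R]_m, compact L & forall k, supp (phi k) `<=` L
    & forall (s : seq 'I_m) (e : R), 0 < e ->
        \forall k \near \oo, forall x, normc (cpartial s (phi k) x) < e].

(* Only the values of u on test functions are meaningful. For linear maps on
   the space of test functions continuity is sequential continuity at 0. *)
Definition is_distribution u :=
  (forall (a : R[i]) f g, test_fun f -> test_fun g ->
     u (fun x => a * f x + g x) = a * u f + u g) /\
  (forall phi : nat -> 'rV[R]_m -> R[i], test_cvg0 phi ->
     normc (u (phi k)) @[k --> \oo] --> (0 : R)).

End distributions.

Section operators.
Context {R : realType} {n : nat}.
Local Notation fct := ('rV[R]_n -> R[i]).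
(* T f g is the value <T f, g> of the distribution T f at g *)
Implicit Types (T : fct -> fct -> R[i]) (S : fct -> fct) (f g : fct).

Definition continuous_linear_operator T :=
  [/\ forall f, test_fun f -> is_distribution (T f),
      forall (a : R[i]) f h g, test_fun f -> test_fun h -> test_fun g ->
        T (fun x => a * f x + h x) g = a * T f g + T h g
    & forall phi : nat -> fct, test_cvg0 phi -> forall g, test_fun g ->
        normc (T (phi k) g) @[k --> \oo] --> (0 : R)].

(* The pairing of a function with a test function is bilinear (no conjugate).
   S is a bounded operator on L^2 extending T; elements of L^2 are represented
   by functions, hence the equality almost everywhere in the linearity. *)
Definition L2_extension T S :=
  [/\ exists B : R, forall f, in_Lp 2 f ->
        in_Lp 2 (S f) /\ (Lp_norm 2 (S f) <= B%:E * Lp_norm 2 f)%E,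
      forall (a : R[i]) f g, in_Lp 2 f -> in_Lp 2 g ->
        {ae @lebesgue_rV R n, forall x,
          S (fun y => a * f y + g y) x = a * S f x + S g x}
    & forall f g, test_fun f -> test_fun g ->
        T f g = cintegral (fun x => S f x * g x)].

(* g is a representative of the value at f of the extension by density of S
   from L^1 `&` L^2 to L^1 (limit in measure), resp. from L^p `&` L^2 to L^p.
   Approximating sequences h exist by density, so g is unique a.e. *)
Definition L1_value S f g :=
  cmeasurable g /\
  forall h : nat -> fct, (forall k, in_Lp 1 (h k) /\ in_Lp 2 (h k)) ->
    Lp_norm 1 (fun x => h k x - f x) @[k --> \oo] --> 0%E ->
    cvg_in_measure (fun k => S (h k)) g.

Definition Lp_value (p : R) S f g :=
  in_Lp p g /\
  forall h : nat -> fct, (forall k, in_Lp p (h k) /\ in_Lp 2 (h k)) ->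
    Lp_norm p (fun x => h k x - f x) @[k --> \oo] --> 0%E ->
    Lp_norm p (fun x => S (h k) x - g x) @[k --> \oo] --> 0%E.

(* R^n x R^n is 'rV[R]_(n + n), the pair (x, y) being row_mx x y *)
Definition tensor g f : 'rV[R]_(n + n) -> R[i] :=
  fun z => g (lsubmx z) * f (rsubmx z).

Definition schwartz_kernel T (k : ('rV[R]_(n + n) -> R[i]) -> R[i]) :=
  is_distribution k /\
  forall f g, test_fun f -> test_fun g -> T f g = k (tensor g f).

End operators.

Section hyper_curves.
Context {R : realType}.

(* Euclidean norm (the library norm of 'rV is the sup norm) *)
Definition enorm m (x : 'rV[R]_m) : R := Num.sqrt (\sum_i x ord0 i ^+ 2).

Context {n r : nat}.
Variables (D : 'I_r.+1 -> set 'rV[R]_n) (gam : 'I_r.+1 -> 'rV[R]_n -> 'rV[R]_n).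

Definition closed_domain (E : set 'rV[R]_n) :=
  exists U : set 'rV[R]_n, [/\ open U, connected U, U !=set0 & E = closure U].

Definition branch (i : 'I_r.+1) : set 'rV[R]_(n + n) :=
  [set row_mx x (gam i x) | x in D i].

Definition hyper_curve : set 'rV[R]_(n + n) := \bigcup_i branch i.

(* only the values of gam i on D i matter *)
Definition standard_hyper_curve :=
  [/\ forall i, closed_domain (D i),
      forall i x, (D i)^° x ->
        differentiable (gam i) x /\ \det (jacobian (gam i) x) != 0,
      forall i j, i != j ->
        finite_set [set x | [/\ D i x, D j x & gam i x = gam j x]]
    & exists2 c : R, 1 < c & forall i,
        (forall x x', D i x -> D i x' ->
          enorm (gam i x - gam i x') <= c * enorm (x - x')) /\
        exists2 gam_inv : 'rV[R]_n -> 'rV[R]_n,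
          (forall x, D i x -> gam_inv (gam i x) = x) &
          forall y y', (gam i @` D i) y -> (gam i @` D i) y' ->
            enorm (gam_inv y - gam_inv y') <= c * enorm (y - y')].

Definition curve_preimage (E : set 'rV[R]_n) : set 'rV[R]_n :=
  \bigcup_i [set x | D i x /\ E (gam i x)].

Definition rho_branch (i : 'I_r.+1) (x y : 'rV[R]_n) : R :=
  inf [set enorm (row_mx x y - z) | z in branch i].

Definition rho (x y : 'rV[R]_n) : R :=
  \big[Num.min/rho_branch ord0 x y]_i rho_branch i x y.

(* The points (x, y') and (x', y) below are off the curve as soon as (x, y) is,
   the distance to the curve being rho x y > 0. *)
Definition standard_kernel (K : 'rV[R]_n -> 'rV[R]_n -> R[i]) (A delta : R) :=
  forall x y, ~ hyper_curve (row_mx x y) ->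
    [/\ normc (K x y) <= A * rho x y `^ (- n%:R),
        forall y', enorm (y - y') <= 2^-1 * rho x y ->
          normc (K x y - K x y') <=
            A * enorm (y - y') `^ delta * rho x y `^ (- n%:R - delta)
      & forall x', enorm (x - x') <= 2^-1 * rho x y ->
          normc (K x y - K x' y) <=
            A * enorm (x - x') `^ delta * rho x y `^ (- n%:R - delta)].

Definition kernel_coincides (k : ('rV[R]_(n + n) -> R[i]) -> R[i])
    (K : 'rV[R]_n -> 'rV[R]_n -> R[i]) :=
  forall phi, test_fun phi -> supp phi `&` hyper_curve = set0 ->
    k phi = cintegral (fun z => K (lsubmx z) (rsubmx z) * phi z).

(* T f is an element of L^2, so the integral representation is an equality
   almost everywhere outside of curve_preimage (supp f). *)
Definition kernel_represents (S : ('rV[R]_n -> R[i]) -> 'rV[R]_n -> R[i])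
    (K : 'rV[R]_n -> 'rV[R]_n -> R[i]) :=
  forall f, test_fun f ->
    {ae @lebesgue_rV R n, forall x, ~ curve_preimage (supp f) x ->
      S f x = cintegral (fun y => K x y * f y)}.

Definition CZO (T : ('rV[R]_n -> R[i]) -> ('rV[R]_n -> R[i]) -> R[i]) :=
  continuous_linear_operator T /\
  exists S k K, exists A delta : R,
    [/\ L2_extension T S, schwartz_kernel T k, kernel_coincides k K,
        0 < A /\ 0 < delta & standard_kernel K A delta /\ kernel_represents S K].

End hyper_curves.

(* Main.v *)
Require Import Defs.
From HB Require Import structures.
From mathcomp Require Import all_boot all_order all_algebra complex.
From mathcomp Require Import all_classical all_reals all_analysis.
From mathcomp Require Import measurable_realfun.
From mathcomp Require Import zify ring lra.
Import Order.TTheory GRing.Theory Num.Theory.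
Import numFieldNormedType.Exports.
Local Open Scope ring_scope.
Set Implicit Arguments.
Unset Strict Implicit.
Unset Printing Implicit Defensive.

(** The reason behind the theorem is that the singularities of the kernel are
    as sparse as for a classical Calderon-Zygmund operator. The branches of the
    curve are Lipschitz graphs with Lipschitz inverses, so for a fixed y the
    points x such that (x, y) lies at distance less than t from the curve are
    contained in boundedly many balls of radius O(t), and the same holds for a
    fixed x ([curve_dist_cover]). In the Calderon-Zygmund decomposition, the
    part of the function living on a cube of side t around y is therefore
    harmless outside of boundedly many cubes of side O(t): it has mean zero, and
    there the kernel is smooth in y. This gives the weak type (1,1) estimate,
    real interpolation with the bound on L^2 gives the range p < 2, and since
    the transposed kernel has the same properties duality gives p > 2.

    These steps are carried out on finite matrices, where there is no question
    of convergence: [discrete_weak_type] for a matrix indexed by a finite tree,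
    [discrete_marcinkiewicz] and [discrete_duality], summed up in
    [discrete_kernel_weak] and [discrete_kernel_strong] for matrices indexed by
    the dyadic cells of side 2^-N of a large box. The matrix of an operator has
    as entry (i, j) the mean over the cell i of the image of the indicator of
    the cell j. That it inherits the bounds of the kernel, with constants that
    do not depend on N, is [cell_matrix_kernel]. Distances are measured there in
    numbers of cells, so that the scale disappears, and the integral
    representation of the operator is used for smooth bumps filling up one cell
    only: approximating the indicator in L^2, they transfer the regularity of
    the kernel to the matrix. As the compressions of the operator to step
    functions converge in L^2 ([dyadic_proj_cvg]), the bounds survive the limit
    in N ([operator_weak_type], [operator_strong_type]).

    The extension S of T to L^2 in the conclusion need not be the one for which
    the kernel representation is known. The pairings of S f with test functions
    being prescribed by T, two extensions agree almost everywhere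
    ([L2_extension_unique]), whence constants that do not depend on S. All of
    this concerns real functions, applied to the real and imaginary parts of S.

    The passage from the intersection with L^2 to the whole of L^1 or L^p is the
    usual extension by density. Completeness is needed in measure only
    ([cauchy_cvg_mu]), both cases being covered by a weak type estimate; the
    strong estimate for p > 1 follows by Fatou's lemma. *)

(** * Calderon-Zygmund decomposition on a finite tree *)

Section discrete_calderon_zygmund.
Context {R : realType} {I : finType}.
(** The classes of level k are the fibres of q k, which maps an index to the
    representative of its class; they merge as k grows until there is only one.
    The model is the tree of dyadic cubes, with Dg = 2^n. *)
Variables (q : nat -> I -> I) (m Dg : nat).
Hypothesis q0 : forall i, q 0 i = i.
Hypothesis qS : forall k i j, q k i = q k j -> q k.+1 i = q k.+1 j.
Hypothesis qm : forall i j, q m i = q m j.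
Hypothesis Dg0 : (0 < Dg)%N.
Hypothesis qcard : forall k i, (k <= m)%N ->
  #|[set j | q k j == q k i]| = (Dg ^ k)%N.
Implicit Types (f h : I -> R) (k : nat).

Let q_le k k' i j : (k <= k')%N -> q k i = q k j -> q k' i = q k' j.
Proof. by move=> /subnKC <-; elim: (k' - k)%N => [|l IH]; rewrite ?addn0// addnS => /IH/qS. Qed.

Definition class_avg k f i : R := (\sum_(j | q k j == q k i) f j) / (Dg ^ k)%:R.

Let DgX_gt0 k : (0 : R) < (Dg ^ k)%:R. Proof. by rewrite ltr0n expn_gt0 Dg0. Qed.

(** After exchanging the two sums, each j of the family receives the value h j,
    shared by its class, as many times as the class has elements. With h = 1 this
    says that averaging preserves the mass; with an entry of the matrix as h it
    is the cancellation of the bad part. *)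
Lemma sum_class_avg (B : pred I) (kk : I -> nat) f h :
  (forall i, B i -> (kk i <= m)%N) ->
  (forall i j, B i -> q (kk i) j = q (kk i) i -> [/\ B j, kk j = kk i & h j = h i]) ->
  \sum_(i | B i) h i * class_avg (kk i) f i = \sum_(i | B i) h i * f i.
Proof.
move=> Bm Bq.
under eq_bigr do rewrite /class_avg mulr_suml mulr_sumr.
rewrite (exchange_big_dep B)/=; last first.
  by move=> i j Bi /eqP ji; have [] := Bq _ _ Bi ji.
apply: eq_bigr => j Bj.
rewrite (eq_bigl (fun i => i \in [set i | q (kk j) i == q (kk j) j])); last first.
  move=> i; rewrite inE; apply/andP/eqP => [[Bi /eqP ji]|ij].
    by have [_ kji _] := Bq _ _ Bi ji; rewrite kji.
  have [Bi kij _] := Bq _ _ Bj ij; split => //.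
  by rewrite kij ij.
rewrite (eq_bigr (fun=> h j * (f j / (Dg ^ kk j)%:R))); last first.
  move=> i; rewrite inE => /eqP ij.
  by have [Bi -> ->] := Bq _ _ Bj ij.
rewrite sumr_const qcard ?Bm// -[LHS]mulr_natr -mulrA divfK//.
by rewrite gt_eqF.
Qed.

Variables (a : I -> I -> R) (M C1 C2 : R) (E : nat -> I -> {set I}).
Hypothesis M0 : 0 <= M.
Hypothesis C10 : 0 <= C1.
Hypothesis C20 : 0 <= C2.
Hypothesis aL2 : forall f,
  \sum_i (\sum_j a i j * f j) ^+ 2 <= M * \sum_j f j ^+ 2.
Hypothesis Ecard : forall k j, (k <= m)%N -> #|E k (q k j)|%:R <= C1 * (Dg ^ k)%:R.
Hypothesis aE : forall k j, (k <= m)%N ->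
  \sum_(i | i \notin E k (q k j)) `|a i j - a i (q k j)| <= C2.

Let avg_class k f i j : q k i = q k j -> class_avg k f i = class_avg k f j.
Proof. by move=> ij; rewrite /class_avg ij. Qed.

Let markov (P : pred I) f (l : R) : (forall i, 0 <= f i) ->
  l * #|[set i | P i && (l <= f i)]|%:R <= \sum_(i | P i) f i.
Proof.
move=> f0; rewrite mulr_natr -sumr_const [leRHS](bigID (fun i => l <= f i))/=.
rewrite -[leLHS]addr0 lerD ?sumr_ge0//.
by under eq_bigl do rewrite inE; apply: ler_sum => i /andP[].
Qed.

(** A bad point lies in a class with a large average; the maximal cubes of the
    decomposition are the classes at the stopping levels of the bad points. *)
Definition bad (f : I -> R) (l : R) i := [exists k : 'I_m.+1, l < class_avg k f i].
Definition stop (f : I -> R) (l : R) i : nat :=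
  \max_(k < m.+1 | l < class_avg k f i) k.

Let stopP f l i : bad f l i ->
  l < class_avg (stop f l i) f i /\ (stop f l i <= m)%N.
Proof.
case/existsP => k hk.
have [|j jP jE] := eq_bigmax_cond (fun j : 'I_m.+1 => j : nat)
  (A := [pred j : 'I_m.+1 | l < class_avg j f i]).
  by apply/card_gt0P; exists k.
by rewrite /stop; move: jE; rewrite /= => ->; rewrite -ltnS ltn_ord.
Qed.

Let stop_max f l i k : (k <= m)%N -> l < class_avg k f i -> (k <= stop f l i)%N.
Proof.
rewrite -ltnS => km h.
exact: (leq_bigmax_cond (F := fun j : 'I_m.+1 => j : nat) (Ordinal km)).
Qed.

Let stop_class f l i j : bad f l i -> q (stop f l i) j = q (stop f l i) i ->
  bad f l j /\ stop f l j = stop f l i.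
Proof.
move=> bi ji; have [hi im] := stopP bi.
have bj : bad f l j.
  apply/existsP; exists (Ordinal (n := m.+1) im).
  by rewrite /= (avg_class _ ji).
split => //; apply/eqP; rewrite eqn_leq; apply/andP; split; last first.
  by apply: stop_max => //; rewrite (avg_class _ ji).
have [hj jm] := stopP bj.
rewrite leqNgt; apply/negP => ij.
have : (stop f l j <= stop f l i)%N.
  by apply: stop_max => //; rewrite -(avg_class _ (q_le (ltnW ij) ji)).
by rewrite leqNgt ij.
Qed.

(** The function is replaced by its averages on the maximal classes with a large
    average. The averaged function is bounded by a multiple of l, so the
    quadratic bound and Chebyshev's inequality apply to it. The remainder has
    mean zero on each of these classes, which allows subtracting from the matrix
    its value at the representative of the class; the result is summable outside
    of the sets E, whose total size is controlled by the sizes of the classes. No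
    shape is imposed on the sets E: they need not surround the class. *)
Lemma discrete_weak_type f l : 0 < l ->
  l * #|[set i | l <= `|\sum_j a i j * f j|]|%:R <=
  (1 + C1 + 4 * C2 + 4 * M * Dg%:R) * \sum_j `|f j|.
Proof.
move=> l0; pose F i := `|f i|; have F0 i : 0 <= F i by exact: normr_ge0.
have sF0 : 0 <= \sum_j F j by exact: sumr_ge0.
have DR0 : (0 : R) < Dg%:R by rewrite ltr0n.
have [[i0 hi0]|top] := pselect (exists i, l < class_avg m F i).
  (* the average over the whole of I is large: nothing to prove *)
  have Im : #|I|%:R = (Dg ^ m)%:R :> R.
    rewrite -(qcard i0 (leqnn m)); congr (_%:R); apply: eq_card => j.
    by rewrite !inE (qm j i0) eqxx.
  apply: (@le_trans _ _ (\sum_j F j)); last first.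
    by rewrite ler_peMl// -!addrA lerDl !addr_ge0// ?mulr_ge0// ltW.
  apply: (@le_trans _ _ (l * #|I|%:R)).
    by rewrite ler_wpM2l ?(ltW l0)// ler_nat max_card.
  rewrite Im -ler_pdivlMr//; apply: le_trans (ltW hi0) _.
  rewrite /class_avg ler_pM2r ?invr_gt0//.
  by rewrite [leRHS](bigID (fun j => q m j == q m i0))/= lerDl sumr_ge0.
have {}top i : class_avg m F i <= l by rewrite leNgt; apply/negP => h; apply: top; exists i.
set B := bad F l; set k := stop F l.
have Bk i : B i -> l < class_avg (k i) F i by case/stopP.
have Bm i : B i -> (k i < m)%N.
  move=> Bi; have [hi] := stopP Bi; rewrite leq_eqVlt => /orP[/eqP km|//].
  by have := top i; rewrite -km leNgt hi.
have Bm' i : B i -> (k i <= m)%N by move=> /Bm/ltnW.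
have Bcl i j : B i -> q (k i) j = q (k i) i -> B j /\ k j = k i by exact: stop_class.
have notB i k' : (k' <= m)%N -> ~~ B i -> class_avg k' F i <= l.
  move=> k'm; apply: contraNT; rewrite -ltNge => h; apply/existsP.
  by exists (Ordinal (n := m.+1) k'm).
have avgS i : B i -> class_avg (k i) F i <= Dg%:R * l.
  move=> Bi; have h : class_avg (k i).+1 F i <= l.
    rewrite leNgt; apply/negP => h.
    by have := stop_max (Bm _ Bi) h; rewrite ltnn.
  apply: (@le_trans _ _ (Dg%:R * class_avg (k i).+1 F i)); last by rewrite ler_pM2l.
  rewrite /class_avg expnS natrM invfM mulrCA mulVKf ?gt_eqF//.
  rewrite ler_pM2r ?invr_gt0// [leRHS](bigID (fun j => q (k i) j == q (k i) i))/=.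
  rewrite (_ : \sum_(j | _ && _) F j = \sum_(j | q (k i) j == q (k i) i) F j) ?lerDl ?sumr_ge0//.
  apply: eq_bigl => j; case: (q (k i) j =P q (k i) i) => [ji|_]; last by rewrite andbF.
  by rewrite (qS ji) eqxx.
have norm_avg k' i : `|class_avg k' f i| <= class_avg k' F i.
  rewrite /class_avg normrM (gtr0_norm (_ : 0 < _^-1)) ?invr_gt0// ler_pM2r ?invr_gt0//.
  exact: ler_norm_sum.
pose g i := if B i then class_avg (k i) f i else f i.
pose b i := f i - g i.
have gB i : B i -> g i = class_avg (k i) f i by rewrite /g => ->.
have bB i : ~~ B i -> b i = 0 by rewrite /b /g => /negbTE ->; rewrite subrr.
have g_le i : `|g i| <= Dg%:R * l.
  rewrite /g; case: ifPn => Bi; first exact: le_trans (norm_avg _ _) (avgS _ Bi).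
  have := notB _ _ (leq0n m) Bi; rewrite /class_avg expn0 divr1.
  under eq_bigl do rewrite !q0.
  rewrite big_pred1_eq => /le_trans; apply.
  by rewrite ler_peMl ?(ltW l0)// ler1n.
have sB : \sum_(i | B i) class_avg (k i) F i = \sum_(i | B i) F i.
  have := @sum_class_avg B k F (fun=> 1) Bm' _.
  rewrite -!mulr_sumr !mul1r; apply => i j Bi ji.
  by have [] := Bcl _ _ Bi ji.
have sg : \sum_i `|g i| <= \sum_i F i.
  rewrite (bigID B)/= [leRHS](bigID B)/= -sB; apply: lerD; apply: ler_sum => i Bi.
    by rewrite gB.
  by rewrite /g (negbTE Bi).
have sb : \sum_i `|b i| <= 2 * \sum_i F i.
  rewrite mulr_natl mulr2n; apply: le_trans (lerD (lexx _) sg).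
  by rewrite -big_split; apply: ler_sum => i _; exact: ler_normB.
pose T f i := \sum_j a i j * f j.
have TD i : T f i = T g i + T b i.
  rewrite /T -big_split; apply: eq_bigr => j _ /=.
  by rewrite -mulrDr /b addrCA subrr addr0.
(* the good part, by the quadratic estimate *)
have good : l * #|[set i | l / 2 <= `|T g i|]|%:R <= 4 * M * Dg%:R * \sum_j F j.
  have := @markov predT (fun i => T g i ^+ 2) ((l / 2) ^+ 2) (fun=> sqr_ge0 _).
  rewrite (_ : [set i | _ && _] = [set i | l / 2 <= `|T g i|]); last first.
    apply/setP => i; rewrite !inE /= -(real_normK (num_real (T g i))).
    by rewrite ler_pXn2r// ?nnegrE ?divr_ge0 ?ltW.
  move=> h; have {h} h1 := le_trans h (aL2 g).
  have h2 : \sum_j g j ^+ 2 <= Dg%:R * l * \sum_j F j.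
    apply: (@le_trans _ _ (Dg%:R * l * \sum_j `|g j|)).
      rewrite mulr_sumr; apply: ler_sum => j _.
      by rewrite -(real_normK (num_real (g j))) expr2 ler_wpM2r.
    by rewrite ler_wpM2l// mulr_ge0// ltW.
  have {h1 h2} := le_trans h1 (ler_wpM2l M0 h2).
  rewrite -(ler_pM2l l0); move: (#|_|%:R) (\sum_j F j) => X Y.
  nra.
pose EE := \bigcup_(i | B i) E (k i) (q (k i) i).
have EE_card : l * #|EE|%:R <= C1 * \sum_j F j.
  have h1 : #|EE|%:R <= \sum_(i | B i) C1.
    apply: (@le_trans _ _ (\sum_(i | B i) \sum_(x in E (k i) (q (k i) i)) ((Dg ^ k i)%:R : R)^-1)); last first.
      apply: ler_sum => i Bi; rewrite sumr_const -[leLHS]mulr_natl ler_pdivrMr//.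
      by rewrite Ecard// Bm'.
    rewrite (exchange_big_dep (mem EE))/=; last first.
      by move=> i x Bi xE; apply/bigcupP; exists i.
    rewrite -sum1_card natr_sum; apply: ler_sum => x /bigcupP[i Bi xE].
    rewrite (bigID (fun j => q (k i) j == q (k i) i))/= -[leLHS]addr0 lerD//; last first.
      by apply: sumr_ge0 => j _; rewrite invr_ge0 ltW.
    rewrite (eq_bigl (fun j => j \in [set j | q (k i) j == q (k i) i])); last first.
      move=> j; rewrite inE; case: eqP => [ji|]; last by rewrite andbF.
      by have [Bj kj] := Bcl _ _ Bi ji; rewrite Bj kj ji xE.
    rewrite (eq_bigr (fun=> ((Dg ^ k i)%:R)^-1)); last first.
      by move=> j; rewrite inE => /eqP ji; have [_ ->] := Bcl _ _ Bi ji.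
    by rewrite sumr_const qcard ?Bm'// -[_ *+ (Dg ^ _)]mulr_natr mulVf// gt_eqF.
  apply: le_trans (ler_wpM2l (ltW l0) h1) _.
  apply: (@le_trans _ _ (C1 * \sum_(i | B i) F i)); last first.
    by rewrite ler_wpM2l// [leRHS](bigID B)/= lerDl sumr_ge0.
  rewrite -sB !mulr_sumr; apply: ler_sum => i Bi.
  by rewrite mulrC ler_wpM2l// ltW// Bk.
have TbE x : T b x = \sum_(j | B j) (a x j - a x (q (k j) j)) * b j.
  rewrite /T (bigID B)/= [X in _ + X]big1 ?addr0; last first.
    by move=> j Bj; rewrite bB// mulr0.
  have h : \sum_(j | B j) a x (q (k j) j) * b j = 0.
    under eq_bigr => j Bj do rewrite /b gB// mulrBr.
    rewrite sumrB (@sum_class_avg B k f (fun j => a x (q (k j) j)))// ?subrr// => i j Bi ji.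
    by have [Bj kj] := Bcl _ _ Bi ji; rewrite kj ji.
  by under [RHS]eq_bigr do rewrite mulrBl; rewrite sumrB h subr0.
(* the bad part, off the exceptional set, by cancellation *)
have badE : l * #|[set x | (x \notin EE) && (l / 2 <= `|T b x|)]|%:R <= 4 * C2 * \sum_j F j.
  have h := @markov (fun x => x \notin EE) (fun x => `|T b x|) (l / 2) (fun=> normr_ge0 _).
  have h1 : \sum_(x | x \notin EE) `|T b x| <= C2 * (2 * \sum_j F j).
    apply: (@le_trans _ _ (C2 * \sum_j `|b j|)); last by rewrite ler_wpM2l.
    apply: (@le_trans _ _ (\sum_(j | B j) \sum_(x | x \notin EE) `|a x j - a x (q (k j) j)| * `|b j|)).
      rewrite exchange_big; apply: ler_sum => x xE; rewrite TbE.
      by apply: le_trans (ler_norm_sum _ _ _) _; apply: ler_sum => j _; rewrite normrM.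
    rewrite [X in C2 * X](bigID B)/= mulrDr -[leLHS]addr0 lerD//; last first.
      by rewrite mulr_ge0// sumr_ge0.
    rewrite mulr_sumr; apply: ler_sum => j Bj; rewrite -mulr_suml ler_wpM2r//.
    apply: le_trans (aE j (Bm' _ Bj)).
    rewrite [leRHS](bigID (fun x => x \notin EE))/=.
    rewrite -[leLHS]addr0 lerD ?sumr_ge0//.
    rewrite le_eqVlt; apply/orP; left; apply/eqP/eq_bigl => x.
    case: (boolP (x \in EE)); rewrite ?andbF// andbT => xE.
    by apply/esym; apply: contra xE => xE; apply/bigcupP; exists j.
  have := le_trans h h1; move: (#|_|%:R) (\sum_j F j) => X Y; lra.
have sub : [set i | l <= `|T f i|] \subset [set i | l / 2 <= `|T g i|] :|: EE
    :|: [set x | (x \notin EE) && (l / 2 <= `|T b x|)].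
  apply/fintype.subsetP => x; rewrite !inE TD => h.
  case: (boolP (x \in EE)) => xE; rewrite ?orbT//= orbF.
  have := le_trans h (ler_normD _ _).
  by case: (leP (l / 2) `|T g x|) => //= h1 h2; lra.
have /(ler_wpM2l (ltW l0)) : #|[set i | l <= `|T f i|]|%:R <=
    #|[set i | l / 2 <= `|T g i|]|%:R + #|EE|%:R +
    #|[set x | (x \notin EE) && (l / 2 <= `|T b x|)]|%:R :> R.
  rewrite -!natrD ler_nat; apply: leq_trans (subset_leq_card sub) _.
  apply: leq_trans (leq_card_setU _ _) _; rewrite leq_add2r.
  exact: leq_card_setU.
move=> /le_trans; apply; rewrite !mulrDr (mulrDl (_ + _)) (mulrDl (1 + _)) mulrDl mul1r.
apply: le_trans (lerD (lerD good EE_card) badE) _.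
by move: sF0; rewrite /F; set X := 4 * M * _ * _; lra.
Qed.
End discrete_calderon_zygmund.

(** * Interpolation and duality for finite matrices *)

Section dyadic_sums.
Context {R : realType}.
Implicit Types s t x : R.

Lemma powRVN x s : 0 <= x -> x^-1 `^ s = x `^ (- s).
Proof. by move=> x0; rewrite -[x^-1]powR_inv1// -powRrM mulN1r. Qed.

(** Sum of the geometric series of ratio 2^-s. *)
Definition geo s : R := (1 - 2 `^ (- s))^-1.

Let pow2_lt1 s : 0 < s -> 2 `^ (- s) < 1 :> R.
Proof.
move=> s0; rewrite -powRVN//; have := @gt0_ltr_powR R _ s0 2^-1 1.
by rewrite !nnegrE powR1 invf_lt1 ?ltr1n ?invr_ge0//; apply.
Qed.

Lemma geo_gt0 s : 0 < s -> 0 < geo s.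
Proof. by move=> s0; rewrite invr_gt0 subr_gt0 pow2_lt1. Qed.

Lemma geoE s : 0 < s -> 1 + 2 `^ (- s) * geo s = geo s.
Proof.
move=> s0; have h := pow2_lt1 s0.
by rewrite /geo; field; rewrite subr_eq0 eq_sym lt_eqF.
Qed.

Lemma sum_dyadic_desc s t K : 0 < s -> 0 < t ->
  \sum_(k < K) (t * 2 ^+ k) `^ (- s) <= geo s * t `^ (- s).
Proof.
move=> s0; elim: K t => [|K IH] t t0.
  by rewrite big_ord0 mulr_ge0 ?powR_ge0// ltW// geo_gt0.
rewrite big_ord_recl/= expr0 mulr1.
under eq_bigr do rewrite /bump/= add1n exprS mulrA.
apply: le_trans (lerD (lexx _) (IH _ _)) _; first by rewrite mulr_gt0.
rewrite powRM ?(ltW t0)// -[X in _ <= X * _](geoE s0) mulrDl mul1r lerD2l.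
by rewrite (mulrC (t `^ _)) mulrA (mulrC (geo s)).
Qed.

Lemma sum_dyadic_ge s t x K : 0 < s -> 0 < t -> 0 < x ->
  \sum_(k < K | x <= t * 2 ^+ k) (t * 2 ^+ k) `^ (- s) <= geo s * x `^ (- s).
Proof.
move=> s0 + x0; elim: K t => [|K IH] t t0.
  by rewrite big_ord0 mulr_ge0 ?powR_ge0// ltW// geo_gt0.
have [xt|tx] := leP x t.
  apply: (@le_trans _ _ (geo s * t `^ (- s))).
    apply: le_trans (sum_dyadic_desc K.+1 s0 t0).
    by rewrite [leRHS](bigID (fun k : 'I_K.+1 => x <= t * 2 ^+ k))/= lerDl sumr_ge0// => *; exact: powR_ge0.
  rewrite ler_pM2l ?geo_gt0// !powRN lef_pV2 ?posrE ?powR_gt0//.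
  by rewrite ge0_ler_powR ?nnegrE// ltW.
rewrite big_mkcond big_ord_recl/= expr0 mulr1 (leNgt x t) tx/= add0r -big_mkcond/=.
under eq_bigl do rewrite /bump/= add1n exprS mulrA.
under eq_bigr do rewrite /bump/= add1n exprS mulrA.
by apply: IH; rewrite mulr_gt0.
Qed.

Lemma sum_dyadic_lt s t x K : 0 < s -> 0 < t -> 0 < x ->
  \sum_(k < K | t * 2 ^+ k < x) (t * 2 ^+ k) `^ s <= geo s * x `^ s.
Proof.
move=> s0 t0 x0.
have h k : \sum_(j < k.+1) (t * 2 ^+ j) `^ s <= geo s * (t * 2 ^+ k) `^ s.
  elim: k => [|k IH].
    rewrite big_ord_recr big_ord0/= add0r ler_peMl ?powR_ge0//.
    by rewrite -(geoE s0) lerDl mulr_ge0 ?powR_ge0// ltW// geo_gt0.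
  rewrite big_ord_recr/=; apply: le_trans (lerD IH (lexx _)) _.
  have -> : t * 2 ^+ k = 2^-1 * (t * 2 ^+ k.+1) by rewrite exprS; field.
  have tk : 0 <= t * 2 ^+ k.+1 by rewrite mulr_ge0 ?exprn_ge0 ?(ltW t0).
  rewrite [(2^-1 * _) `^ s]powRM ?invr_ge0// powRVN// -[X in _ <= X * _](geoE s0).
  rewrite mulrDl mul1r [leRHS]addrC lerD2r.
  by rewrite mulrA (mulrC (geo s)).
elim: K => [|K IH]; first by rewrite big_ord0 mulr_ge0 ?powR_ge0// ltW// geo_gt0.
have [tx|xt] := ltP (t * 2 ^+ K) x; last first.
  by rewrite big_mkcond big_ord_recr/= ltNge xt/= addr0 -big_mkcond.
apply: (@le_trans _ _ (geo s * (t * 2 ^+ K) `^ s)).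
  apply: le_trans (h K).
  by rewrite [leRHS](bigID (fun k : 'I_K.+1 => t * 2 ^+ k < x))/= lerDl sumr_ge0// => *; exact: powR_ge0.
rewrite ler_pM2l ?geo_gt0// ge0_ler_powR ?nnegrE ?mulr_ge0 ?exprn_ge0//; exact: ltW.
Qed.

Lemma dyadic_bound t x : 0 < t -> exists K, x < t * 2 ^+ K.
Proof.
move=> t0; have [x0|x0] := leP x 0; first by exists 0%N; rewrite expr0 mulr1 (le_lt_trans x0).
exists (Num.Def.archi_bound (x / t)).
have /archi_boundP h : 0 <= x / t by rewrite divr_ge0 ?ltW.
rewrite mulrC -ltr_pdivrMr//; apply: lt_trans h _.
by rewrite -natrX ltr_nat ltn_expl.
Qed.

Lemma dyadic_locate t x K : 0 < t -> t <= x -> x < t * 2 ^+ K ->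
  exists k : 'I_K, t * 2 ^+ k <= x < t * 2 ^+ k.+1.
Proof.
move=> t0 tx; elim: K => [|K IH].
  by rewrite expr0 mulr1 ltNge tx.
have [/IH[k hk] _|h1 h2] := ltP x (t * 2 ^+ K); last by exists ord_max; rewrite h1.
by exists (widen_ord (leqnSn K) k).
Qed.

Lemma ge0_bound_sum (I : finType) (F : I -> R) i : (forall i, 0 <= F i) -> F i <= \sum_i F i.
Proof. by move=> F0; rewrite (bigD1 i)//= lerDl sumr_ge0. Qed.
End dyadic_sums.

Section discrete_Lp.
Context {R : realType} {I : finType}.
Implicit Types (a : I -> I -> R) (f h : I -> R) (p : R).

Definition marcinkiewicz_const (W M p : R) : R :=
  2 `^ p * (2 * W * geo (p - 1) + 4 * M * geo (2 - p)).

(** Marcinkiewicz interpolation between the weak type (1,1) bound W and the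
    quadratic bound M. The heights run over the powers of 2 up to a positive
    factor, which suffices as the image takes finitely many values; at each
    height f is cut into its large part, treated by W, and its small part,
    treated by M. *)
Lemma discrete_marcinkiewicz a W M p f : 0 <= W -> 0 <= M -> 1 < p < 2 ->
  (forall h, \sum_i (\sum_j a i j * h j) ^+ 2 <= M * \sum_j h j ^+ 2) ->
  (forall h l, 0 < l ->
     l * #|[set i | l <= `|\sum_j a i j * h j|]|%:R <= W * \sum_j `|h j|) ->
  \sum_i `|\sum_j a i j * f j| `^ p <=
  marcinkiewicz_const W M p * \sum_j `|f j| `^ p.
Proof.
move=> W0 M0 /andP[p1 p2] aL2 aW; pose T h i := \sum_j a i j * h j.
have p0 : 0 < p by lra.
have q0 : 0 < p - 1 by lra.
have r0 : 0 < 2 - p by lra.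
pose F i := `|T f i|; rewrite -/(F _).
(* a positive height below every nonzero value of the image *)
pose t := (1 + \sum_(i | 0 < F i) (F i)^-1)^-1.
have t0 : 0 < t.
  by rewrite invr_gt0 ltr_wpDr// sumr_ge0// => i /ltW; rewrite invr_ge0.
have tF i : 0 < F i -> t <= F i.
  move=> Fi; rewrite -[leRHS]invrK lef_pV2 ?posrE ?invr_gt0//; last first.
    by rewrite -[ltRHS]invrK invr_gt0.
  rewrite (bigD1 i)//= addrCA lerDl addr_ge0// sumr_ge0// => j /andP[/ltW].
  by rewrite invr_ge0.
have [K hK] := dyadic_bound (\sum_i F i) t0.
have FK i : F i < t * 2 ^+ K by apply: le_lt_trans hK; apply: ge0_bound_sum => j; exact: normr_ge0.
pose l k := t * 2 ^+ k.
have l0 k : 0 < l k by rewrite mulr_gt0// exprn_gt0.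
(* layer-cake along the dyadic heights *)
have layer : \sum_i F i `^ p <= 2 `^ p * \sum_(k < K) l k `^ p * #|[set i | l k <= F i]|%:R.
  under [X in _ * X]eq_bigr do rewrite -sum1_card natr_sum mulr_sumr.
  rewrite (exchange_big_dep predT)//= mulr_sumr; apply: ler_sum => i _.
  have [Fi|Fi] := ltP 0 (F i); last first.
    rewrite (_ : F i = 0) ?powR0 ?gt_eqF//; last by apply/eqP; rewrite eq_le Fi normr_ge0.
    by rewrite mulr_ge0 ?powR_ge0// sumr_ge0// => k _; rewrite mulr_ge0 ?powR_ge0.
  have [k /andP[k1 k2]] := dyadic_locate t0 (tF _ Fi) (FK i).
  rewrite (bigD1 k)/= ?inE ?k1// mulr1 mulrDr -[leLHS]addr0 lerD//; last first.
    by rewrite mulr_ge0 ?powR_ge0// sumr_ge0// => *; rewrite mulr_ge0 ?powR_ge0.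
  rewrite -powRM ?(ltW (l0 _))// ge0_ler_powR ?nnegrE ?(ltW p0)//.
  - exact: normr_ge0.
  - by rewrite mulr_ge0// ltW.
  - by apply: ltW; move: k2; rewrite exprS mulrCA.
apply: le_trans layer _; rewrite /marcinkiewicz_const -mulrA ler_wpM2l ?powR_ge0//.
(* split of f at each height *)
have split k : l k `^ p * #|[set i | l k <= F i]|%:R <=
   2 * W * \sum_(j | l k < `|f j|) l k `^ (p - 1) * `|f j| +
   4 * M * \sum_(j | `|f j| <= l k) l k `^ (- (2 - p)) * `|f j| ^+ 2.
  pose f1 j := if l k < `|f j| then f j else 0.
  pose f2 j := if `|f j| <= l k then f j else 0.
  have fE j : f j = f1 j + f2 j.
    by rewrite /f1 /f2 leNgt; case: ltP => /=; rewrite ?addr0 ?add0r.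
  have l20 : 0 < l k / 2 by rewrite divr_gt0.
  have h1 := aW f1 _ l20; have h2 := aL2 f2.
  have h3 : (l k / 2) ^+ 2 * #|[set i | l k / 2 <= `|T f2 i|]|%:R <= M * \sum_j f2 j ^+ 2.
    apply: le_trans h2; rewrite mulr_natr -sumr_const.
    apply: (@le_trans _ _ (\sum_(i in [set i | l k / 2 <= `|T f2 i|]) (T f2 i) ^+ 2)).
      apply: ler_sum => i; rewrite inE => hi.
      by rewrite -(real_normK (num_real (T f2 i))) ler_pXn2r ?nnegrE// ltW.
    by rewrite [leRHS](bigID (mem [set i | l k / 2 <= `|T f2 i|]))/= lerDl sumr_ge0// => *; exact: sqr_ge0.
  have h4 : #|[set i | l k <= F i]|%:R <= #|[set i | l k / 2 <= `|T f1 i|]|%:R +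
      #|[set i | l k / 2 <= `|T f2 i|]|%:R :> R.
    rewrite -natrD ler_nat; apply: leq_trans (leq_card_setU _ _).
    apply: subset_leq_card; apply/fintype.subsetP => i; rewrite !inE => hi.
    have : F i <= `|T f1 i| + `|T f2 i|.
      apply: le_trans (ler_normD _ _); rewrite /F /T -big_split/=.
      by under eq_bigr do rewrite fE mulrDr.
    by move=> /(le_trans hi); case: (leP (l k / 2) `|T f1 i|) => //= *; lra.
  apply: le_trans (ler_wpM2l (powR_ge0 _ _) h4) _; rewrite mulrDr; apply: lerD.
    rewrite -mulr_sumr.
    have -> : l k `^ p = 2 * l k `^ (p - 1) * (l k / 2).
      rewrite powRB ?(gt_eqF (l0 k)) ?implybT// powRr1 ?(ltW (l0 k))//.
      by field; rewrite gt_eqF.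
    have c0 : 0 <= 2 * l k `^ (p - 1) by rewrite mulr_ge0 ?powR_ge0.
    rewrite -[leLHS]mulrA; apply: le_trans (ler_wpM2l c0 h1) _.
    rewrite [X in W * X](_ : _ = \sum_(j | l k < `|f j|) `|f j|); last first.
      by rewrite [RHS]big_mkcond; apply: eq_bigr => j _; rewrite /f1; case: ifP; rewrite ?normr0.
    rewrite le_eqVlt; apply/orP; left; apply/eqP; ring.
  have -> : l k `^ p = 4 * l k `^ (- (2 - p)) * (l k / 2) ^+ 2.
    have -> : - (2 - p) = p - 2%:R by ring.
    rewrite powRB ?(gt_eqF (l0 k)) ?implybT// powR_mulrn ?(ltW (l0 k))//.
    by field; rewrite gt_eqF.
  have c0 : 0 <= 4 * l k `^ (- (2 - p)) by rewrite mulr_ge0 ?powR_ge0.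
  rewrite -[leLHS]mulrA; apply: le_trans (ler_wpM2l c0 h3) _.
  rewrite -mulr_sumr [X in M * X](_ : _ = \sum_(j | `|f j| <= l k) `|f j| ^+ 2); last first.
    rewrite [RHS]big_mkcond; apply: eq_bigr => j _; rewrite /f2.
    by case: ifP; rewrite ?expr0n// real_normK// num_real.
  rewrite le_eqVlt; apply/orP; left; apply/eqP; ring.
apply: le_trans; first by apply: ler_sum => k _; exact: split.
rewrite big_split/= -2!mulr_sumr [leRHS]mulrDl.
apply: lerD; rewrite (exchange_big_dep predT)//= -[leRHS]mulrA.
  rewrite ler_wpM2l ?mulr_ge0// mulr_sumr; apply: ler_sum => j _; rewrite -mulr_suml.
  have [->|fj] := eqVneq (f j) 0; first by rewrite normr0 mulr0 powR0 ?gt_eqF// mulr0.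
  have fj0 : 0 < `|f j| by rewrite normr_gt0.
  apply: le_trans (ler_wpM2r (ltW fj0) (sum_dyadic_lt K q0 t0 fj0)) _.
  by rewrite powRB ?(gt_eqF fj0) ?implybT// powRr1 ?(ltW fj0)// -mulrA divfK// gt_eqF.
rewrite ler_wpM2l ?mulr_ge0// mulr_sumr; apply: ler_sum => j _; rewrite -mulr_suml.
have [->|fj] := eqVneq (f j) 0; first by rewrite normr0 expr0n/= mulr0 powR0 ?gt_eqF// mulr0.
have fj0 : 0 < `|f j| by rewrite normr_gt0.
apply: le_trans (ler_wpM2r (exprn_ge0 2 (ltW fj0)) (sum_dyadic_ge K r0 t0 fj0)) _.
have -> : - (2 - p) = p - 2%:R by ring.
by rewrite powRB ?(gt_eqF fj0) ?implybT// powR_mulrn ?(ltW fj0)// -mulrA divfK// expf_neq0// gt_eqF.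
Qed.

(** The image T f is tested against h = sgn (T f) |T f|^(p-1), whose p'-norm is
    the p-norm of T f. Young's inequality with a weight s splits the pairing of f
    with the transposed image of h, and s is chosen so large that the second term
    is absorbed. *)
Lemma discrete_duality a C p f : 0 <= C -> 1 < p ->
  (forall h, \sum_i `|\sum_j a j i * h j| `^ (p / (p - 1)) <=
     C * \sum_j `|h j| `^ (p / (p - 1))) ->
  \sum_i `|\sum_j a i j * f j| `^ p <= 2 * (2 * C + 1) `^ (p - 1) * \sum_j `|f j| `^ p.
Proof.
move=> C0 p1 aC; set p' := p / (p - 1).
have p0 : 0 < p by lra.
have q0 : 0 < p - 1 by lra.
have p'0 : 0 < p' by rewrite divr_gt0.
pose T f i := \sum_j a i j * f j.
pose h i := Num.sg (T f i) * `|T f i| `^ (p - 1).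
have hE i : `|h i| = `|T f i| `^ (p - 1).
  rewrite normrM (ger0_norm (powR_ge0 _ _)) normr_sg.
  by case: eqVneq => [->|]; rewrite ?mul1r// normr0 powR0 ?mulr0// gt_eqF.
have hp i : `|h i| `^ p' = `|T f i| `^ p.
  by rewrite hE -powRrM /p'; congr (_ `^ _); field; rewrite gt_eqF.
have Th i : h i * T f i = `|T f i| `^ p.
  rewrite /h mulrAC -[X in X * _]mulrC mulrC -normrEsg.
  have [->|Ti] := eqVneq (T f i) 0; first by rewrite normr0 mul0r powR0 ?gt_eqF.
  rewrite [LHS]mulrC powRB ?normr_eq0 ?Ti ?implybT// powRr1// divfK// normr_eq0//.
set X := \sum_i `|T f i| `^ p.
have X0 : 0 <= X by apply: sumr_ge0 => *; exact: powR_ge0.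
pose s := (2 * C + 1) `^ p'^-1.
have D0 : 0 < 2 * C + 1 by lra.
have s0 : 0 < s by exact: powR_gt0.
have XE : X = \sum_j f j * (\sum_i a i j * h i).
  rewrite /X; under eq_bigr do rewrite -Th mulr_sumr.
  rewrite exchange_big; apply: eq_bigr => j _ /=; rewrite mulr_sumr.
  by apply: eq_bigr => i _; ring.
have h1 : X <= s `^ p * (\sum_j `|f j| `^ p) + s `^ (- p') * (C * X).
  have := aC h; under [X in _ <= _ * X]eq_bigr do rewrite hp.
  move=> /(ler_wpM2l (powR_ge0 s (- p'))) /(lerD (lexx (s `^ p * \sum_j `|f j| `^ p))).
  apply: le_trans; rewrite XE !mulr_sumr -big_split/=; apply: ler_sum => j _.
  apply: le_trans (ler_norm _) _; rewrite normrM.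
  set y := `|\sum_i _|.
  have -> : `|f j| * y = (s * `|f j|) * (s^-1 * y) by field; rewrite gt_eqF.
  apply: le_trans (@conjugate_powR _ _ _ p p' _ _ _ _ _) _ => //.
  - by rewrite mulr_ge0// (ltW s0).
  - by rewrite mulr_ge0 ?invr_ge0 ?(ltW s0) ?normr_ge0.
  - by rewrite /p'; field; rewrite !gt_eqF.
  have sV : s^-1 `^ p' = s `^ (- p') by rewrite powRVN// ltW.
  rewrite [(s * _) `^ _]powRM ?(ltW s0)// [(s^-1 * y) `^ _]powRM ?invr_ge0 ?(ltW s0) ?normr_ge0// sV.
  have p'1 : 1 <= p' by rewrite /p' ler_pdivlMr// mul1r; lra.
  by apply: lerD; rewrite ler_pdivrMr// ler_peMr ?mulr_ge0 ?powR_ge0// ltW.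
have h2 : s `^ (- p') * (C * X) <= X / 2.
  have -> : s `^ (- p') = (2 * C + 1)^-1.
    by rewrite /s -powRrM mulrN mulVf ?gt_eqF// powR_inv1// ltW.
  by rewrite mulrC ler_pdivrMr//; nra.
have -> : (2 * C + 1) `^ (p - 1) = s `^ p.
  by rewrite /s -powRrM; congr (_ `^ _); rewrite /p'; field; rewrite !gt_eqF.
lra.
Qed.

(** The case p = 2 of the same argument, which keeps the constant. *)
Lemma discrete_L2_adjoint a M f : 0 < M ->
  (forall h, \sum_i (\sum_j a i j * h j) ^+ 2 <= M * \sum_j h j ^+ 2) ->
  \sum_i (\sum_j a j i * f j) ^+ 2 <= M * \sum_j f j ^+ 2.
Proof.
move=> M0 aM; pose u i := \sum_j a j i * f j.
have h : \sum_i u i ^+ 2 = \sum_j f j * \sum_i a j i * u i.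
  under eq_bigr do rewrite expr2 {1}/u mulr_suml.
  rewrite exchange_big; apply: eq_bigr => j _ /=; rewrite mulr_sumr.
  by apply: eq_bigr => i _; ring.
have h1 : \sum_i u i ^+ 2 <= (M / 2) * (\sum_j f j ^+ 2) + (2 * M)^-1 * \sum_j (\sum_i a j i * u i) ^+ 2.
  rewrite h !mulr_sumr -big_split/=; apply: ler_sum => j _.
  set x := f j; set y := \sum_i _.
  have := sqr_ge0 (M * x - y); rewrite -subr_ge0 => h0.
  have -> : M / 2 * x ^+ 2 + (2 * M)^-1 * y ^+ 2 - x * y = (2 * M)^-1 * (M * x - y) ^+ 2.
    by field; rewrite gt_eqF.
  by rewrite mulr_ge0 ?sqr_ge0// invr_ge0 mulr_ge0// ltW.
have h2 : (2 * M)^-1 * (\sum_j (\sum_i a j i * u i) ^+ 2) <= 2^-1 * \sum_i u i ^+ 2.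
  rewrite mulrC ler_pdivrMr ?mulr_gt0//; apply: le_trans (aM u) _.
  by rewrite le_eqVlt; apply/orP; left; apply/eqP; field.
by rewrite -/(u _); lra.
Qed.

End discrete_Lp.

(** * Singular matrices indexed by dyadic cells *)

Section dyadic_index.
Context {n m : nat}.
Local Notation I := {ffun 'I_n -> 'I_(2 ^ m)}.
Implicit Types (i j : I) (k : nat).

Let corner_subproof k (x : 'I_(2 ^ m)) : (x %/ 2 ^ k * 2 ^ k < 2 ^ m)%N.
Proof. exact: leq_ltn_trans (leq_trunc_div _ _) (ltn_ord x). Qed.

(** The cells are the points of a grid, and the dyadic cubes of 2^k cells per side
    are the classes of level k; a cube is represented by its lowest cell. *)
Definition corner k i : I := [ffun l => Ordinal (corner_subproof k (i l))].

Lemma cornerP k i j :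
  corner k i = corner k j <-> forall l, (i l %/ 2 ^ k = j l %/ 2 ^ k)%N.
Proof.
split => [/ffunP h l|h]; last by apply/ffunP => l; rewrite !ffunE; apply/val_inj; rewrite /= h.
have := h l; rewrite !ffunE => /(congr1 val)/= /eqP.
by rewrite eqn_pmul2r ?expn_gt0// => /eqP.
Qed.

Lemma corner0 i : corner 0 i = i.
Proof. by apply/ffunP => l; rewrite ffunE; apply/val_inj; rewrite /= expn0 divn1 muln1. Qed.

Lemma cornerS k i j : corner k i = corner k j -> corner k.+1 i = corner k.+1 j.
Proof. by move=> /cornerP h; apply/cornerP => l; rewrite expnSr !divnMA h. Qed.

Lemma corner_top i j : corner m i = corner m j.
Proof. by apply/cornerP => l; rewrite !divn_small. Qed.

Lemma corner_dist k j l : (`|(j l : int) - corner k j l| <= 2 ^ k)%N.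
Proof.
rewrite ffunE/=; have := ltn_pmod (j l) (expn_gt0 2 k); have := divn_eq (j l) (2 ^ k).
lia.
Qed.

Lemma card_ord_interval N (u v : nat) : (u + v <= N)%N ->
  #|[pred x : 'I_N | (u <= x < u + v)%N]| = v.
Proof.
move=> uvN; have h (r : 'I_v) : (u + r < N)%N by have := ltn_ord r; lia.
rewrite -[RHS]card_ord -(@card_imset _ _ (fun r => Ordinal (h r))); last first.
  by move=> r r' /(congr1 val)/= /addnI/val_inj.
apply: eq_card => x; rewrite inE; apply/idP/imsetP => [/andP[ux xv]|[r _ ->]/=].
  have hx : (x - u < v)%N by lia.
  by exists (Ordinal hx) => //; apply/val_inj => /=; lia.
by have := ltn_ord r; lia.
Qed.

Lemma card_corner_class k i : (k <= m)%N ->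
  #|[set j | corner k j == corner k i]| = ((2 ^ n) ^ k)%N.
Proof.
move=> km.
have -> : #|[set j | corner k j == corner k i]| =
    #|family (fun l => [pred x : 'I_(2 ^ m) | (x %/ 2 ^ k == i l %/ 2 ^ k)%N])|.
  apply: eq_card => j; rewrite inE; apply/eqP/familyP => [/cornerP h l|h].
    by rewrite inE h.
  by apply/cornerP => l; have := h l; rewrite inE => /eqP.
rewrite card_family (_ : [seq _ | _ : _] = nseq n (2 ^ k)%N).
  by elim: n => [|n' IH]; rewrite ?expn0 ?exp1n//= IH expnS expnMn.
have eq_nseq : forall s : seq 'I_n, [seq (2 ^ k)%N | _ <- s] = nseq (size s) (2 ^ k)%N.
  by elim=> //= _ s ->.
rewrite -[in RHS](size_enum_ord n) -eq_nseq; apply: eq_map => l.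
rewrite -[RHS](@card_ord_interval (2 ^ m) (i l %/ 2 ^ k * 2 ^ k)); last first.
  rewrite addnC -mulSn -[leqRHS](divnK (dvdn_exp2l 2 km)) leq_mul2r; apply/orP; right.
  by rewrite ltn_divLR ?expn_gt0// divnK ?dvdn_exp2l.
apply: eq_card => x; rewrite !inE.
rewrite eqn_leq andbC; congr (_ && _); first by rewrite leq_divRL ?expn_gt0.
by rewrite -ltnS ltn_divLR ?expn_gt0// mulSn addnC.
Qed.

Lemma card_index_ball (S : {set I}) (i0 : I) d :
  (forall i, i \in S -> forall l, (`|(i l : int) - i0 l| <= d)%N) ->
  (#|S| <= (2 * d + 1) ^ n)%N.
Proof.
move=> h; pose F l := [pred x : 'I_(2 ^ m) | (`|(x : int) - i0 l| <= d)%N].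
have cF l : (#|F l| <= 2 * d + 1)%N.
  rewrite cardE -(size_map (@nat_of_ord _)) -(size_iota (i0 l - d) (2 * d + 1)).
  apply: uniq_leq_size; first by rewrite map_inj_uniq ?enum_uniq//; exact: val_inj.
  by move=> x /mapP[y]; rewrite mem_enum mem_iota inE => hy ->; move: hy; lia.
have sub : S \subset family F.
  by apply/fintype.subsetP => i /h hi; apply/familyP => l; rewrite inE.
apply: leq_trans (subset_leq_card sub) _; rewrite card_family.
rewrite -[X in (_ <= _ ^ X)%N](size_enum_ord n) /image_mem.
elim: (enum 'I_n) => [|x s IH] /=; first by rewrite expn0.
by rewrite expnS leq_mul// cF.
Qed.

End dyadic_index.

(** The shell where rho is about 2^k s has at most C0 (2^(k+1) s)^n elements, each
    contributing (2^k)^-delta (2^k s)^-n; the powers of s cancel and the sum over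
    k is geometric. *)
Lemma sum_outer_shells (R : realType) (J : finType) (rho : J -> R) (n : nat) (C0 delta s : R) :
  0 < delta -> 0 < s -> 0 <= C0 ->
  (forall t, s <= t -> #|[set i | rho i <= t]|%:R <= C0 * t ^+ n) ->
  \sum_(i | s <= rho i) s `^ delta * rho i `^ (- n%:R - delta) <= C0 * 2 ^+ n * geo delta.
Proof.
move=> d0 s0 C00 growth.
have [K hK] := dyadic_bound (\sum_i `|rho i|) s0.
have rK i : rho i < s * 2 ^+ K.
  apply: le_lt_trans hK; apply: le_trans (ler_norm _) _.
  by apply: (ge0_bound_sum (F := fun i => `|rho i|)) => j; exact: normr_ge0.
pose l k := s * 2 ^+ k.
have l0 k : 0 < l k by rewrite mulr_gt0// exprn_gt0.
have sl k : s <= l k by rewrite ler_peMr ?(ltW s0)// exprn_ege1// ler1n.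
set e := - n%:R - delta.
have e0 : 0 <= - e by rewrite opprB opprK addr_ge0// ltW.
have le i : s <= rho i ->
    rho i `^ e <= \sum_(k < K | rho i <= l k.+1) l k `^ e.
  move=> si; have [k /andP[k1 k2]] := dyadic_locate s0 si (rK i).
  rewrite (bigD1 k) ?(ltW k2)//= -[leLHS]addr0 lerD//; last first.
    by apply: sumr_ge0 => *; exact: powR_ge0.
  rewrite -[e]opprK !(powRN _ (- e)) lef_pV2 ?posrE ?powR_gt0 ?(lt_le_trans s0 si)//.
  by rewrite ge0_ler_powR ?nnegrE// ltW// (lt_le_trans s0).
apply: (@le_trans _ _ (s `^ delta * \sum_(i | s <= rho i) \sum_(k < K | rho i <= l k.+1) l k `^ e)).
  by rewrite mulr_sumr; apply: ler_sum => i si; rewrite ler_wpM2l ?powR_ge0 ?le.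
rewrite (exchange_big_dep predT)//=.
apply: (@le_trans _ _ (s `^ delta * \sum_(k < K) C0 * 2 ^+ n * l k `^ (- delta))).
  rewrite ler_wpM2l ?powR_ge0//; apply: ler_sum => k _.
  rewrite sumr_const -[leLHS]mulr_natl.
  apply: (@le_trans _ _ (C0 * (l k.+1) ^+ n * l k `^ e)).
    rewrite ler_wpM2r ?powR_ge0//; apply: le_trans (growth _ (sl _)).
    rewrite ler_nat subset_leq_card//; apply/fintype.subsetP => i.
    by rewrite inE => /andP[].
  rewrite -[leLHS]mulrA -[leRHS]mulrA ler_wpM2l//.
  have -> : l k.+1 = 2 * l k by rewrite /l exprS mulrCA.
  rewrite exprMn -[leLHS]mulrA ler_wpM2l ?exprn_ge0//.
  rewrite -powR_mulrn ?(ltW (l0 k))// -powRD ?(gt_eqF (l0 k)) ?implybT//.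
  by rewrite /e addrA subrr add0r.
rewrite -mulr_sumr mulrCA ler_wpM2l ?mulr_ge0 ?exprn_ge0//.
apply: le_trans (ler_wpM2l (powR_ge0 _ _) (sum_dyadic_desc K d0 s0)) _.
by rewrite mulrCA powRN mulfV ?mulr1// gt_eqF// powR_gt0.
Qed.

Section discrete_singular_integral.
Context {R : realType} (n : nat).
Variables (M A delta C0 c : R).
Hypothesis M0 : 0 < M.
Hypothesis A0 : 0 <= A.
Hypothesis delta0 : 0 < delta.
Hypothesis C00 : 0 <= C0.
Hypothesis c1 : 1 <= c.
Local Notation I m := {ffun 'I_n -> 'I_(2 ^ m)}.

(** Here rho i j is the distance of the pair of cells (i, j) to the singular set,
    measured in cells. The first condition says that the singular set is sparse
    in each column, the second that the rows are smooth away from it. *)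
Definition half_kernel m (a rho : I m -> I m -> R) :=
  (forall t (j : I m), 1 <= t -> #|[set i | rho i j <= t]|%:R <= C0 * t ^+ n) /\
  (forall (i j j' : I m) (d : nat), (0 < d)%N -> (forall l, (`|(j l : int) - j' l| <= d)%N) ->
     c * d%:R <= rho i j ->
     `|a i j - a i j'| <= A * d%:R `^ delta * rho i j `^ (- n%:R - delta)).

Definition discrete_kernel m (a rho : I m -> I m -> R) :=
  [/\ forall f, \sum_i (\sum_j a i j * f j) ^+ 2 <= M * \sum_j f j ^+ 2,
      half_kernel a rho & half_kernel (fun i j => a j i) (fun i j => rho j i)].

(** The terms come from the four parts of the decomposition in
    [discrete_weak_type], the exceptional sets being where rho is less than c
    times the side of the cube. *)
Definition weak_const : R :=
  1 + C0 * c ^+ n + 4 * (A * (C0 * 2 ^+ n * geo delta)) + 4 * M * (2 ^ n)%:R.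

Lemma discrete_kernel_weak m (a rho : I m -> I m -> R) f l : 0 < l ->
  discrete_kernel a rho ->
  l * #|[set i | l <= `|\sum_j a i j * f j|]|%:R <= weak_const * \sum_j `|f j|.
Proof.
move=> l0 [aL2 [growth reg] _].
have c0 : 0 < c by exact: lt_le_trans c1.
have cX k : 1 <= c * (2 ^ k)%:R.
  by rewrite -[leLHS]mulr1 ler_pM// ler1n expn_gt0.
have geo0 := ltW (geo_gt0 delta0).
have := (@discrete_weak_type _ _ (@corner n m) m (2 ^ n)%N (@corner0 _ _) (@cornerS _ _)
  (@corner_top _ _) _ (@card_corner_class _ _)
  a M (C0 * c ^+ n) (A * (C0 * 2 ^+ n * geo delta))
  (fun k j => [set i | rho i j < c * (2 ^ k)%:R])); apply => //.
- by rewrite expn_gt0.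
- exact: ltW.
- by rewrite mulr_ge0 ?exprn_ge0// ltW.
- by rewrite !mulr_ge0 ?exprn_ge0.
- move=> k j _; apply: (@le_trans _ _ #|[set i | rho i (corner k j) <= c * (2 ^ k)%:R]|%:R).
    rewrite ler_nat subset_leq_card//; apply/fintype.subsetP => i.
    by rewrite !inE => /ltW.
  apply: le_trans (growth _ _ (cX k)) _.
  by rewrite exprMn -mulrA ler_wpM2l// -natrX -!expnM mulnC.
- move=> k j _; set j0 := corner k j; set s := c * (2 ^ k)%:R.
  have s0 : 0 < s by exact: lt_le_trans (cX k).
  apply: (@le_trans _ _ (\sum_(i | s <= rho i j0) A * (s `^ delta * rho i j0 `^ (- n%:R - delta)))).
    rewrite (eq_bigl (fun i => s <= rho i j0)); last by move=> i; rewrite inE -leNgt.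
    apply: ler_sum => i si; rewrite distrC.
    apply: le_trans (reg i j0 j (2 ^ k)%N _ _ si) _; first by rewrite expn_gt0.
      by move=> l'; rewrite distnC; exact: corner_dist.
    rewrite -mulrA ler_wpM2l// ler_wpM2r ?powR_ge0// ge0_ler_powR ?nnegrE ?(ltW delta0)//.
      exact: ltW.
    by rewrite ler_peMl.
  rewrite -mulr_sumr ler_wpM2l//.
  apply: (@sum_outer_shells _ _ (fun i => rho i j0)) => // t st.
  exact: growth (le_trans (cX k) st).
Qed.

(** Interpolation below 2 and, above 2, interpolation for the transposed matrix at
    the conjugate exponent followed by duality. *)
Definition strong_const p : R :=
  let m' := marcinkiewicz_const weak_const M in
  if p < 2 then m' p else if p == 2 then M else 2 * (2 * m' (p / (p - 1)) + 1) `^ (p - 1).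

Let weak_const0 : 0 <= weak_const.
Proof.
have geo0 := ltW (geo_gt0 delta0).
have c0 : 0 < c by exact: lt_le_trans c1.
by rewrite /weak_const !addr_ge0// !mulr_ge0// ?exprn_ge0// ltW.
Qed.

Lemma discrete_kernel_strong m (a rho : I m -> I m -> R) p f : 1 < p ->
  discrete_kernel a rho ->
  \sum_i `|\sum_j a i j * f j| `^ p <= strong_const p * \sum_j `|f j| `^ p.
Proof.
move=> p1 arho; have [aL2 h1 h2] := arho.
rewrite /strong_const; case: ltP => p2.
  apply: discrete_marcinkiewicz => //; [exact: ltW|by rewrite p1|].
  by move=> h l l0; exact: (discrete_kernel_weak h l0 arho).
case: eqP => [->|/eqP pn2].
  under eq_bigr do rewrite powR_mulrn// real_normK ?num_real//.
  under [X in _ <= _ * X]eq_bigr do rewrite powR_mulrn// real_normK ?num_real//.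
  exact: aL2.
have {}p2 : 2 < p by rewrite lt_neqAle eq_sym pn2.
have p'12 : 1 < p / (p - 1) < 2.
  by rewrite ltr_pdivlMr ?ltr_pdivrMr; lra.
have M0' := ltW M0.
apply: discrete_duality => //.
  rewrite /marcinkiewicz_const mulr_ge0 ?powR_ge0// addr_ge0// !mulr_ge0//.
    by rewrite ltW// geo_gt0//; lra.
  by rewrite ltW// geo_gt0//; lra.
move=> h; apply: (discrete_marcinkiewicz (a := fun i j => a j i)) => //.
  by move=> g; exact: discrete_L2_adjoint.
move=> g l l0; apply: (@discrete_kernel_weak _ (fun i j => a j i) (fun i j => rho j i)) => //.
by split => // g'; exact: discrete_L2_adjoint.
Qed.

End discrete_singular_integral.

Local Open Scope classical_set_scope.

(** * Integrals of powers *)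

Section power_integral.
Context {d : measure_display} {T : measurableType d} {R : realType}.
Variable mu : {measure set T -> \bar R}.
Implicit Types (f g : T -> R) (p : R) (A : set T).

(** The p-th power of the norm of L^p, which avoids roots and is additive up to a
    factor 2^p. *)
Definition Ip p f : \bar R := (\int[mu]_x (`|f x| `^ p)%:E)%E.

Lemma measurable_pow p A f : measurable_fun A f ->
  measurable_fun A (fun x => (`|f x| `^ p)%:E).
Proof.
move=> mf; apply/measurable_EFinP.
apply: (measurableT_comp (f := @powR R ^~ p)); first exact: measurable_powR.
exact: measurableT_comp.
Qed.

Lemma IpE p f : Ip p f = (\int[mu]_x (`|f x| `^ p)%:E)%E. Proof. by []. Qed.

Lemma Ip_ge0 p f : (0 <= Ip p f)%E.
Proof. by apply: integral_ge0 => x _; rewrite lee_fin powR_ge0. Qed.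

Lemma Ip_ae_le p f g : 0 <= p -> measurable_fun setT f -> measurable_fun setT g ->
  {ae mu, forall x, `|f x| <= `|g x|} -> (Ip p f <= Ip p g)%E.
Proof.
move=> p0 mf mg fg; apply: ae_ge0_le_integral => //.
- exact: measurable_pow.
- exact: measurable_pow.
- by apply: filterS fg => x h _; rewrite lee_fin ge0_ler_powR// nnegrE.
Qed.

Lemma Ip_le p f g : 0 <= p -> measurable_fun setT f -> measurable_fun setT g ->
  (forall x, `|f x| <= `|g x|) -> (Ip p f <= Ip p g)%E.
Proof. by move=> p0 mf mg fg; apply: Ip_ae_le => //; exact: nearW. Qed.

Lemma Ip_ae_eq p f g : 0 <= p -> measurable_fun setT f -> measurable_fun setT g ->
  {ae mu, forall x, f x = g x} -> Ip p f = Ip p g.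
Proof.
move=> p0 mf mg fg; apply/eqP; rewrite eq_le; apply/andP; split; apply: Ip_ae_le => //.
  by apply: filterS fg => x ->.
by apply: filterS fg => x ->.
Qed.

Lemma powR_quasi_triangle p (a b : R) : 0 <= p -> 0 <= a -> 0 <= b ->
  (a + b) `^ p <= 2 `^ p * (a `^ p + b `^ p).
Proof.
move=> p0; wlog ab : a b / a <= b => [h|a0 b0].
  by case: (leP a b) => [|/ltW] ab a0 b0; [|rewrite addrC (addrC (a `^ p))]; apply: h.
apply: (@le_trans _ _ ((2 * b) `^ p)).
  by rewrite ge0_ler_powR ?nnegrE ?addr_ge0 ?mulr_ge0//; lra.
by rewrite powRM// ler_wpM2l ?powR_ge0// lerDr powR_ge0.
Qed.

Lemma Ip_add p f g : 0 <= p -> measurable_fun setT f -> measurable_fun setT g ->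
  (Ip p (fun x => f x + g x)%R <= (2 `^ p)%:E * (Ip p f + Ip p g))%E.
Proof.
move=> p0 mf mg; rewrite /Ip -ge0_integralD//; last 2 first.
- exact: measurable_pow.
- exact: measurable_pow.
have mD : measurable_fun setT (fun x => (`|f x| `^ p)%:E + (`|g x| `^ p)%:E)%E.
  by apply: emeasurable_funD; exact: measurable_pow.
rewrite -ge0_integralZl ?lee_fin ?powR_ge0//; last first.
  by move=> x _; rewrite -EFinD lee_fin addr_ge0 ?powR_ge0.
apply: ge0_le_integral => //.
- by apply: measurable_pow; exact: measurable_funD.
- exact: measurable_funeM.
move=> x _; rewrite -EFinD -EFinM lee_fin.
apply: le_trans (powR_quasi_triangle p0 (normr_ge0 _) (normr_ge0 _)).
by rewrite ge0_ler_powR ?nnegrE ?addr_ge0// ler_normD.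
Qed.

Lemma Ip_opp p f : Ip p (fun x => - f x) = Ip p f.
Proof. by apply: eq_integral => x _; rewrite normrN. Qed.

Lemma Ip_sub p f g : 0 <= p -> measurable_fun setT f -> measurable_fun setT g ->
  (Ip p (fun x => f x - g x)%R <= (2 `^ p)%:E * (Ip p f + Ip p g))%E.
Proof.
move=> p0 mf mg; rewrite -[X in (_ + X)%E](Ip_opp _ g).
by apply: Ip_add => //; exact: measurableT_comp.
Qed.

Lemma Ip_distC p f g : Ip p (fun x => f x - g x) = Ip p (fun x => g x - f x).
Proof. by apply: eq_integral => x _; rewrite distrC. Qed.

Lemma Ip_scale p a f : measurable_fun setT f ->
  Ip p (fun x => a * f x) = ((`|a| `^ p)%:E * Ip p f)%E.
Proof.
move=> mf; rewrite /Ip -ge0_integralZl ?lee_fin ?powR_ge0//.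
- by apply: eq_integral => x _; rewrite normrM powRM// EFinM.
- exact: measurable_pow.
Qed.

Lemma chebyshev_Ip p f l : 0 < p -> 0 < l -> measurable_fun setT f ->
  ((l `^ p)%:E * mu [set x | (l <= `|f x|)%R] <= Ip p f)%E.
Proof.
move=> p0 l0 mf; have := @le_integral_abse _ _ _ mu _ measurableT _ (l `^ p)
  (measurable_pow p mf) (powR_gt0 _ l0).
rewrite setTI (_ : [set x | _] = [set x | l <= `|f x|]); last first.
  apply/seteqP; split => x /=; rewrite lee_fin (ger0_norm (powR_ge0 _ _)).
    apply: contraTT; rewrite -!ltNge => h; rewrite gt0_ltr_powR// ?nnegrE//.
    exact: ltW.
  by move=> h; rewrite ge0_ler_powR ?nnegrE ?(ltW p0) ?(ltW l0).
move=> /le_trans; apply; rewrite le_eqVlt; apply/orP; left; apply/eqP.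
by apply: eq_integral => x _; rewrite abse_EFin (ger0_norm (powR_ge0 _ _)).
Qed.

Lemma measurable_level l f : measurable_fun setT f -> measurable [set x | l <= `|f x|].
Proof.
move=> mf; rewrite -[X in measurable X]setTI.
have -> : [set x | l <= `|f x|] = (fun x => `|f x|) @^-1` `[l, +oo[.
  by apply/seteqP; split => x /=; rewrite in_itv/= andbT.
by have := measurableT_comp (@normr_measurable R setT) mf; apply.
Qed.

(** Finite p-energy with p at least 1 on a set of finite measure gives
    integrability, since |f| <= 1 + |f|^p. *)
Lemma Ip_integrable p A f : 1 <= p -> measurable A -> (mu A < +oo)%E ->
  measurable_fun setT f -> (Ip p f < +oo)%E -> mu.-integrable A (EFin \o f).
Proof.
move=> p1 mA Afin mf ffin; have mfA := measurable_funTS (D := A) mf.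
have h : mu.-integrable A (fun x => (1 + `|f x| `^ p)%:E).
  rewrite (_ : (fun x => _) = (fun x => 1%:E + (`|f x| `^ p)%:E)%E); last by apply/funext.
  apply: integrableD => //.
    apply/integrableP; split; first exact: measurable_cst.
    under eq_integral do rewrite abse_EFin normr1.
    by rewrite integral_cst// mul1e.
  apply/integrableP; split; first exact: measurable_pow.
  apply: le_lt_trans ffin.
  under eq_integral do rewrite abse_EFin (ger0_norm (powR_ge0 _ _)).
  by apply: ge0_subset_integral => //; exact: measurable_pow.
apply: le_integrable h => //; first exact/measurable_EFinP.
move=> x _; rewrite /= lee_fin [leRHS]ger0_norm ?addr_ge0 ?powR_ge0//.
have [f1|f1] := leP `|f x| 1; first by rewrite (le_trans f1)// lerDl powR_ge0.
apply: (@le_trans _ _ (`|f x| `^ p)); last by rewrite lerDr.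
by rewrite -{1}(powRr1 (normr_ge0 (f x))) ler_powR// ltW.
Qed.

(** Jensen's inequality for the mean over A, through Young's inequality
    t^(p-1) |f| <= |f|^p / p + t^p / q at the mean t. *)
Lemma Ip_mean p A f (v : R) : 1 <= p -> measurable A -> mu A = v%:E -> 0 < v ->
  measurable_fun setT f -> mu.-integrable A (EFin \o f) ->
  ((v * `|(\int[mu]_(x in A) f x)%R / v| `^ p)%:E <= \int[mu]_(x in A) (`|f x| `^ p)%:E)%E.
Proof.
move=> p1 mA Av v0 mf iF; have mfA := measurable_funTS (D := A) mf.
have p0 : 0 < p by apply: lt_le_trans p1.
set t := `|_ / v|; have t0 : 0 <= t by exact: normr_ge0.
have tle : t * v <= (\int[mu]_(x in A) `|f x|)%R.
  rewrite /t normrM [X in _ * X * _]gtr0_norm ?invr_gt0// divfK ?gt_eqF//.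
  exact: le_normr_Rintegral.
have [|fin] := leP +oo%E (\int[mu]_(x in A) (`|f x| `^ p)%:E)%E.
  by rewrite leye_eq => /eqP ->; rewrite leey.
have iN : mu.-integrable A (EFin \o (fun x => `|f x|)) by exact: integrable_norm.
have iP : mu.-integrable A (EFin \o (fun x => `|f x| `^ p)).
  apply/integrableP; split; first exact: measurable_pow.
  by under eq_integral do rewrite /= (ger0_norm (powR_ge0 _ _)).
have icst a : mu.-integrable A (EFin \o (fun=> a)).
  apply/integrableP; split; first exact/measurable_EFinP.
  under eq_integral do rewrite /=.
  by rewrite integral_cst//= Av -EFinM ltry.
have iE : (\int[mu]_(x in A) (`|f x| `^ p)%:E)%E = (\int[mu]_(x in A) (`|f x| `^ p))%R%:E.
  rewrite /Rintegral fineK// ge0_fin_numE//; apply: integral_ge0 => x _.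
  by rewrite lee_fin powR_ge0.
rewrite iE lee_fin.
(* the tangent line of s |-> s^p at s = t lies below the graph *)
have young s : 0 <= s -> p * t `^ (p - 1) * s - (p - 1) * t `^ p <= s `^ p.
  move=> s0; have [->|tn0] := eqVneq t 0.
    rewrite (@powR0 _ p) ?gt_eqF// mulr0 subr0.
    have [->|pn1] := eqVneq p 1; first by rewrite subrr powRr0 !mul1r powRr1.
    by rewrite powR0 ?subr_eq0// mulr0 mul0r powR_ge0.
  have t1 : 0 < t by rewrite lt_neqAle eq_sym tn0.
  have [pE|pn1] := eqVneq p 1.
    by rewrite pE subrr powRr0 !mul1r mul0r subr0 powRr1.
  have q0 : 0 < p - 1 by rewrite subr_gt0 lt_neqAle eq_sym pn1.
  have := @conjugate_powR R s (t `^ (p - 1)) p (p / (p - 1)) s0 (powR_ge0 _ _) p0 (divr_gt0 p0 q0).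
  rewrite -powRrM (_ : (p - 1) * (p / (p - 1)) = p); last by field; rewrite gt_eqF.
  rewrite (_ : p^-1 + _ = 1); last by field; rewrite !gt_eqF.
  move=> /(_ erefl); rewrite -(ler_pM2l p0) mulrDr.
  rewrite (_ : p * (s `^ p / p) = s `^ p); last by field; rewrite gt_eqF.
  rewrite (_ : p * (t `^ p / (p / (p - 1))) = (p - 1) * t `^ p); last by field; rewrite !gt_eqF.
  lra.
have h : (\int[mu]_(x in A) (p * t `^ (p - 1) * `|f x| - (p - 1) * t `^ p) <=
          \int[mu]_(x in A) (`|f x| `^ p))%R.
  apply: le_Rintegral => //.
    rewrite (_ : _ \o _ = (fun x => (p * t `^ (p - 1))%:E * (`|f x|)%:E - ((p - 1) * t `^ p)%:E)%E) //.
    by apply: integrableB => //; [exact: integrableZl|exact: icst].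
  by move=> x _; exact: young.
apply: le_trans h; rewrite RintegralB//; last first.
  exact: (@integrableZl _ _ _ mu _ mA (p * t `^ (p - 1)) (EFin \o (fun x => `|f x|))).
rewrite RintegralZl// Rintegral_cst// Av/=.
apply: (@le_trans _ _ (p * t `^ (p - 1) * (t * v) - (p - 1) * t `^ p * v)).
  have -> : p * t `^ (p - 1) * (t * v) = p * t `^ p * v.
    have [->|tn0] := eqVneq t 0; first by rewrite mul0r (@powR0 _ p) ?gt_eqF// !mulr0 mul0r.
    rewrite powRB ?tn0 ?implybT// powRr1//; field.
    by rewrite tn0.
  by rewrite le_eqVlt; apply/orP; left; apply/eqP; ring.
by rewrite lerD2r ler_wpM2l// mulr_ge0 ?powR_ge0// ltW.
Qed.

End power_integral.

(** * Convergence in measure *)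

Lemma continuous_norm_powR (R : realType) (p : R) : 0 < p ->
  continuous (fun y : R => `|y| `^ p).
Proof.
move=> p0 y; have [->|y0] := eqVneq y 0; last first.
  apply: (@continuous_comp _ _ _ (fun y : R => `|y|) (fun y => y `^ p)).
    exact: norm_continuous.
  apply/differentiable_continuous/derivable1_diffP.
  by have := @is_derive1_powR R p `|y|; rewrite normr_gt0 => /(_ y0) [].
apply/cvgrPdist_lt => e e0; rewrite normr0 powR0 ?gt_eqF//.
have h : \forall t \near (0 : R), `|t| < e `^ p^-1 by apply: nbhs0_lt; exact: powR_gt0.
apply: filterS h => t tE; rewrite sub0r normrN ger0_norm ?powR_ge0//.
have -> : e = (e `^ p^-1) `^ p by rewrite -powRrM mulVf ?gt_eqF// powRr1// ltW.
by rewrite gt0_ltr_powR// nnegrE// powR_ge0.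
Qed.

Section convergence_in_measure.
Context {d : measure_display} {T : measurableType d} {R : realType}.
Variable mu : {measure set T -> \bar R}.
Implicit Types (f g : T -> R) (F : nat -> T -> R) (p : R).
Local Open Scope ereal_scope.

Definition cvg_mu F f := forall e : R, (0 < e)%R ->
  mu [set x | (e <= `|F k x - f x|)%R] @[k --> \oo] --> 0.

Lemma Ip_cvg_mu p F f : (0 < p)%R -> (forall k, measurable_fun setT (F k)) ->
  measurable_fun setT f ->
  Ip mu p (fun x => F k x - f x)%R @[k --> \oo] --> 0 -> cvg_mu F f.
Proof.
move=> p0 mF mf Ff e e0.
have ep : (0 < (e `^ p)^-1)%R by rewrite invr_gt0 powR_gt0.
apply: (@squeeze_cvge _ _ _ _ (fun=> 0) _ (fun k => ((e `^ p)^-1)%:E * Ip mu p (fun x => F k x - f x)%R)).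
- apply: nearW => k; rewrite measure_ge0/=.
  have := chebyshev_Ip mu p0 e0 (measurable_funB (mF k) mf).
  move=> /(lee_wpmul2l (x := ((e `^ p)^-1)%:E)); rewrite lee_fin (ltW ep) => /(_ isT).
  by rewrite muleA -EFinM mulVf ?mul1e// gt_eqF// powR_gt0.
- exact: cvg_cst.
- rewrite -[X in _ --> X](mule0 ((e `^ p)^-1)%:E).
  by apply: cvgeZl => //.
Qed.

(** A sequence convergent in measure has an almost everywhere convergent
    subsequence: pick it with summable measures of the exceptional sets. *)
Lemma cvg_mu_subseq F f : (forall k, measurable_fun setT (F k)) ->
  measurable_fun setT f -> cvg_mu F f ->
  exists s : nat -> nat, (forall j, (j <= s j)%N) /\
    {ae mu, forall x, F (s j) x @[j --> \oo] --> f x}.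
Proof.
move=> mF mf Ff.
have e0 j : (0 < (2^-1 : R) ^+ j)%R by rewrite exprn_gt0.
have h j : exists k, (j <= k)%N /\
    mu [set x | ((2^-1) ^+ j <= `|F k x - f x|)%R] <= ((2^-1 : R) ^+ j)%:E.
  have := Ff _ (e0 j) => /(@fine_cvgP _ _ _ _ _ _).
  move=> [fin /cvgrPdist_lt/(_ _ (e0 j)) lt].
  have [k [[fk ltk] jk]] := filter_ex (filterI (filterI fin lt) (nbhs_infty_ge j)).
  exists k; split => //; rewrite -[leLHS]fineK// lee_fin.
  by move: ltk; rewrite sub0r normrN => /ltW; apply: le_trans; exact: ler_norm.
have [s hs] := choice h.
exists s; split; first by move=> j; have [] := hs j.
pose A j := [set x | ((2^-1) ^+ j <= `|F (s j) x - f x|)%R].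
have mA j : measurable (A j) by apply: measurable_level; exact: measurable_funB.
have A0 : mu (lim_sup_set A) = 0.
  apply: lim_sup_set_cvg0 => //.
  apply: (@le_lt_trans _ _ (\sum_(0 <= j <oo) ((2^-1 : R) ^+ j)%:E)).
    by apply: lee_nneseries => // j _; have [] := hs j.
  rewrite (_ : \sum_(0 <= j <oo) _ = 2%:E) ?ltry//.
  have -> : (fun n => \sum_(0 <= j < n) ((2^-1 : R) ^+ j)%:E) = EFin \o series (geometric 1 2^-1).
    by apply/funext => m; rewrite /= /series/= -sumEFin; apply: eq_bigr => j _; rewrite mul1r.
  apply/cvg_lim => //; apply: cvg_EFin; first exact: nearW.
  have := @cvg_geometric_series R 1 2^-1; rewrite (_ : 1 / (1 - 2^-1) = 2)%R; last by field.
  by apply; rewrite ger0_norm ?invr_ge0// invf_lt1// ltr1n.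
exists (lim_sup_set A); split => //.
  apply: bigcap_measurable => // k _.
  by apply: bigcup_measurable => j _; exact: mA.
move=> x /= hx; apply: contrapT => nA; apply: hx.
have [m hm] : exists m, forall j, (m <= j)%N -> ~ A j x.
  move: nA; rewrite /lim_sup_set /bigcap/= => /existsNP[m /not_implyP[_ hm]].
  by exists m => j mj Aj; apply: hm; exists j.
apply/cvgrPdist_lt => e ee.
have /cvgrPdist_lt/(_ _ ee) : ((2^-1 : R) ^+ j @[j --> \oo] --> (0 : R))%R.
  by apply: cvg_expr; rewrite ger0_norm ?invr_ge0// invf_lt1// ltr1n.
move=> near_e; near=> j.
rewrite distrC; apply: (@lt_trans _ _ ((2^-1) ^+ j)%R).
  by rewrite ltNge; apply/negP; apply: hm; near: j; exact: nbhs_infty_ge.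
have : (`|0 - 2^-1 ^+ j| < e)%R by near: j.
by rewrite sub0r normrN; apply: le_lt_trans; exact: ler_norm.
Unshelve. all: by end_near. Qed.

Lemma Ip_fatou p F f (C : \bar R) : (0 < p)%R -> (forall k, measurable_fun setT (F k)) ->
  measurable_fun setT f -> {ae mu, forall x, F k x @[k --> \oo] --> f x} ->
  (forall k, Ip mu p (F k) <= C) -> Ip mu p f <= C.
Proof.
move=> p0 mF mf Ff FC.
pose G k x := (`|F k x| `^ p)%:E.
have mG k : measurable_fun setT (G k) by exact: measurable_pow.
have G0 k x : 0 <= G k x by rewrite lee_fin powR_ge0.
have GE : {ae mu, forall x, limn_einf (G ^~ x) = (`|f x| `^ p)%:E}.
  apply: filterS Ff => x Fx.
  have : G k x @[k --> \oo] --> (`|f x| `^ p)%:E.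
    apply: cvg_EFin; first exact: nearW.
    apply: (@continuous_cvg _ _ _ _ _ _ (fun y : R => `|y| `^ p)%R) Fx.
    exact: continuous_norm_powR.
  by move=> /cvg_limn_einf_sup[].
have -> : Ip mu p f = \int[mu]_x limn_einf (G ^~ x).
  apply: ge0_ae_eq_integral => //.
  - exact: measurable_pow.
  - have -> : (fun x => limn_einf (G^~ x)) = (fun x => - limn_esup (fun k => - G k x)).
      by apply/funext => x; rewrite (limn_esupN (G^~ x)) oppeK.
    apply: (measurableT_comp (f := -%E)) => //.
    by apply: measurable_fun_limn_esup => k; exact: measurableT_comp.
  - move=> x _; rewrite limn_einf_lim; apply: lime_ge; first exact: is_cvg_einfs.
    by apply: nearW => k; apply: le_ereal_inf_tmp => _ [j _ <-].
  - by apply: filterS GE => x ->.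
apply: (le_trans (fatou mu measurableT mG _)) => //.
rewrite limn_einf_lim; apply: lime_le; first exact: is_cvg_einfs.
apply: nearW => k; apply: le_trans (FC k).
by apply: ereal_inf_lbound; exists k => /=.
Qed.

Lemma Ip_le_of_cvg_mu p F f (C : \bar R) : (0 < p)%R ->
  (forall k, measurable_fun setT (F k)) -> measurable_fun setT f -> cvg_mu F f ->
  (forall k, Ip mu p (F k) <= C) -> Ip mu p f <= C.
Proof.
move=> p0 mF mf Ff FC; have [s [_ hs]] := cvg_mu_subseq mF mf Ff.
exact: (Ip_fatou (F := fun j => F (s j)) p0 (fun j => mF (s j)) mf hs (fun j => FC (s j))).
Qed.

(** Lowering the level to l / 2 leaves room for the error made by F k. *)
Lemma level_le_of_cvg_mu F f (C l : R) : (0 < l)%R ->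
  (forall k, measurable_fun setT (F k)) -> measurable_fun setT f -> cvg_mu F f ->
  (forall k, mu [set x | (l / 2 <= `|F k x|)%R] <= C%:E) ->
  mu [set x | (l <= `|f x|)%R] <= C%:E.
Proof.
move=> l0 mF mf Ff FC; have l20 : (0 < l / 2)%R by rewrite divr_gt0.
have /(cvgeD (erefl : C%:E +? 0) (cvg_cst C%:E)) := Ff _ l20.
rewrite adde0 => h; apply: (cvge_ge _ h).
apply: nearW => k; apply: le_trans (leeD (FC k) (lexx _)).
apply: le_trans (measureU2 _ _ _); last 2 first.
- exact: measurable_level.
- by apply: measurable_level; exact: measurable_funB.
apply: le_measure; rewrite ?inE; first exact: measurable_level.
  apply: measurableU; first exact: measurable_level.
  by apply: measurable_level; exact: measurable_funB.
move=> x /= lf; case: (leP (l / 2) `|F k x|)%R => [|h1]; [by left|right].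
have : (`|f x| <= `|F k x| + `|F k x - f x|)%R.
  by rewrite -{1}(subKr (F k x) (f x)) (le_trans (ler_normB _ _)).
lra.
Qed.

End convergence_in_measure.

(** * Dyadic cells and step functions *)

Section dyadic_cells.
Context {R : realType} {n : nat}.
Local Notation X := 'rV[R]_n.
Local Notation mu := (@lebesgue_rV R n : {measure set X -> \bar R}).
Local Notation G N := {ffun 'I_n -> 'I_(2 ^ (N + N).+1)}.
Implicit Types (N M : nat) (x y : X) (p : R) (f g : X -> R).

Lemma measurable_coord_set (A : set R) l : measurable A ->
  measurable [set x : X | A (x ord0 l)].
Proof.
move=> mA; rewrite -[X in measurable X]setTI.
exact: (@measurable_coord_rV R n l measurableT).
Qed.

Lemma measurable_rect (A : 'I_n -> set R) : (forall l, measurable (A l)) ->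
  measurable [set x : X | forall l, A l (x ord0 l)].
Proof.
move=> mA; rewrite (_ : [set _ | _] = \big[setI/setT]_(l < n) [set x : X | A l (x ord0 l)]).
  by apply: bigsetI_measurable => l _; exact: measurable_coord_set.
rewrite -bigcap_seq; apply/seteqP; split => x /= h l; first by move=> _; exact: h.
exact: (h l (mem_index_enum l)).
Qed.

Lemma half_open_boxE (a b : 'I_n -> R) : [set x : X | forall l, a l <= x ord0 l < b l] =
  [set x : X | forall l, (fun l => `[a l, b l[%classic) l (x ord0 l)].
Proof. by apply/seteqP; split => x /= h l; have := h l; rewrite in_itv. Qed.

Lemma measurable_half_open_box (a b : 'I_n -> R) :
  measurable [set x : X | forall l, a l <= x ord0 l < b l].
Proof.
by rewrite half_open_boxE; apply: (measurable_rect (A := fun l => `[a l, b l[%classic)) => l.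
Qed.

Definition cell_side N : R := (2 ^+ N)^-1.
(** The cells of level N fill the box [-2^N, 2^N)^n, hence 2^(2N+1) of them in each
    direction. *)
Definition cell_corner N (i : G N) : X := \row_l (((i l)%:R - (2 ^ (N + N))%:R) * cell_side N).
Definition cell N (i : G N) : set X :=
  [set x | forall l, cell_corner i ord0 l <= x ord0 l < cell_corner i ord0 l + cell_side N].
Definition big_box M : set X := [set x | forall l, - 2 ^+ M <= x ord0 l < 2 ^+ M].

(** Unlike the cells, which are finite in number, these cubes tile the whole
    space: the unions of cubes of a given side are stable under all boolean
    operations. *)
Definition same_cube N x y := forall l, Num.floor (2 ^+ N * x ord0 l) = Num.floor (2 ^+ N * y ord0 l).
Definition saturated N (A : set X) := forall x y, same_cube N x y -> A x -> A y.

Lemma cell_side_gt0 N : 0 < cell_side N. Proof. by rewrite invr_gt0 exprn_gt0. Qed.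

Lemma cellP N (i : G N) x :
  cell i x <-> forall l, Num.floor (2 ^+ N * x ord0 l) = (i l)%:Z - (2 ^ (N + N))%:Z.
Proof.
have s0 := cell_side_gt0 N.
have h l : (cell_corner i ord0 l <= x ord0 l < cell_corner i ord0 l + cell_side N) =
    (Num.floor (2 ^+ N * x ord0 l) == (i l)%:Z - (2 ^ (N + N))%:Z).
  rewrite floor_eq mxE !intrD mulrNz -!pmulrn.
  rewrite (_ : _ * _ + cell_side N = ((i l)%:R - (2 ^ (N + N))%:R + 1) * cell_side N); last by ring.
  by rewrite /cell_side ler_pdivrMr ?ltr_pdivlMr ?exprn_gt0// (mulrC (2 ^+ N)).
by split => hx l; have := hx l; rewrite h => /eqP.
Qed.

Lemma same_cube_le N M x y : (M <= N)%N -> same_cube N x y -> same_cube M x y.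
Proof.
have floor_half (t : R) : Num.floor t = (Num.floor (2 * t) %/ 2)%Z.
  apply: floor_def; have /andP[h1 h2] := floor_itv (2 * t).
  set m := Num.floor _ in h1 h2 *; move: h1 h2 (divz_eq m 2) (@modz_ge0 m 2 isT).
  move: (@ltz_pmod m 2 isT); move: m (m %/ 2)%Z (m %% 2)%Z => m q r r2 h1 h2 mE r0.
  move: h1 h2; rewrite mE !intrD intrM.
  have : (0 : R) <= r%:~R by rewrite ler0z.
  have : r%:~R <= (1 : R) by rewrite -[1]/(1%:~R) ler_int; lia.
  by rewrite -[2%:~R]/(2 : R) -[1%:~R]/(1 : R); lra.
move=> /subnKC <-; elim: (N - M)%N => [|k IH]; first by rewrite addn0.
move=> xy; apply: IH => l; rewrite floor_half [RHS]floor_half !mulrA -exprS -addnS.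
by rewrite xy.
Qed.

Lemma same_cube_sym N x y : same_cube N x y -> same_cube N y x.
Proof. by move=> h l; rewrite h. Qed.

Lemma cell_same_cube N (i : G N) x y : cell i x -> cell i y -> same_cube N x y.
Proof. by move=> /cellP hx /cellP hy l; rewrite hx hy. Qed.

Lemma cell_cover N x : big_box N x -> exists i : G N, cell i x.
Proof.
move=> hx; have h l : (absz (Num.floor (2 ^+ N * x ord0 l) + (2 ^ (N + N))%:Z)%R < 2 ^ (N + N).+1)%N /\
    0 <= Num.floor (2 ^+ N * x ord0 l) + (2 ^ (N + N))%:Z.
  have /andP[h1 h2] := hx l.
  have f1 : - (2 ^ (N + N))%:Z <= Num.floor (2 ^+ N * x ord0 l).
    rewrite floor_ge_int rmorphN/= -pmulrn natrX exprD -mulrN ler_wpM2l ?exprn_ge0//.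
  have f2 : Num.floor (2 ^+ N * x ord0 l) < (2 ^ (N + N))%:Z.
    rewrite ltNge floor_ge_int -ltNge -pmulrn natrX exprD ltr_pM2l ?exprn_gt0//.
  by rewrite expnS; split; lia.
exists [ffun l => Ordinal (proj1 (h l))]; apply/cellP => l; rewrite ffunE/=.
by have [_ h0] := h l; rewrite gez0_abs// addrK.
Qed.

Lemma cell_inj N (i j : G N) x : cell i x -> cell j x -> i = j.
Proof.
move=> /cellP hi /cellP hj; apply/ffunP => l; apply/val_inj => /=.
by have := hi l; rewrite hj => /addIr [].
Qed.

Lemma measurable_cell N (i : G N) : measurable (cell i).
Proof. exact: measurable_half_open_box. Qed.

Lemma measurable_big_box M : measurable (big_box M).
Proof. exact: measurable_half_open_box. Qed.

End dyadic_cells.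

(** The measure of a product of measurable sets, by induction on the dimension
    along the definition of the measure as an iterated product. *)
Lemma lebesgue_rect (R : realType) n (A : 'I_n -> set R) (v : 'I_n -> R) :
  (forall l, measurable (A l)) -> (forall l, lebesgue_measure (A l) = (v l)%:E) ->
  lebesgue_rV [set x : 'rV[R]_n | forall l, A l (x ord0 l)] = (\prod_l v l)%:E.
Proof.
elim: n => [|n IH] in A v *; move=> mA vA.
  rewrite big_ord0 /= diracE mem_set//=.
  by case.
rewrite /= /pushforward (_ : _ @^-1` _ =
    [set x : 'rV[R]_n | forall l : 'I_n, A (lift ord0 l) (x ord0 l)] `*` A ord0); last first.
  apply/seteqP; split => -[x t] /= h.
    split; last by have := h ord0; rewrite mxE unlift_none.
    by move=> i; have := h (lift ord0 i); rewrite !mxE liftK.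
  case: h => h ht i; rewrite mxE.
  by case: unliftP => [j ->|->] //=.
have m0 := @measurable_rect R n (fun l : 'I_n => A (lift ord0 l)) (fun l => mA _).
rewrite product_measure1E//; last exact: mA.
have IH' := IH _ (fun l => v (lift ord0 l)) (fun l => mA (lift ord0 l)) (fun l => vA (lift ord0 l)).
rewrite [X in (X * _)%E]IH' [X in (_ * X)%E]vA.
by rewrite big_ord_recl/= -EFinM mulrC.
Qed.

Section step_functions.
Context {R : realType} {n : nat}.
Local Notation X := 'rV[R]_n.
Local Notation mu := (@lebesgue_rV R n : {measure set X -> \bar R}).
Local Notation G N := {ffun 'I_n -> 'I_(2 ^ (N + N).+1)}.
Implicit Types (N M : nat) (x y : X) (p : R) (f g : X -> R).

Definition cell_vol N : R := cell_side N ^+ n.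

Lemma cell_vol_gt0 N : 0 < cell_vol N.
Proof. by rewrite exprn_gt0// cell_side_gt0. Qed.

Lemma lebesgue_half_open_box (a b : 'I_n -> R) : (forall l, a l < b l) ->
  mu [set x : X | forall l, a l <= x ord0 l < b l] = (\prod_l (b l - a l))%:E.
Proof.
move=> ab; rewrite half_open_boxE.
apply: (@lebesgue_rect _ _ (fun l => `[a l, b l[%classic) (fun l => b l - a l)) => l //.
by rewrite lebesgue_measure_itv/= lte_fin ab EFinB.
Qed.

Lemma lebesgue_cell N (i : G N) : mu (cell i) = (cell_vol N)%:E.
Proof.
rewrite /cell lebesgue_half_open_box; last by move=> l; rewrite ltrDl cell_side_gt0.
under eq_bigr do rewrite addrAC subrr add0r.
by rewrite prodr_const card_ord.
Qed.

Lemma lebesgue_big_box M : (mu (big_box M) < +oo)%E.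
Proof.
rewrite /big_box lebesgue_half_open_box ?ltry// => l.
by rewrite (@lt_le_trans _ _ 0)// ?oppr_lt0 ?exprn_gt0// exprn_ge0.
Qed.

Definition step N (c : G N -> R) : X -> R := fun x => \sum_i c i * \1_(cell i) x.

Definition cell_mean N f (i : G N) : R := (\int[mu]_(x in cell i) f x)%R / cell_vol N.

(** Conditional expectation on the cells inside the box, 0 outside. *)
Definition dyadic_proj N f := step (cell_mean (N := N) f).

Lemma step_cell N (c : G N -> R) i x : cell i x -> step c x = c i.
Proof.
move=> ix; rewrite /step (bigD1 i)//= indicE mem_set// mulr1 big1 ?addr0// => j ji.
rewrite indicE memNset ?mulr0// => jx; move/eqP: ji; apply; exact: cell_inj jx ix.
Qed.

Lemma step_out N (c : G N -> R) x : (forall i : G N, ~ cell i x) -> step c x = 0.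
Proof. by move=> h; rewrite /step big1// => i _; rewrite indicE memNset ?mulr0//; exact: h. Qed.

Lemma step_comp N (c : G N -> R) (phi : R -> R) x : phi 0 = 0 ->
  phi (step c x) = \sum_i phi (c i) * \1_(cell i) x.
Proof.
move=> phi0; have [[i ix]|h] := pselect (exists i : G N, cell i x).
  by rewrite (step_cell _ ix) -[LHS](@step_cell _ (phi \o c) _ _ ix).
rewrite step_out ?phi0; last by move=> i ix; apply: h; exists i.
by rewrite big1// => i _; rewrite indicE memNset ?mulr0// => ix; apply: h; exists i.
Qed.

Lemma measurable_step N (c : G N -> R) : measurable_fun setT (step c).
Proof.
apply: measurable_sum => i; apply: measurable_funM => //.
by apply: measurable_indic; exact: measurable_cell.
Qed.

Lemma integral_step_ge0 N (c : G N -> R) : (forall i, 0 <= c i) ->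
  (\int[mu]_x (step c x)%:E)%E = (cell_vol N * \sum_i c i)%:E.
Proof.
move=> c0; under eq_integral do rewrite /step -sumEFin.
rewrite ge0_integral_sum//; last 2 first.
- move=> i; apply/measurable_EFinP; apply: measurable_funM => //.
  by apply: measurable_indic; exact: measurable_cell.
- by move=> i x _; rewrite lee_fin mulr_ge0// indicE.
rewrite mulr_sumr -sumEFin; apply: eq_bigr => i _.
under eq_integral do rewrite EFinM.
rewrite ge0_integralZl ?lee_fin//; last first.
  by apply/measurable_EFinP; apply: measurable_indic; exact: measurable_cell.
rewrite integral_indic//; last exact: measurable_cell.
by rewrite setIT lebesgue_cell -EFinM mulrC.
Qed.

Lemma Ip_step p N (c : G N -> R) : 0 < p ->
  Ip mu p (step c) = (cell_vol N * \sum_i `|c i| `^ p)%:E.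
Proof.
move=> p0; rewrite -integral_step_ge0; last by move=> i; exact: powR_ge0.
apply: eq_integral => x _; congr (_%:E).
by rewrite (step_comp c (phi := fun t => `|t| `^ p))// normr0 powR0 ?gt_eqF.
Qed.

Lemma cell_mean_pow p N f (i : G N) : 1 <= p -> measurable_fun setT f ->
  (Ip mu p f < +oo)%E ->
  ((cell_vol N * `|cell_mean f i| `^ p)%:E <= \int[mu]_(x in cell i) (`|f x| `^ p)%:E)%E.
Proof.
move=> p1 mf fp; apply: Ip_mean => //.
- exact: measurable_cell.
- exact: lebesgue_cell.
- exact: cell_vol_gt0.
- by apply: (Ip_integrable p1) => //; [exact: measurable_cell|rewrite lebesgue_cell ltry].
Qed.

Lemma sum_cells_le N (h : X -> \bar R) : measurable_fun setT h -> (forall x, (0 <= h x)%E) ->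
  (\sum_(i : G N) \int[mu]_(x in cell i) h x <= \int[mu]_x h x)%E.
Proof.
move=> mh h0; rewrite -ge0_integral_bigsetU//.
- apply: ge0_subset_integral => //.
  by apply: bigsetU_measurable => i _; exact: measurable_cell.
- by move=> i; exact: measurable_cell.
- exact: index_enum_uniq.
- by move=> i j _ _ [x [ix jx]]; exact: cell_inj ix jx.
- exact: measurable_funTS.
Qed.

Lemma sum_cell_mean_pow p N f : 1 <= p -> measurable_fun setT f -> (Ip mu p f < +oo)%E ->
  ((cell_vol N * \sum_(i : G N) `|cell_mean f i| `^ p)%:E <= Ip mu p f)%E.
Proof.
move=> p1 mf fp; rewrite mulr_sumr -sumEFin.
apply: (@le_trans _ _ (\sum_(i : G N) \int[mu]_(x in cell i) (`|f x| `^ p)%:E)%E).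
  by apply: lee_sum => i _; exact: cell_mean_pow.
apply: sum_cells_le; first exact: measurable_pow.
by move=> x; rewrite lee_fin powR_ge0.
Qed.

Lemma Ip_dyadic_proj p N f : 1 <= p -> measurable_fun setT f -> (Ip mu p f < +oo)%E ->
  (Ip mu p (dyadic_proj N f) <= Ip mu p f)%E.
Proof.
by move=> p1 mf fp; rewrite Ip_step ?(lt_le_trans _ p1)//; exact: sum_cell_mean_pow.
Qed.

End step_functions.

(** * Density of the dyadic step functions *)

Lemma Ip_dominated {d} {T : measurableType d} {R : realType}
    (mu : {measure set T -> \bar R}) (p : R) (F : nat -> T -> R) (f g : T -> R) :
  0 < p -> (forall k, measurable_fun setT (F k)) -> measurable_fun setT f ->
  measurable_fun setT g -> {ae mu, forall x, F k x @[k --> \oo] --> f x} ->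
  (forall k x, `|F k x| <= `|g x|) -> (forall x, `|f x| <= `|g x|) ->
  (Ip mu p g < +oo)%E ->
  Ip mu p (fun x => F k x - f x) @[k --> \oo] --> 0%E.
Proof.
move=> p0 mF mf mg Ff Fg fg gfin.
pose H k x := (`|F k x - f x| `^ p)%:E.
have mH k : measurable_fun setT (H k) by apply: measurable_pow; exact: measurable_funB.
have := @dominated_convergence _ _ _ mu setT measurableT H (cst 0%E)
  (fun x => ((2 * `|g x|) `^ p)%:E) mH (measurable_cst _) _ _ _.
case.
- apply: filterS Ff => x Fx _; apply: cvg_EFin; first exact: nearW.
  have h : F k x - f x @[k --> \oo] --> (0 : R).
    by rewrite -(subrr (f x)); apply: cvgB => //; exact: cvg_cst.
  have h2 := @continuous_cvg _ _ _ _ _ _ _ _ (@continuous_norm_powR R p p0 0) h.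
  have -> : (0 : R) = `|0 : R| `^ p by rewrite normr0 powR0 ?gt_eqF.
  exact: h2.
- have h : Ip mu p (fun x => 2 * g x) = (\int[mu]_x ((2 * `|g x|) `^ p)%:E)%E.
    by apply: eq_integral => x _; rewrite normrM (ger0_norm (ler0n _ 2)).
  apply/integrableP; split.
    rewrite (_ : (fun x => _) = (fun x => (`|2 * g x| `^ p)%:E)).
      by apply: measurable_pow; exact: measurable_funM.
    by apply/funext => x; rewrite normrM (ger0_norm (ler0n _ 2)).
  under eq_integral do rewrite abse_EFin (ger0_norm (powR_ge0 _ _)).
  by rewrite -h Ip_scale// lte_mul_pinfty// ?lee_fin ?powR_ge0.
- apply: nearW => x k _; rewrite /H abse_EFin (ger0_norm (powR_ge0 _ _)) lee_fin.
  rewrite ge0_ler_powR ?nnegrE ?mulr_ge0 ?(ltW p0)//.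
  by apply: le_trans (ler_normB _ _) _; rewrite mulr_natl mulr2n lerD.
- by move=> _ _; rewrite integral0.
Qed.

(* Unfolding the iterated product or the integral makes unification diverge. *)
Opaque lebesgue_rV Ip.

(** Turns convergence of nonnegative extended reals into statements on reals,
    where the arithmetic of the estimates takes place. *)
Lemma cvge0P (R : realType) (u : nat -> \bar R) : (forall k, (0 <= u k)%E) ->
  u k @[k --> \oo] --> 0%E <->
  (forall e : R, 0 < e -> \forall k \near \oo, (u k <= e%:E)%E).
Proof.
move=> u0; split => [/fine_cvgP[fin /cvgrPdist_le h] e e0|h].
  apply: filterS (filterI fin (h _ e0)) => k [fk hk].
  rewrite -[leLHS]fineK// lee_fin; move: hk; rewrite sub0r normrN /=.
  by apply: le_trans; exact: ler_norm.
apply/fine_cvgP; split.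
  by apply: filterS (h _ ltr01) => k hk; rewrite ge0_fin_numE// (le_lt_trans hk)// ltry.
apply/cvgrPdist_le => e e0; apply: filterS (h _ e0) => k hk.
rewrite sub0r normrN ger0_norm ?fine_ge0//= -lee_fin fineK//.
by rewrite ge0_fin_numE// (le_lt_trans hk)// ltry.
Qed.

Section borel_sets.
Context {R : realType} {n : nat}.
Local Notation X := 'rV[R]_n.
Local Notation mu := (@lebesgue_rV R n : {measure set X -> \bar R}).
Implicit Types (N M : nat) (x y : X) (A U : set X).

Lemma saturated_measurable N A : saturated N A -> measurable A.
Proof.
move=> sA; pose fl (x : X) : {ffun 'I_n -> int} := [ffun l => Num.floor (2 ^+ N * x ord0 l)].
pose F (k : {ffun 'I_n -> int}) := [set x | A x /\ fl x = k].
rewrite (_ : A = \bigcup_k F k); last first.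
  by apply/seteqP; split => [x Ax|x [k _ []]//]; exists (fl x).
apply: countable_bigcupT_measurable => // k.
have [[y [Ay yk]]|h] := pselect (exists y, A y /\ fl y = k); last first.
  rewrite (_ : F k = set0)//; apply/seteqP; split => // x [Ax xk].
  by apply: h; exists x.
rewrite (_ : F k = [set x : X | forall l, (k l)%:~R * cell_side N <= x ord0 l < (k l + 1)%:~R * cell_side N]).
  exact: measurable_half_open_box.
have h x l : (Num.floor (2 ^+ N * x ord0 l) == k l) =
    ((k l)%:~R * cell_side N <= x ord0 l < (k l + 1)%:~R * cell_side N).
  rewrite floor_eq /cell_side ler_pdivrMr ?exprn_gt0// ltr_pdivlMr ?exprn_gt0//.
  by rewrite mulrC.
apply/seteqP; split => x /=.
  by move=> [_ xk] l; rewrite -h -xk ffunE.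
move=> hx; have xk : fl x = k by apply/ffunP => l; rewrite ffunE; apply/eqP; rewrite h.
split => //; apply: sA Ay => l.
by have := congr1 (fun z : {ffun 'I_n -> int} => z l) (etrans yk (esym xk)); rewrite !ffunE.
Qed.

Lemma same_cube_dist N x y l : same_cube N x y -> `|x ord0 l - y ord0 l| < cell_side N.
Proof.
move=> h; have := floor_itv (2 ^+ N * x ord0 l); have := floor_itv (2 ^+ N * y ord0 l).
rewrite h intrD -[1%:~R]/(1 : R) => /andP[h1 h2] /andP[h3 h4].
have N0 : (0 : R) < 2 ^+ N by rewrite exprn_gt0.
rewrite -(ltr_pM2l N0) /cell_side mulfV ?gt_eqF// -{1}(gtr0_norm N0) -normrM mulrBr.
by rewrite ltr_norml; lra.
Qed.

Lemma cell_side_small (e : R) : 0 < e -> exists N, cell_side N < e.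
Proof.
move=> e0; have [K hK] := dyadic_bound e^-1 (ltr01 : (0 : R) < 1).
exists K; rewrite /cell_side -[e]invrK ltf_pV2 ?posrE ?invr_gt0 ?exprn_gt0//.
by rewrite -[ltRHS]mul1r.
Qed.

Lemma mx_norm_le (x : X) (e : R) : 0 <= e -> (`|x| <= e) <-> (forall l, `|x ord0 l| <= e).
Proof.
move=> e0; rewrite /Num.Def.normr/= mx_normrE; split => [h l|h].
  apply: le_trans h; exact: (le_bigmax _ (fun ij : 'I_1 * 'I_n => `|x ij.1 ij.2|) (ord0, l)).
apply/bigmax_leP; split => // -[i l] _ /=.
by rewrite (ord1 i); exact: h.
Qed.

Lemma open_rV_measurable U : open U -> measurable U.
Proof.
move=> oU; pose A N := [set x | forall y, same_cube N x y -> U y].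
rewrite (_ : U = \bigcup_N A N).
  apply: bigcup_measurable => N _; apply: (@saturated_measurable N) => x y xy Ax z yz.
  by apply: Ax => l; rewrite xy yz.
apply/seteqP; split => [x Ux|x [N _ Ax]]; last exact: Ax.
have /nbhs_ballP[e /= e0 xeU] : nbhs x U by exact: open_nbhs_nbhs.
have [N hN] := cell_side_small e0; exists N => // y xy; apply: xeU.
rewrite -ball_normE /ball_/=; apply: le_lt_trans hN.
apply/mx_norm_le; first exact/ltW/cell_side_gt0.
by move=> l; rewrite !mxE; exact/ltW/same_cube_dist.
Qed.

Lemma continuous_rV_measurable (f : X -> R) : continuous f -> measurable_fun setT f.
Proof.
move=> cf; apply: (measurability _ (RGenOpens.measurableE R)).
move=> _ [_ [a [b ->]] <-]; rewrite setTI; apply: open_rV_measurable.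
by apply: open_comp; [move=> x _; exact: cf|exact: interval_open].
Qed.

Lemma saturated_big_box M : saturated M (@big_box R n M).
Proof.
move=> x y xy /cell_cover[i /cellP ix].
have yi : cell i y by apply/cellP => l; rewrite -xy ix.
have s0 := @cell_side_gt0 R M; have i2 : (2 ^ (M + M))%:R * cell_side M = 2 ^+ M :> R.
  by rewrite natrX exprD /cell_side mulfK// gt_eqF// exprn_gt0.
move=> l; have /andP[] := yi l; rewrite mxE mulrBl i2 => h1 h2; apply/andP; split.
  by apply: le_trans h1; rewrite -[leLHS]add0r lerD2r mulr_ge0// ltW.
apply: (lt_le_trans h2); rewrite -[X in _ + X]mul1r addrAC -mulrDl lerBlDr -i2 -mulrDl.
rewrite ler_pM2r// natr1 -natrD ler_nat; apply: leq_trans (ltn_ord (i l)) _.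
by rewrite expnS mul2n -addnn.
Qed.

(** The dyadic cubes generate the Borel sets: {x_l < a} is the increasing
    union over N of the cubes of side 2^-N that it contains. *)
(** A half-line x_l < a is the increasing union over N of the unions of cubes of
    side 2^-N that it contains. *)
Lemma measurable_sub_saturated (A : set X) : measurable A ->
  <<s [set A : set X | exists N, saturated N A] >> A.
Proof.
move: A; apply: smallest_sub; first exact: smallest_sigma_algebra.
rewrite -bigcup_seq => B [l _] [Y mY <-].
pose S := [set A : set X | exists N, saturated N A].
have : measurable_fun setT (fun x : g_sigma_algebraType S => (x : X) ord0 l).
  apply: (measurability _ (RGenInftyO.measurableE R)) => _ [_ [a ->] <-]; rewrite setTI.
  rewrite (_ : _ @^-1` _ = \bigcup_N [set x : X |
      ((Num.floor (2 ^+ N * x ord0 l) + 1)%:~R <= 2 ^+ N * a)]).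
    apply: bigcup_measurable => N _; apply: sub_sigma_algebra; exists N => x y xy /=.
    by rewrite xy.
  apply/seteqP; split => x /=; rewrite in_itv/=.
    rewrite -subr_gt0 => /cell_side_small[N hN].
    exists N => //=; have /andP[h1 _] := floor_itv (2 ^+ N * x ord0 l).
    have N0 : (0 : R) < 2 ^+ N by rewrite exprn_gt0.
    move: hN; rewrite /cell_side -(ltr_pM2l N0) mulfV ?gt_eqF// mulrBr intrD -[1%:~R]/(1 : R).
    by lra.
  move=> [N _ /= h]; have /andP[_ h1] := floor_itv (2 ^+ N * x ord0 l).
  by have := lt_le_trans h1 h; rewrite ltr_pM2l// exprn_gt0.
by move=> /(_ measurableT _ mY); rewrite setTI.
Qed.

End borel_sets.

Section dyadic_density.
Context {R : realType} {n : nat}.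
Local Notation X := 'rV[R]_n.
Local Notation mu := (@lebesgue_rV R n : {measure set X -> \bar R}).
Local Notation G N := {ffun 'I_n -> 'I_(2 ^ (N + N).+1)}.
Implicit Types (N M : nat) (x y : X) (f g : X -> R) (A : set X).

Definition L2fun f := measurable_fun setT f /\ (Ip mu 2 f < +oo)%E.

Lemma L2fun_integrable f A : L2fun f -> measurable A -> (mu A < +oo)%E ->
  mu.-integrable A (EFin \o f).
Proof. by move=> [mf ff] mA fA; apply: (Ip_integrable _ mA fA mf ff); rewrite ler1n. Qed.

Lemma L2fun_lin a f g : L2fun f -> L2fun g -> L2fun (fun x => a * f x + g x).
Proof.
move=> [mf ff] [mg gf]; have maf : measurable_fun setT (fun x => a * f x) by exact: measurable_funM.
split; first exact: measurable_funD.
apply: le_lt_trans (Ip_add mu _ maf mg) _ => //.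
have c0 b : (0 <= ((b : R) `^ 2)%:E)%E by rewrite lee_fin powR_ge0.
apply: lte_mul_pinfty (c0 _) _ _ => //; apply: lte_add_pinfty gf.
by rewrite Ip_scale//; apply: lte_mul_pinfty (c0 _) _ ff.
Qed.

Lemma L2fun_sub f g : L2fun f -> L2fun g -> L2fun (fun x => f x - g x).
Proof.
move=> hf hg; rewrite (_ : (fun x => _) = (fun x => -1 * g x + f x)); first exact: L2fun_lin.
by apply/funext => x; rewrite mulN1r addrC.
Qed.

Lemma L2fun_step N (c : G N -> R) : L2fun (step c).
Proof. by split; [exact: measurable_step|rewrite Ip_step ?ltry]. Qed.

Lemma cell_mean_lin N a f g (i : G N) : L2fun f -> L2fun g ->
  cell_mean (fun x => a * f x + g x) i = a * cell_mean f i + cell_mean g i.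
Proof.
move=> hf hg; have mi := @measurable_cell R n N i.
have fi : (mu (cell i) < +oo)%E by rewrite lebesgue_cell ltry.
have If := L2fun_integrable hf mi fi; have Ig := L2fun_integrable hg mi fi.
rewrite /cell_mean RintegralD//; last exact: (@integrableZl _ _ _ mu _ mi a (EFin \o f)).
by rewrite RintegralZl// mulrDl mulrA.
Qed.

Lemma dyadic_proj_lin N a f g x : L2fun f -> L2fun g ->
  dyadic_proj N (fun x => a * f x + g x) x = a * dyadic_proj N f x + dyadic_proj N g x.
Proof.
move=> hf hg; rewrite /dyadic_proj /step mulr_sumr -big_split; apply: eq_bigr => i _ /=.
by rewrite cell_mean_lin// mulrDl mulrA.
Qed.

Definition dyadic_limit f := Ip mu 2 (fun x => dyadic_proj N f x - f x) @[N --> \oo] --> 0%E.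

Let lt2 : (0 : R) <= 2. Proof. by []. Qed.

Lemma dyadic_limit_lin a f g : L2fun f -> L2fun g ->
  dyadic_limit f -> dyadic_limit g -> dyadic_limit (fun x => a * f x + g x).
Proof.
move=> hf hg lf lg; pose u N := Ip mu 2 (fun x => dyadic_proj N f x - f x).
pose v N := Ip mu 2 (fun x => dyadic_proj N g x - g x).
have mP N (h : X -> R) : measurable_fun setT (dyadic_proj N h) by exact: measurable_step.
have mB N h : L2fun h -> measurable_fun setT (fun x => dyadic_proj N h x - h x).
  by move=> [mh _]; apply: measurable_funB => //; exact: mP.
apply: (@squeeze_cvge _ _ _ _ (fun=> 0%E) _
   (fun N => (2 `^ 2)%:E * ((`|a| `^ 2)%:E * u N + v N))%E).
- apply: nearW => N; rewrite Ip_ge0/= /u /v -Ip_scale; last exact: mB.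
  rewrite (_ : (fun x => _) = (fun x => a * (dyadic_proj N f x - f x) + (dyadic_proj N g x - g x))).
    by apply: Ip_add => //; [apply: measurable_funM => //; exact: mB|exact: mB].
  by apply/funext => x; rewrite dyadic_proj_lin//; ring.
- exact: cvg_cst.
- rewrite -[X in _ --> X](mule0 (2 `^ 2)%:E); apply: cvgeZl => //.
  rewrite -[X in _ --> X]adde0; apply: cvgeD => //.
  rewrite -[X in _ --> X](mule0 (`|a| `^ 2)%:E).
  by apply: (cvgeZl _ lf); rewrite fin_numE.
Qed.

(** The projections are contractions of L^2, so the set of functions that they
    approximate is closed. *)
Lemma dyadic_limit_closed f (g : nat -> X -> R) : L2fun f -> (forall k, L2fun (g k)) ->
  (forall k, dyadic_limit (g k)) ->
  Ip mu 2 (fun x => g k x - f x) @[k --> \oo] --> 0%E -> dyadic_limit f.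
Proof.
move=> hf hg lg gf.
pose u N h := Ip mu 2 (fun x => dyadic_proj N h x - h x).
pose v k := Ip mu 2 (fun x => g k x - f x).
have h0 N k : (u N f <= (2 `^ 2)%:E * (v k + (2 `^ 2)%:E * (u N (g k) + v k)))%E.
  rewrite /u /v.
  have hd := L2fun_sub hf (hg k); have [mg _] := hg k; have [mf _] := hf.
  have m1 : measurable_fun setT (fun x => dyadic_proj N (g k) x - g k x).
    by apply: measurable_funB => //; exact: measurable_step.
  have m2 : measurable_fun setT (fun x => g k x - f x) by exact: measurable_funB.
  apply: (@le_trans _ _ ((2 `^ 2)%:E * (Ip mu 2 (dyadic_proj N (fun x => f x - g k x)%R) +
      Ip mu 2 (fun x => (dyadic_proj N (g k) x - g k x) + (g k x - f x))%R)%E)%E).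
    rewrite (_ : (fun x => _) = (fun x => dyadic_proj N (fun x => f x - g k x) x +
        ((dyadic_proj N (g k) x - g k x) + (g k x - f x)))).
      by apply: Ip_add => //; [exact: measurable_step|exact: measurable_funD].
    apply/funext => x.
    rewrite (_ : (fun x => f x - g k x) = (fun x => -1 * g k x + f x)); last first.
      by apply/funext => z; rewrite mulN1r addrC.
    by rewrite (dyadic_proj_lin _ _ _ (hg k) hf); ring.
  apply: lee_wpmul2l; first by rewrite lee_fin powR_ge0.
  apply: leeD; last exact: Ip_add.
  by rewrite [leRHS]Ip_distC; apply: (Ip_dyadic_proj N _ hd.1 hd.2); rewrite ler1n.
apply/cvge0P => [N|e e0]; first exact: Ip_ge0.
set c : R := 2 `^ 2 in h0; have c0 : 0 < c by exact: powR_gt0.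
pose e' := e / (c * (1 + c * 2)).
have e'0 : 0 < e' by rewrite divr_gt0// mulr_gt0// addr_gt0// mulr_gt0.
have /(_ _ e'0)/filter_ex[k gk] := (cvge0P (fun k => Ip_ge0 mu 2 (fun x => g k x - f x))).1 gf.
have := (cvge0P (fun N => Ip_ge0 mu 2 (fun x => dyadic_proj N (g k) x - g k x))).1 (lg k) _ e'0.
apply: filterS => N hN; apply: le_trans (h0 N k) _.
have -> : e = c * (e' + c * (e' + e')).
  have p0 : c != 0 by rewrite gt_eqF.
  have p1 : 1 + c * 2 != 0 by rewrite gt_eqF// addr_gt0// mulr_gt0.
  by rewrite /e'; field; rewrite p0 p1.
clearbody e'; have c0' : (0 <= c%:E)%E by rewrite lee_fin ltW.
rewrite EFinM EFinD EFinM EFinD; apply: (lee_wpmul2l c0'); apply: (leeD gk).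
exact: (lee_wpmul2l c0' (leeD hN gk)).
Qed.

Lemma L2fun_indic A : measurable A -> (mu A < +oo)%E -> L2fun (\1_A : X -> R).
Proof.
move=> mA fA; split; first exact: measurable_indic.
rewrite IpE (_ : (\int[_]_x _ = \int[mu]_x (\1_A x)%:E)%E).
  by rewrite integral_indic// setIT.
apply: eq_integral => x _; rewrite indicE.
by case: (x \in A) => /=; rewrite ?normr1 ?normr0 ?powR1 ?powR0.
Qed.

Lemma big_box_sub N M : (M <= N)%N -> big_box M `<=` @big_box R n N.
Proof.
move=> MN x h l; have /andP[h1 h2] := h l.
have h3 : (2 : R) ^+ M <= 2 ^+ N by rewrite ler_eXn2l// ltr1n.
by apply/andP; split; [apply: le_trans h1; rewrite lerN2|exact: lt_le_trans h3].
Qed.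

(** Each cell of level at least M lies inside a cube of level M, on which the
    indicator is constant. *)
Lemma dyadic_proj_saturated M N A : saturated M A -> A `<=` big_box M -> (M <= N)%N ->
  forall x, dyadic_proj N (\1_A : X -> R) x = \1_A x.
Proof.
move=> sA AM MN x; have [[i ix]|h] := pselect (exists i : G N, cell i x); last first.
  rewrite /dyadic_proj step_out; last by move=> i ix; apply: h; exists i.
  rewrite indicE memNset// => /AM/(big_box_sub MN)/cell_cover[i ix].
  by apply: h; exists i.
rewrite /dyadic_proj (step_cell _ ix) /cell_mean.
rewrite (@eq_Rintegral _ _ _ mu _ (fun=> \1_A x)); last first.
  move=> y; rewrite inE => iy; rewrite !indicE; congr (nat_of_bool _)%:R.
  have xy := same_cube_le MN (cell_same_cube ix iy).
  by apply/idP/idP; rewrite !inE; apply: sA => //; exact: same_cube_sym.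
rewrite Rintegral_cst//; last exact: measurable_cell.
by rewrite lebesgue_cell/= mulfK// gt_eqF// cell_vol_gt0.
Qed.

(** The sets with this property form a lambda-system, and it contains the unions
    of cubes, which are stable under intersection and generate the measurable
    sets. The box keeps the measures finite. *)
Lemma dyadic_limit_indic A M : measurable A -> dyadic_limit (\1_(A `&` big_box M) : X -> R).
Proof.
have fin B k : measurable B -> L2fun (\1_(B `&` big_box k) : X -> R).
  move=> mB; have mI : measurable (B `&` big_box k).
    by apply: measurableI => //; exact: measurable_big_box.
  apply: L2fun_indic => //; apply: le_lt_trans (lebesgue_big_box k).
  by apply: le_measure => //; rewrite ?inE//; exact: measurable_big_box.
move=> /measurable_sub_saturated mA.
suff : <<s [set A : set X | exists N, saturated N A] >> `<=`
    [set A : set X | measurable A /\ forall k, dyadic_limit (\1_(A `&` big_box k) : X -> R)].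
  by move=> /(_ _ mA)[_]; apply.
have satP B : (exists N, saturated N B) ->
    measurable B /\ forall k, dyadic_limit (\1_(B `&` big_box k) : X -> R).
  move=> [N sB]; split; first exact: saturated_measurable sB.
  move=> k; pose m := maxn N k.
  have sBk : saturated m (B `&` @big_box R n k).
    move=> x y xy [Bx kx]; split.
      by apply: sB Bx; apply: same_cube_le xy; exact: leq_maxl.
    by apply: saturated_big_box kx; apply: same_cube_le xy; exact: leq_maxr.
  have subm : B `&` big_box k `<=` @big_box R n m.
    by move=> x [_]; apply: big_box_sub; exact: leq_maxr.
  apply: cvg_near_cst; near=> N'.
  rewrite IpE; apply: integral0_eq => x _.
  rewrite (dyadic_proj_saturated sBk subm) ?subrr ?normr0 ?powR0//.
  by near: N'; exact: nbhs_infty_ge.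
apply: lambda_system_subset => //.
- move=> B C [N sB] [N' sC]; exists (maxn N N') => x y xy [Bx Cx]; split.
    by apply: sB Bx; apply: same_cube_le xy; exact: leq_maxl.
  by apply: sC Cx; apply: same_cube_le xy; exact: leq_maxr.
- split; [by []|by apply: satP; exists 0%N|move=> B C CB [mB lB] [mC lC]|move=> F ndF hF].
  + split; first exact: measurableD.
    move=> k; rewrite (_ : \1_(_ `&` _) = (fun x => -1 * \1_(C `&` big_box k) x + \1_(B `&` big_box k) x)).
      by apply: dyadic_limit_lin => //; exact: fin.
    apply/funext => x; rewrite !indicE !in_setI.
    rewrite -[(fun y => ~ C y)]/(~` C) in_setC.
    have : (x \in C) -> (x \in B) by rewrite !inE; exact: CB.
    by case: (x \in C) => [/(_ isT) ->|_]; case: (x \in B); case: (x \in big_box k); rewrite /= ?mulr0 ?mulr1 ?add0r ?addNr.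
  + have mU : measurable (\bigcup_i F i).
      by apply: bigcup_measurable => i _; have [] := hF i.
    split => // k; apply: (dyadic_limit_closed (g := fun i => \1_(F i `&` big_box k))).
    * exact: fin.
    * by move=> i; apply: fin; have [] := hF i.
    * by move=> i; have [_] := hF i.
    * have [mb fb] := L2fun_indic (@measurable_big_box R n k) (@lebesgue_big_box R n k).
      apply: (Ip_dominated (g := \1_(big_box k))) => //.
      - by move=> i; have [] := fin _ k (hF i).1.
      - by have [] := fin _ k mU.
      - apply: nearW => x; apply: cvg_near_cst; have [[i _ Fix]|h] := pselect ((\bigcup_i F i) x).
          near=> j; rewrite !indicE !in_setI [x \in F j]mem_set ?[x \in \bigcup_i F i]mem_set//; first by exists i.
          have ij : (i <= j)%N by near: j; exact: nbhs_infty_ge.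
          by have /subsetPset := ndF _ _ ij; apply.
        near=> j; rewrite !indicE !in_setI [x \in F j]memNset ?[x \in \bigcup_i F i]memNset//.
        by move=> Fj; apply: h; exists j.
      - by move=> i x; rewrite !indicE in_setI; case: (x \in big_box k); rewrite ?andbF//= normr1; case: (_ \in _); rewrite ?normr1 ?normr0.
      - by move=> x; rewrite !indicE in_setI; case: (x \in big_box k); rewrite ?andbF//= normr1; case: (_ \in _); rewrite ?normr1 ?normr0.
Unshelve. all: by end_near. Qed.

Let dyadic_limit_sum m (F : 'I_m -> X -> R) :
  (forall i, L2fun (F i) /\ dyadic_limit (F i)) ->
  L2fun (fun x => \sum_i F i x) /\ dyadic_limit (fun x => \sum_i F i x).
Proof.
elim: m => [|m IH] in F *; move=> hF.
  rewrite (_ : (fun x => _) = \1_(set0 `&` big_box 0)).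
    split; last exact: dyadic_limit_indic.
    by rewrite set0I; apply: L2fun_indic => //; rewrite measure0.
  by apply/funext => x; rewrite big_ord0 set0I indic0.
have [h1 h2] := IH (fun i => F (widen_ord (leqnSn m) i)) (fun i => hF _).
rewrite (_ : (fun x => _) = (fun x => 1 * F ord_max x + \sum_(i < m) F (widen_ord (leqnSn m) i) x)).
  by have [h3 h4] := hF ord_max; exact (conj (L2fun_lin 1 h3 h1) (dyadic_limit_lin 1 h3 h1 h4 h2)).
by apply/funext => x; rewrite big_ord_recr/= addrC mul1r.
Qed.

Import HBNNSimple.

Let dyadic_limit_ge0 f : L2fun f -> (forall x, 0 <= f x) -> dyadic_limit f.
Proof.
move=> [mf ff] f0; have mfE : measurable_fun setT (EFin \o f) by exact/measurable_EFinP.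
pose g k := nnsfun_approx measurableT mfE k.
have g_le k x : 0 <= g k x <= f x.
  rewrite fun_ge0 /= -lee_fin /g nnsfun_approxE.
  by apply: (@le_approx _ _ _ setT (EFin \o f) k x) => // z _; rewrite lee_fin.
have mB k : measurable (big_box k : set X) by exact: measurable_big_box.
pose h k x : R := g k x * \1_(big_box k) x.
have h_le k x : `|h k x| <= `|f x|.
  have /andP[g0 gf] := g_le k x; rewrite normrM (ger0_norm g0) (ger0_norm (f0 x)).
  by rewrite indicE; case: (_ \in _); rewrite ?normr1 ?normr0 ?mulr1 ?mulr0.
have mh k : measurable_fun setT (h k).
  by apply: measurable_funM => //; exact: measurable_indic.
have Lh k : L2fun (h k).
  by split; [exact: mh|apply: le_lt_trans ff; apply: Ip_le].
apply: (dyadic_limit_closed (g := h)) => //.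
  move=> k; pose s := finmap.enum_fset (fset_set (range (g k))).
  have -> : h k = (fun x => \sum_(i < size s) s`_i *
        \1_((g k @^-1` [set s`_i]) `&` big_box k) x).
    apply/funext => x; rewrite /h fimfunEord mulr_suml; apply: eq_bigr => i _.
    by rewrite -mulrA indicI.
  apply: (proj2 (dyadic_limit_sum _)) => i.
  have mA : measurable (g k @^-1` [set s`_i]) by exact: measurable_sfunP.
  have L0 : L2fun (\1_((g k @^-1` [set s`_i]) `&` big_box k) : X -> R).
    apply: L2fun_indic; first exact: measurableI.
    by apply: le_lt_trans (lebesgue_big_box k); apply: le_measure; rewrite ?inE//; exact: measurableI.
  have lim0 := dyadic_limit_indic k mA.
  have [z1 z2] : L2fun (fun=> 0 : R) /\ dyadic_limit (fun=> 0 : R).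
    rewrite (_ : (fun=> 0) = (fun x : X => \sum_(j < 0) (0 : R))); last first.
      by apply/funext => x; rewrite big_ord0.
    by apply: (@dyadic_limit_sum 0 (fun _ _ => 0)); case.
  rewrite (_ : (fun x => _) = (fun x => s`_i * \1_((g k @^-1` [set s`_i]) `&` big_box k) x + 0)).
    exact (conj (L2fun_lin _ L0 z1) (dyadic_limit_lin _ L0 z1 lim0 z2)).
  by apply/funext => x; rewrite addr0.
apply: (Ip_dominated (g := f)) => //.
apply: nearW => x.
have gx : g k x @[k --> \oo] --> f x.
  have f0E z : setT z -> (0 <= (EFin \o f) z)%E by move=> _; rewrite lee_fin.
  exact: (fine_cvg (cvg_nnsfun_approx measurableT mfE f0E (I : setT x))).
have [k0 hk0] : exists k0, big_box k0 x.
  have [k0 hk] := dyadic_bound (`|x| + 1) (ltr01 : (0 : R) < 1); exists k0 => l.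
  rewrite mul1r in hk; have := (mx_norm_le x (normr_ge0 x)).1 (lexx _) l.
  by rewrite ler_norml => /andP[h1 h2]; apply/andP; split; lra.
apply: cvg_trans gx; apply: near_eq_cvg; near=> k.
rewrite /h indicE mem_set ?mulr1//; apply: big_box_sub hk0.
by near: k; exact: nbhs_infty_ge.
Unshelve. all: by end_near. Qed.

(** From indicators to nonnegative functions by simple functions, and to all of
    L^2 by positive and negative parts. *)
Lemma dyadic_proj_cvg f : L2fun f ->
  Ip mu 2 (fun x => dyadic_proj N f x - f x) @[N --> \oo] --> 0%E.
Proof.
move=> [mf ff].
have Lmax g : measurable_fun setT g -> (forall x, `|g x| <= `|f x|) ->
    L2fun (fun x => Num.max (g x) 0).
  move=> mg gf; have mm : measurable_fun setT (fun x => Num.max (g x) 0).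
    by apply: measurable_maxr => //; exact: measurable_cst.
  split; first exact: mm.
  apply: le_lt_trans ff; apply: (Ip_le mu lt2 mm mf) => x; apply: le_trans (gf x).
  by rewrite /Num.max; case: ltP; rewrite ?normr0.
have mNf : measurable_fun setT (fun x => - f x) by exact: measurableT_comp.
have hp := Lmax _ mf (fun=> lexx _).
have hn : L2fun (fun x => Num.max (- f x) 0) by apply: Lmax => // x; rewrite normrN.
have fE : f = (fun x => -1 * Num.max (- f x) 0 + Num.max (f x) 0).
  apply/funext => x; case: (ltP (f x) 0) => h.
    by rewrite max_l ?oppr_ge0 ?ltW// addr0 mulN1r opprK.
  by rewrite max_r ?oppr_le0// mulr0 add0r.
rewrite -/(dyadic_limit f) fE; apply: dyadic_limit_lin => //; apply: dyadic_limit_ge0 => //.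
  by move=> x; rewrite le_max lexx orbT.
by move=> x; rewrite le_max lexx orbT.
Qed.

End dyadic_density.

(** * Smooth bumps filling a cell *)

Section smooth_functions.
Context {R : realType}.
Implicit Types (f g : R -> R) (P : {poly R}).

Fixpoint diffk k f : Prop :=
  if k is k'.+1 then (forall x, derivable f x 1) /\ diffk k' f^`() else True.

Definition smooth1 f := forall k, diffk k f.

Lemma diffkS k f : diffk k.+1 f -> diffk k f.
Proof. by elim: k f => [//|k IH] f [df /IH]; split. Qed.

Lemma smooth1_derivable f x : smooth1 f -> derivable f x 1.
Proof. by move=> /(_ 1%N)[]. Qed.

Lemma smooth1_deriv f : smooth1 f -> smooth1 f^`().
Proof. by move=> sf k; have [] := sf k.+1. Qed.

Lemma diffk_add k f g : diffk k f -> diffk k g -> diffk k (fun x => f x + g x).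
Proof.
elim: k f g => [//|k IH] f g [df df'] [dg dg']; split.
  by move=> x; exact: derivableD.
rewrite (_ : _^`() = (fun x => f^`()%classic x + g^`()%classic x)); first exact: IH.
by apply/funext => x; rewrite !derive1E deriveD.
Qed.

Lemma diffk_mul k f g : diffk k f -> diffk k g -> diffk k (fun x => f x * g x).
Proof.
elim: k f g => [//|k IH] f g hf hg; have [df df'] := hf; have [dg dg'] := hg; split.
  by move=> x; exact: derivableM.
rewrite (_ : _^`() = (fun x => f x * g^`()%classic x + g x * f^`()%classic x)).
  by apply: diffk_add; apply: IH => //; exact: diffkS.
by apply/funext => x; rewrite !derive1E deriveM.
Qed.

Lemma diffk_cst k a : diffk k (cst a).
Proof.
elim: k a => [//|k IH] a; split; first by move=> x; exact: derivable_cst.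
by rewrite (_ : _^`() = cst 0)//; apply/funext => x; rewrite derive1E derive_cst.
Qed.

Lemma smooth1_mul f g : smooth1 f -> smooth1 g -> smooth1 (fun x => f x * g x).
Proof. by move=> sf sg k; exact: diffk_mul. Qed.

Lemma smooth1_affine f a b : smooth1 f -> smooth1 (fun x => f (a * x + b)).
Proof.
move=> sf k; elim: k f sf => [//|k IH] f sf.
have d (x : R) : is_derive x (1 : R) (fun x => f (a * x + b)) (f^`()%classic (a * x + b) * a).
  have h1 : is_derive (a * x + b) (1 : R) f (f^`()%classic (a * x + b)).
    by rewrite derive1E; apply: DeriveDef => //; exact: smooth1_derivable.
  have h2 : is_derive x (1 : R) (fun x => a * x + b) a.
    have : is_derive x (1 : R) (fun x : R => a * x + b) (a *: 1 + 0).
      by apply: is_deriveD; apply: is_deriveZ.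
    by rewrite addr0 /GRing.scale/= mulr1.
  exact: (@is_derive1_comp R f (fun x => a * x + b)).
split; first by move=> x; have [] := d x.
rewrite (_ : _^`() = (fun x => f^`()%classic (a * x + b) * a)); last first.
  by apply/funext => x; rewrite derive1E; have [] := d x.
apply: diffk_mul; last exact: diffk_cst.
by apply: IH; exact: smooth1_deriv.
Qed.

(** The functions P(1/t) exp(-1/t), extended by 0 to t <= 0: a class closed
    under differentiation. *)
Definition flat P (t : R) : R := if 0 < t then P.[t^-1] * expR (- t^-1) else 0.

(** Exponential growth beats P(s) s^2 at s = 1/t; the exponent 2 gives both the
    continuity of flat P at 0 and the vanishing of its derivative there. *)
Lemma flat_quotient_bound P : exists C : R, 0 < C /\
  forall t, `|t| < 1 -> `|flat P t| <= C * `|t| ^+ 2.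
Proof.
pose m := size P; pose S := \sum_(i < m) `|P`_i|.
exists ((S + 1) * (m.+2)`!%:R).
have S0 : 0 <= S by apply: sumr_ge0.
have F0 : (0 : R) < (m.+2)`!%:R by rewrite ltr0n fact_gt0.
split; first by rewrite mulr_gt0// ltr_wpDl.
move=> t t1; rewrite /flat; case: ifP => [t0|_]; last first.
  by rewrite normr0 !mulr_ge0 ?exprn_ge0 ?addr_ge0// ltW.
rewrite (gtr0_norm t0) in t1 *; set s := t^-1.
have s1 : 1 <= s by rewrite /s invf_ge1// ltW.
have s0 : 0 < s by exact: lt_le_trans s1.
rewrite normrM (gtr0_norm (expR_gt0 _)) expRN.
have hP : `|P.[s]| <= S * s ^+ m.
  rewrite horner_coef mulr_suml; apply: le_trans (ler_norm_sum _ _ _) _.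
  apply: ler_sum => i _; rewrite normrM ler_wpM2l// normrX (gtr0_norm s0).
  by rewrite ler_weXn2l// ltnW.
have he : s ^+ m.+2 <= (m.+2)`!%:R * expR s.
  rewrite mulrC -ler_pdivrMr//; apply: le_trans (expR_ge1Dxn m.+1 (ltW s0)).
  by rewrite lerDr.
apply: (@le_trans _ _ (S * s ^+ m / expR s)).
  by rewrite ler_pM2r// invr_gt0 expR_gt0.
rewrite ler_pdivrMr ?expR_gt0//.
have -> : s ^+ m = s ^+ m.+2 * t ^+ 2.
  by rewrite -addn2 exprD -mulrA -exprMn /s mulVf ?gt_eqF// expr1n mulr1.
apply: (@le_trans _ _ (S * ((m.+2)`!%:R * expR s * t ^+ 2))).
  by rewrite ler_wpM2l// ler_wpM2r// exprn_ge0// ltW.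
rewrite (_ : _ * t ^+ 2 * expR s = (S + 1) * ((m.+2)`!%:R * expR s * t ^+ 2)); last by ring.
by rewrite ler_wpM2r ?lerDl// !mulr_ge0 ?exprn_ge0// ?expR_ge0// ltW.
Qed.

(** Differentiating P(1/t) exp(-1/t) gives (P - P')(1/t) t^-2 exp(-1/t), which is
    again of this form. *)
Lemma is_derive_flat P t : is_derive t (1 : R) (flat P) (flat ((P - P^`()) * 'X^2) t).
Proof.
have [t0|t0|->] := ltgtP t 0.
- have h : {near t, cst 0 =1 flat P}.
    near=> u; rewrite /flat ltNge ltW//; near: u; exact: lt_nbhsl.
  rewrite [X in is_derive _ _ _ X]/flat ltNge (ltW t0)/=; apply: DeriveDef.
    by apply: near_eq_derivable h _; exact: derivable_cst.
  by rewrite -(near_eq_derive _ h) derive_cst.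
- have h : {near t, (fun u => P.[u^-1] * expR (- u^-1)) =1 flat P}.
    near=> u; rewrite /flat ifT//; near: u; exact: lt_nbhsr.
  have dV : is_derive t (1 : R) (fun u : R => u^-1) (- t ^- 2).
    have := @is_deriveV R id t 1 1 (lt0r_neq0 t0) (is_derive_id _ _).
    by rewrite /GRing.scale/= mulr1.
  have dP : is_derive t (1 : R) (fun u : R => P.[u^-1]) (P^`().[t^-1] * - t ^- 2).
    exact: (@is_derive1_comp R (horner P) (fun u => u^-1)).
  have dE : is_derive t (1 : R) (fun u : R => expR (- u^-1)) (expR (- t^-1) * t ^- 2).
    have dN : is_derive t (1 : R) (fun u : R => - u^-1) (t ^- 2).
      by have := is_deriveN dV; rewrite opprK.
    exact: (@is_derive1_comp R expR (fun u => - u^-1)).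
  have dM : is_derive t (1 : R) (fun u => P.[u^-1] * expR (- u^-1)) (flat ((P - P^`()) * 'X^2) t).
    rewrite /flat t0 !hornerE.
    have := is_deriveM dP dE; rewrite /GRing.scale/=.
    set e := expR _; set a := P.[_]; set b := P^`().[_] => hd.
    apply: (@eq_rect _ _ (fun z => is_derive t (1 : R) _ z) hd).
    by rewrite -exprVn; ring.
  by apply: DeriveDef; [apply: near_eq_derivable h _; case: dM|rewrite -(near_eq_derive _ h); case: dM].
- have [C [C0 hC]] := flat_quotient_bound P.
  have cv : h^-1 *: ((flat P \o shift 0) (h *: 1) - flat P 0) @[h --> (0 : R)^'] --> (0 : R).
    apply/cvgrPdist_le => e e0; near=> h.
    have hn0 : h != 0 by near: h; exact: nbhs_dnbhs_neq.
    have h1 : `|h| < 1 by near: h; apply: dnbhs0_lt.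
    have h2 : `|h| <= e / C by near: h; apply: dnbhs0_le; rewrite divr_gt0.
    rewrite sub0r normrN /= addr0 [h *: 1]mulr1 [flat P 0]/flat ltxx subr0 normrM normfV.
    rewrite ler_pdivrMl ?normr_gt0//; apply: le_trans (hC _ h1) _.
    rewrite expr2 mulrCA ler_wpM2l// mulrC.
    by rewrite -ler_pdivlMr.
  rewrite [X in is_derive _ _ _ X]/flat ltxx; apply: DeriveDef; first exact: cvgP cv.
  exact: cvg_lim cv.
Unshelve. all: by end_near. Qed.

Lemma smooth1_flat P : smooth1 (flat P).
Proof.
move=> k; elim: k P => [//|k IH] P; split; first by move=> x; have [] := is_derive_flat P x.
rewrite (_ : _^`() = flat ((P - P^`()) * 'X^2)); first exact: IH.
by apply/funext => x; rewrite derive1E; have [] := is_derive_flat P x.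
Qed.

Definition cutoff (t : R) := flat 1 t.

Lemma cutoffE t : cutoff t = if 0 < t then expR (- t^-1) else 0.
Proof. by rewrite /cutoff /flat hornerC mul1r. Qed.

Lemma cutoff_ge0 t : 0 <= cutoff t.
Proof. by rewrite cutoffE; case: ifP => // _; exact: expR_ge0. Qed.

Lemma cutoff_le1 t : cutoff t <= 1.
Proof.
rewrite cutoffE; case: ifP => // t0.
by rewrite -expR0 ler_expR oppr_le0 invr_ge0 ltW.
Qed.

Lemma cutoff_cvg t : 0 < t -> cutoff (k.+1%:R * t) @[k --> \oo] --> (1 : R).
Proof.
move=> t0; have -> : (fun k : nat => cutoff (k.+1%:R * t)) = (fun k : nat => expR (- (t^-1 * k.+1%:R^-1))).
  by apply/funext => k; rewrite cutoffE ifT ?invfM 1?mulrC// mulr_gt0.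
rewrite -[X in _ --> X]expR0; apply: (@continuous_cvg _ _ _ _ _ _ expR).
  exact: continuous_expR.
rewrite -[X in _ --> X]oppr0; apply: cvgN; rewrite -[X in _ --> X](mulr0 t^-1).
by apply: cvgMl_tmp => //; exact: cvg_harmonic.
Qed.

End smooth_functions.

Section tensor_products.
Context {R : realType} {n : nat}.
Local Notation X := 'rV[R]_n.
Local Notation mu := (@lebesgue_rV R n : {measure set X -> \bar R}).
Local Notation G N := {ffun 'I_n -> 'I_(2 ^ (N + N).+1)}.
Implicit Types (phi : 'I_n -> R -> R) (x : X).

Definition tens phi : X -> R := fun x => \prod_l phi l (x ord0 l).

Lemma continuous_tens phi : (forall l, continuous (phi l)) -> continuous (tens phi).
Proof.
move=> cphi; rewrite /tens; elim: (index_enum _) => [|l s IH] x.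
  have -> : (fun y : X => \prod_(l <- [::]) phi l (y ord0 l)) = cst 1.
    by apply/funext => y; rewrite big_nil.
  exact: cst_continuous.
have -> : (fun y : X => \prod_(j <- l :: s) phi j (y ord0 j)) =
    (fun y : X => phi l (y ord0 l) * \prod_(j <- s) phi j (y ord0 j)).
  by apply/funext => y; rewrite big_cons.
apply: (@continuousM _ _ (fun y : X => phi l (y ord0 l))); last exact: IH.
by apply: (continuous_comp (f := fun y : X => y ord0 l)); [exact: coord_continuous|exact: cphi].
Qed.

Definition tens_upd phi i g l := if l == i then g else phi l.

(** A partial derivative of a product of one-variable functions only acts on one
    factor, so that the iterated ones remain products. *)
Lemma tens_partial phi i x : (forall l, smooth1 (phi l)) ->
  derivable (tens phi) x (delta_mx ord0 i) /\
  'D_(delta_mx ord0 i) (tens phi) x = tens (tens_upd phi i (phi i)^`()) x.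
Proof.
move=> sphi; pose c := \prod_(l | l != i) phi l (x ord0 l).
have dG : derivable (fun t => c * phi i t) (x ord0 i) 1.
  by apply: derivableM; [exact: derivable_cst|exact: smooth1_derivable].
have E : (fun h : R => h^-1 *: ((tens phi \o shift x) (h *: delta_mx ord0 i) - tens phi x)) =
   (fun h : R => h^-1 *: (((fun t => c * phi i t) \o shift (x ord0 i)) (h *: 1) - c * phi i (x ord0 i))).
  apply/funext => h; congr (_ *: (_ - _)); rewrite /= /tens (bigD1 i)//= mulrC.
    rewrite !mxE !eqxx mulr1 [h *: 1]mulr1; congr (_ * _); apply: eq_bigr => l li.
    by rewrite !mxE (negbTE li) mulr0 add0r.
  by [].
rewrite /derivable /derive E; split; first exact: dG.
have -> : tens (tens_upd phi i (phi i)^`()) x = c * (phi i)^`()%classic (x ord0 i).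
  rewrite /tens (bigD1 i)//= mulrC /tens_upd eqxx; congr (_ * _).
  by apply: eq_bigr => l /negbTE ->.
transitivity ('D_1 (fun t => c * phi i t) (x ord0 i)); first by [].
rewrite deriveM; [|exact: derivable_cst|exact: smooth1_derivable].
by rewrite derive_cst scaler0 addr0 derive1E.
Qed.

Lemma smooth_tens phi : (forall l, smooth1 (phi l)) -> smooth (tens phi).
Proof.
move=> sphi s.
have [psi [spsi ->]] : exists psi, (forall l, smooth1 (psi l)) /\ partial s (tens phi) = tens psi.
  elim: s => [|i s [psi [spsi IH]]]; first by exists phi.
  exists (tens_upd psi i (psi i)^`()); split.
    by move=> l; rewrite /tens_upd; case: eqP => // _; exact: smooth1_deriv.
  rewrite /= IH; apply/funext => x; exact: (tens_partial i x spsi).2.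
split; last by move=> i x; exact: (tens_partial i x spsi).1.
apply: continuous_tens => l t.
by apply/differentiable_continuous/derivable1_diffP; exact: smooth1_derivable.
Qed.

Definition bump_factor N (i : G N) k l (t : R) : R :=
  cutoff (k.+1%:R * (t - cell_corner i ord0 l)) *
  cutoff (k.+1%:R * (cell_corner i ord0 l + cell_side N - t)).

(** Positive in the interior of the cell, 0 outside, and tending to 1 inside as k
    grows. No normalization is needed, only convergence to the indicator. *)
Definition cell_bump N (i : G N) k : X -> R := tens (bump_factor i k).

Definition closed_cell N (i : G N) : set X :=
  [set x | forall l, cell_corner i ord0 l <= x ord0 l <= cell_corner i ord0 l + cell_side N].

Lemma smooth1_bump_factor N (i : G N) k l : smooth1 (bump_factor i k l).
Proof.
apply: smooth1_mul.
  rewrite (_ : (fun t => _) = (fun t => cutoff (k.+1%:R * t + - (k.+1%:R * cell_corner i ord0 l)))).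
    by apply: smooth1_affine; exact: smooth1_flat.
  by apply/funext => t; congr cutoff; rewrite mulrBr.
rewrite (_ : (fun t => _) = (fun t => cutoff (- k.+1%:R * t + k.+1%:R * (cell_corner i ord0 l + cell_side N)))).
  by apply: smooth1_affine; exact: smooth1_flat.
by apply/funext => t; congr cutoff; rewrite mulrBr mulNr addrC.
Qed.

Lemma bump_factor_neq0 N (i : G N) k l t : bump_factor i k l t != 0 ->
  cell_corner i ord0 l < t < cell_corner i ord0 l + cell_side N.
Proof.
rewrite /bump_factor mulf_eq0 negb_or !cutoffE => /andP[].
case: ifP; rewrite ?eqxx// pmulr_rgt0 ?ltr0n// subr_gt0 => -> _.
by case: ifP; rewrite ?eqxx// pmulr_rgt0 ?ltr0n// subr_gt0 => -> _.
Qed.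

Lemma bump_neq0 N (i : G N) k x : cell_bump i k x != 0 ->
  forall l, cell_corner i ord0 l < x ord0 l < cell_corner i ord0 l + cell_side N.
Proof.
move=> h l; apply: (@bump_factor_neq0 _ i k); apply: contra h => /eqP h.
by rewrite /cell_bump /tens (bigD1 l)//= h mul0r.
Qed.

Lemma bump_ge0 N (i : G N) k x : 0 <= cell_bump i k x.
Proof. by apply: prodr_ge0 => l _; rewrite mulr_ge0 ?cutoff_ge0. Qed.

Lemma bump_le_indic N (i : G N) k x : cell_bump i k x <= \1_(cell i) x.
Proof.
have [->|h] := eqVneq (cell_bump i k x) 0; first by rewrite indicE.
rewrite indicE mem_set; last by move=> l; have /andP[/ltW -> ->] := bump_neq0 h l.
rewrite (_ : true%:R = \prod_(l < n) (1 : R)); last by rewrite big1.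
apply: ler_prod => l _; rewrite mulr_ge0 ?cutoff_ge0//=.
by rewrite mulr_ile1 ?cutoff_ge0 ?cutoff_le1.
Qed.

Lemma continuous_bump N (i : G N) k : continuous (cell_bump i k).
Proof.
apply: continuous_tens => l t.
apply/differentiable_continuous/derivable1_diffP/smooth1_derivable.
exact: smooth1_bump_factor.
Qed.

Lemma compact_closed_cell N (i : G N) : compact (closed_cell i) /\ closed (closed_cell i).
Proof.
have E : closed_cell i = [set x : X | forall l, (fun l => `[cell_corner i ord0 l,
    cell_corner i ord0 l + cell_side N]%classic) l (x ord0 l)].
  by apply/seteqP; split => x /= h l; have := h l; rewrite in_itv.
have C : compact (closed_cell i) by rewrite E; apply: (rV_compact (A := fun l => `[_, _]%classic)) => l; exact: segment_compact.
by split => //; apply: compact_closed => //; exact: norm_hausdorff.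
Qed.

Definition of_real (f : X -> R) : X -> R[i] := fun x => Complex (f x) 0.

Lemma supp_bump N (i : G N) k : supp (of_real (cell_bump i k)) `<=` closed_cell i.
Proof.
have [_ cl] := compact_closed_cell i.
rewrite /supp closureE; apply: smallest_sub => // x /= h l.
have /andP[/ltW -> /ltW ->]// : cell_corner i ord0 l < x ord0 l < cell_corner i ord0 l + cell_side N.
apply: (@bump_neq0 _ i k); apply: contra h => /eqP h.
by rewrite /of_real h.
Qed.

(** In dimension 0 the imaginary part 0 would not be an empty product, which is why
    n is positive. *)
Lemma test_fun_bump N (i : G N) k : (0 < n)%N -> test_fun (of_real (cell_bump i k)).
Proof.
move=> n0; split.
- by apply: smooth_tens => l; exact: smooth1_bump_factor.
- rewrite (_ : (fun x => _) = tens (fun _ => cst 0)).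
    by apply: smooth_tens => l k'; exact: diffk_cst.
  by apply/funext => x; rewrite /tens prodr_const card_ord expr0n gtn_eqF.
- have [cp _] := compact_closed_cell i.
  apply: (subclosed_compact _ cp); first exact: closed_closure.
  exact: supp_bump.
Qed.

Definition open_cell N (i : G N) : set X :=
  [set x | forall l, cell_corner i ord0 l < x ord0 l < cell_corner i ord0 l + cell_side N].

Lemma lebesgue_open_cell N (i : G N) :
  measurable (open_cell i) /\ mu (open_cell i) = (cell_vol (n := n) N)%:E.
Proof.
pose A l : set R := `]cell_corner i ord0 l, cell_corner i ord0 l + cell_side N[%classic.
have -> : open_cell i = [set x : X | forall l, A l (x ord0 l)].
  by apply/seteqP; split => x /= h l; have := h l; rewrite /A/= in_itv.
split; first by apply: (measurable_rect (A := A)) => l; exact: measurable_itv.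
have -> : cell_vol (n := n) N = \prod_(l < n) cell_side N :> R by rewrite prodr_const card_ord.
apply: (@lebesgue_rect _ _ A) => l; first exact: measurable_itv.
by rewrite lebesgue_measure_itv/= lte_fin ltrDl cell_side_gt0 -EFinB addrAC subrr add0r.
Qed.

Lemma bump_cvg N (i : G N) :
  Ip mu 2 (fun x => cell_bump i k x - \1_(cell i) x) @[k --> \oo] --> 0%E.
Proof.
have mc := @measurable_cell R n N i.
have fc : (mu (cell i) < +oo)%E by rewrite lebesgue_cell ltry.
have [m1 f1] := L2fun_indic mc fc.
pose O := open_cell i; have [mO vO] := lebesgue_open_cell i.
have OC : O `<=` cell i by move=> x h l; have /andP[/ltW -> ->] := h l.
apply: (Ip_dominated (g := \1_(cell i))) => //.
- by move=> k; apply: continuous_rV_measurable; exact: continuous_bump.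
- exists (cell i `\` O); split.
  + exact: measurableD.
  + rewrite measureD// ?lebesgue_cell ?ltry// (_ : cell i `&` O = O); last exact/setIidr.
    by rewrite [X in (_ - X)%E = _]vO [X in (X - _)%E = _]lebesgue_cell subee.
  + move=> x /= hx; apply: contrapT => nx; apply: hx.
    have [xO|xO] := pselect (O x).
      rewrite indicE mem_set; last exact: OC.
      rewrite (_ : 1%:R = \prod_(l < n) (1 : R)); last by rewrite big1.
      apply: cvg_big => //; first by move=> *; exact: mul_continuous.
      move=> l _; rewrite -[X in _ --> X](mulr1 1); have /andP[h1 h2] := xO l.
      by apply: cvgM; apply: cutoff_cvg; rewrite subr_gt0.
    have xc : ~ cell i x by move=> xc; apply: nx.
    rewrite indicE memNset//; apply: cvg_near_cst; apply: nearW => k.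
    apply/eqP/negP => /negP h; apply: xO; exact: bump_neq0 h.
- by move=> k x; rewrite (ger0_norm (bump_ge0 _ _ _)) ger0_norm ?indicE// -indicE bump_le_indic.
Qed.

End tensor_products.

(** * Averages over a cell *)

Section cell_averages.
Context {R : realType} {n : nat}.
Local Notation X := 'rV[R]_n.
Local Notation mu := (@lebesgue_rV R n : {measure set X -> \bar R}).
Local Notation G N := {ffun 'I_n -> 'I_(2 ^ (N + N).+1)}.
Implicit Types (f g h : X -> R).

Lemma cell_mean_ae N f g (i : G N) : measurable_fun setT f -> measurable_fun setT g ->
  {ae mu, forall x, f x = g x} -> cell_mean f i = cell_mean g i.
Proof.
move=> mf mg fg; rewrite /cell_mean /Rintegral; congr (fine _ / _).
apply: ae_eq_integral; first exact: measurable_cell.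
- by apply/measurable_EFinP; exact: measurable_funTS.
- by apply/measurable_EFinP; exact: measurable_funTS.
- by apply: filterS fg => x /= -> _.
Qed.

Lemma cell_mean_le N f (i : G N) (a e : R) : 0 <= e -> L2fun f ->
  {ae mu, forall x, cell i x -> `|f x - a| <= e} -> `|cell_mean f i - a| <= e.
Proof.
move=> e0 hf fe; have mi := @measurable_cell R n N i.
have fi : (mu (cell i) < +oo)%E by rewrite lebesgue_cell ltry.
have v0 := @cell_vol_gt0 R n N.
have Ic (b : R) : mu.-integrable (cell i) (EFin \o (fun=> b)).
  by apply/integrableP; split; [exact/measurable_EFinP|under eq_integral do rewrite /=; rewrite integral_cst//= lebesgue_cell -EFinM ltry].
have If := L2fun_integrable hf mi fi.
have Id : mu.-integrable (cell i) (EFin \o (fun x => f x - a)).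
  by rewrite (_ : _ \o _ = (fun x => (f x)%:E - a%:E)%E)//; apply: integrableB => //; exact: (Ic a).
have -> : cell_mean f i - a = (\int[mu]_(x in cell i) (f x - a))%R / cell_vol (n := n) N.
  rewrite RintegralB//.
  by rewrite Rintegral_cst// lebesgue_cell/= mulrBl mulfK// gt_eqF.
rewrite normrM (gtr0_norm (_ : 0 < _^-1)) ?invr_gt0// ler_pdivrMr//.
apply: le_trans (le_normr_Rintegral mi Id) _.
rewrite -lee_fin /Rintegral fineK; last first.
  by apply: integrable_fin_num => //; exact: (integrable_norm Id).
apply: (@le_trans _ _ (\int[mu]_(x in cell i) e%:E)%E); last first.
  by rewrite integral_cst// lebesgue_cell -EFinM.
have mN : measurable_fun (cell i) (fun x => (`|f x - a|)%:E).
  by have /integrableP[] := integrable_norm Id.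
exact: ae_ge0_le_integral.
Qed.

(** A mean over a cell is continuous on L^2, by Jensen's inequality. *)
Lemma cell_mean_cvg N (F : nat -> X -> R) f (i : G N) : (forall k, L2fun (F k)) -> L2fun f ->
  Ip mu 2 (fun x => F k x - f x) @[k --> \oo] --> 0%E ->
  cell_mean (F k) i @[k --> \oo] --> cell_mean f i.
Proof.
move=> hF hf Ff; have v0 := @cell_vol_gt0 R n N.
have E k : cell_mean (F k) i - cell_mean f i = cell_mean (fun x => F k x - f x) i.
  rewrite (_ : (fun x => _) = (fun x => -1 * f x + F k x)); last first.
    by apply/funext => x; rewrite mulN1r addrC.
  by rewrite (cell_mean_lin (-1) i hf (hF k)) mulN1r addrC.
have h k : ((cell_vol (n := n) N * `|cell_mean (F k) i - cell_mean f i| `^ 2)%:E <=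
    Ip mu 2 (fun x => F k x - f x)%R)%E.
  have [m1 m2] := L2fun_sub (hF k) hf; rewrite E.
  apply: (le_trans (cell_mean_pow _ _ m1 m2)); first by rewrite ler1n.
  rewrite IpE; apply: ge0_subset_integral => //; first exact: measurable_cell.
  exact: measurable_pow.
apply/cvgrPdist_le => e e0.
have e2 : 0 < cell_vol (n := n) N * e `^ 2 by rewrite mulr_gt0// powR_gt0.
have := (cvge0P (fun k => Ip_ge0 mu 2 (fun x => F k x - f x))).1 Ff _ e2.
apply: filterS => k hk; have := le_trans (h k) hk; rewrite lee_fin ler_pM2l// distrC.
by apply: contraTT; rewrite -!ltNge => ?; rewrite gt0_ltr_powR// nnegrE// ltW.
Qed.

Lemma continuous_cell_integrable N (i : G N) h : continuous h ->
  (forall x, ~ closed_cell i x -> h x = 0) -> mu.-integrable setT (EFin \o h).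
Proof.
move=> ch h0; have mh := continuous_rV_measurable ch.
have [cp _] := @compact_closed_cell R n N i.
have [M [Mr hM]] := compact_bounded (continuous_compact (continuous_subspaceT ch) cp).
have /(_ (M + 1)) := hM; rewrite ltrDl ltr01 => /(_ isT) {}hM.
pose v := (2 * cell_side N : R).
have mc : measurable (closed_cell i : set X).
  have -> : closed_cell i = [set x : X | forall l, (fun l => `[cell_corner i ord0 l,
      cell_corner i ord0 l + cell_side N]%classic) l (x ord0 l)].
    by apply/seteqP; split => x /= hx l; have := hx l; rewrite in_itv.
  apply: (measurable_rect (A := fun l => `[cell_corner i ord0 l,
    cell_corner i ord0 l + cell_side N]%classic)) => l; exact: measurable_itv.
have fc : (mu (closed_cell i) < +oo)%E.
  have mb := @measurable_half_open_box R n (fun l => cell_corner i ord0 l) (fun l => cell_corner i ord0 l + v).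
  apply: (@le_lt_trans _ _ (mu [set x : X | forall l, cell_corner i ord0 l <= x ord0 l < cell_corner i ord0 l + v])).
    apply: le_measure; rewrite ?inE//.
    move=> x /= hx l; have /andP[-> hl]/= := hx l; apply: le_lt_trans hl _.
    by rewrite ltrD2l /v ltr_pMl ?cell_side_gt0// ltr1n.
  rewrite lebesgue_half_open_box ?ltry// => l.
  by rewrite ltrDl /v mulr_gt0// cell_side_gt0.
apply: (@le_integrable _ _ _ mu _ measurableT _ (fun x => ((M + 1) * \1_(closed_cell i) x)%:E)).
- exact/measurable_EFinP.
- move=> x _; rewrite /= lee_fin; have [cx|cx] := pselect (closed_cell i x).
    rewrite indicE mem_set// mulr1; apply: le_trans (ler_norm _).
    by apply: hM; exists x.
  by rewrite h0// normr0.
- apply: (@integrableZl _ _ _ mu _ measurableT (M + 1) (EFin \o \1_(closed_cell i))).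
  apply/integrableP; split; first by apply/measurable_EFinP; exact: measurable_indic.
  under eq_integral do rewrite abse_EFin ger0_norm ?indicE// -indicE.
  by rewrite integral_indic// setIT.
Qed.

Lemma Rintegral_close N (i : G N) (u w g : X -> R) (e : R) :
  continuous (fun x => u x * g x) -> continuous (fun x => w x * g x) -> continuous g ->
  (forall x, 0 <= g x) -> (forall x, ~ closed_cell i x -> g x = 0) ->
  (forall x, closed_cell i x -> `|u x - w x| <= e) ->
  `|(\int[mu]_x (u x * g x))%R - (\int[mu]_x (w x * g x))%R| <= e * (\int[mu]_x g x)%R.
Proof.
move=> cu cw cg g0 gout uw.
have iu : mu.-integrable setT (EFin \o (fun x => u x * g x)).
  by apply: (@continuous_cell_integrable N i) => // x /gout ->; rewrite mulr0.
have iw : mu.-integrable setT (EFin \o (fun x => w x * g x)).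
  by apply: (@continuous_cell_integrable N i) => // x /gout ->; rewrite mulr0.
have ig : mu.-integrable setT (EFin \o g) by exact: (@continuous_cell_integrable N i).
have id : mu.-integrable setT (EFin \o (fun x => u x * g x - w x * g x)).
  by rewrite (_ : _ \o _ = (fun x => (u x * g x)%:E - (w x * g x)%:E)%E)//; exact: integrableB.
rewrite -RintegralB// -RintegralZl//.
apply: le_trans (le_normr_Rintegral measurableT id) _.
apply: le_Rintegral => //; first exact: (integrable_norm id).
  exact: (@integrableZl _ _ _ mu _ measurableT e (EFin \o g)).
move=> x _; rewrite -mulrBl normrM (ger0_norm (g0 x)).
have [cx|cx] := pselect (closed_cell i x); first by rewrite ler_wpM2r// uw.
by rewrite gout// !mulr0.
Qed.

Lemma bump_out N (i : G N) k (x : X) : ~ closed_cell i x -> cell_bump i k x = 0.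
Proof.
move=> h; apply/eqP; apply: contra_notT h => /bump_neq0 h l.
by have /andP[/ltW -> /ltW ->] := h l.
Qed.

Lemma L2fun_bump N (i : G N) k : L2fun (cell_bump i k : X -> R).
Proof.
have mb := continuous_rV_measurable (@continuous_bump R n N i k).
have mc := @measurable_cell R n N i.
have fc : (mu (cell i) < +oo)%E by rewrite lebesgue_cell ltry.
have [m1 f1] := L2fun_indic mc fc.
split; first exact: mb.
apply: le_lt_trans f1; apply: (@Ip_le _ _ _ mu 2) mb m1 _ => // x.
by rewrite (ger0_norm (bump_ge0 _ _ _)) ger0_norm ?indicE// -indicE bump_le_indic.
Qed.

Definition bump_mass N (i : G N) k : R := (\int[mu]_x cell_bump i k x)%R.

Lemma bump_mass_ge0 N (i : G N) k : 0 <= bump_mass i k.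
Proof. by apply: Rintegral_ge0 => x _; exact: bump_ge0. Qed.

Lemma bump_mass_cvg N (i : G N) : bump_mass i k @[k --> \oo] --> cell_vol (R := R) (n := n) N.
Proof.
have mc := @measurable_cell R n N i.
have fc : (mu (cell i) < +oo)%E by rewrite lebesgue_cell ltry.
have v0 := @cell_vol_gt0 R n N.
have E k : bump_mass i k = cell_vol (n := n) N * cell_mean (cell_bump i k) i.
  rewrite /bump_mass /cell_mean mulrCA divff ?gt_eqF// mulr1.
  rewrite [RHS]Rintegral_mkcond; apply: eq_Rintegral => x _.
  rewrite patchE; case: ifPn => // /negP; rewrite inE => xi.
  apply/eqP/negPn/negP => /bump_neq0 h; apply: xi => l.
  by have /andP[/ltW -> ->] := h l.
have := cell_mean_cvg (i := i) (L2fun_bump i) (L2fun_indic mc fc) (bump_cvg i).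
have -> : cell_mean (\1_(cell i)) i = 1 :> R.
  rewrite /cell_mean (@eq_Rintegral _ _ _ mu _ (fun=> 1)).
    by rewrite Rintegral_cst// lebesgue_cell/= mul1r divff// gt_eqF.
  by move=> x xi; rewrite indicE xi.
move=> h; under eq_fun do rewrite E.
have := cvgMl_tmp (a := cell_vol (n := n) N) h.
by rewrite mulr1; exact.
Qed.

End cell_averages.

(** * Kernels seen at the scale of the cells *)

Section counting.
Local Close Scope classical_set_scope.

Lemma card_classes n m q d (S : {set {ffun 'I_n -> 'I_(2 ^ m)}}) (cls : {ffun 'I_n -> 'I_(2 ^ m)} -> 'I_q) :
  (forall i i', i \in S -> i' \in S -> cls i = cls i' ->
     forall l, (`|(i l : int) - i' l| <= d)%N) ->
  (#|S| <= q * (2 * d + 1) ^ n)%N.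
Proof.
move=> h; rewrite -sum1_card (partition_big cls predT)//=.
apply: (@leq_trans (\sum_(a < q) (2 * d + 1) ^ n)); last by rewrite sum_nat_const card_ord.
apply: leq_sum => a _; rewrite sum1dep_card.
have [->|/set0Pn[i0]] := eqVneq [set i in S | cls i == a] finset.set0; first by rewrite cards0.
rewrite inE => /andP[S0 /eqP c0]; apply: (@card_index_ball _ _ _ i0) => i.
by rewrite inE => /andP[Si /eqP ci]; apply: h => //; rewrite ci.
Qed.

End counting.

(** Smoothness in y. For smoothness in x the condition is used with the arguments
    of k and sig exchanged, so that each lemma serves for both. *)
Definition kernel_regular {R : realType} {n : nat} (A delta c1 : R) (k sig : 'rV[R]_n -> 'rV[R]_n -> R) :=
  forall x y y', 0 < sig x y -> c1 * `|y - y'| <= sig x y ->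
    `|k x y - k x y'| <= A * `|y - y'| `^ delta * sig x y `^ (- n%:R - delta).

(** All that is retained of the shape of the curve: for a fixed y, the zero set of
    sig looks at every scale like at most q points. *)
Definition fibre_cover {R : realType} {n : nat} (C : R) q (sig : 'rV[R]_n -> 'rV[R]_n -> R) :=
  forall y t, 0 < t -> exists cls : 'rV[R]_n -> 'I_q, forall x x',
    sig x y < t -> sig x' y < t -> cls x = cls x' -> `|x - x'| <= C * t.

Section cell_kernel.
Context {R : realType} {n : nat}.
Local Notation X := 'rV[R]_n.
Local Notation mu := (@lebesgue_rV R n : {measure set X -> \bar R}).
Local Notation G N := {ffun 'I_n -> 'I_(2 ^ (N + N).+1)}.
Implicit Types (k sig : X -> X -> R) (x y : X).

Definition cell_dist sig N (i j : G N) : R := sig (cell_corner i) (cell_corner j) / cell_side N.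

Lemma cell_corner_sub N (i j : G N) l :
  cell_corner i ord0 l - cell_corner j ord0 l = ((i l : int) - (j l : int))%:~R * cell_side N :> R.
Proof. by rewrite !mxE -mulrBl opprB addrA subrK intrB. Qed.

Lemma closed_cell_corner N (i : G N) x : closed_cell i x -> `|x - cell_corner i| <= cell_side N.
Proof.
move=> ix; apply/mx_norm_le; first exact/ltW/cell_side_gt0.
move=> l; have /andP[h1 h2] := ix l; rewrite mxE [X in _ + X]mxE.
by rewrite ger0_norm ?subr_ge0// lerBlDl.
Qed.

Lemma cell_closed N (i : G N) x : cell i x -> closed_cell i x.
Proof. by move=> ix l; have /andP[-> /ltW ->] := ix l. Qed.

(** Each piece of the cover has diameter O(t) cells, hence contains O(t^n) corners. *)
Lemma cell_dist_growth (C : R) q sig N (t : R) (j : G N) : 0 <= C -> fibre_cover C q sig -> 1 <= t ->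
  #|[set i : G N | cell_dist sig i j <= t]%SET|%:R <= (q%:R * (4 * C + 1) ^+ n) * t ^+ n.
Proof.
move=> C0 cov t1; have s0 := @cell_side_gt0 R N; have t0 : 0 < t by exact: lt_le_trans t1.
have [|cls hcls] := cov (cell_corner j) (2 * t * cell_side N); first by rewrite !mulr_gt0.
have a0 : 0 <= 2 * C * t by rewrite !mulr_ge0// ltW.
pose d := Num.truncn (2 * C * t).
have hd : d%:R <= 2 * C * t by rewrite truncn_le.
have lt_sig i : cell_dist sig i j <= t -> sig (cell_corner i) (cell_corner j) < 2 * t * cell_side N.
  rewrite /cell_dist ler_pdivrMr// => /le_lt_trans; apply.
  by rewrite ltr_pM2r// ltr_pMl// ltr1n.
apply: (@le_trans _ _ (q * (2 * d + 1) ^ n)%:R).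
  rewrite ler_nat; apply: (card_classes (cls := fun i => cls (cell_corner i))) => i i'.
  rewrite !inE => /lt_sig hi /lt_sig hi' cii l.
  have h0 : 0 <= C * (2 * t * cell_side N) by rewrite !mulr_ge0// ltW.
  have /(mx_norm_le _ h0)/(_ l) := hcls _ _ hi hi' cii.
  rewrite mxE [X in _ + X]mxE cell_corner_sub normrM (gtr0_norm s0) mulrA ler_pM2r//.
  rewrite mulrA (mulrC C) => h.
  rewrite -ltnS -(ltr_nat R); apply: (@le_lt_trans _ _ (2 * C * t)); last by rewrite truncnS_gt.
  by rewrite natr_absz intr_norm.
rewrite natrM -[leRHS]mulrA ler_wpM2l// natrX -exprMn lerXn2r// ?nnegrE ?ler0n//.
  by rewrite mulr_ge0 ?(ltW t0)// addr_ge0// mulr_ge0.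
have -> : (2 * d + 1)%:R = 2 * d%:R + 1 :> R by rewrite natrD natrM.
by lra.
Qed.


(** The distance changes by at most b + e cells, at most half of itself. *)
Lemma near_base_far sig N (i j : G N) x y (b e : R) : (forall x x' y, `|sig x y - sig x' y| <= `|x - x'|) ->
  (forall x y y', `|sig x y - sig x y'| <= `|y - y'|) ->
  `|x - cell_corner i| <= b * cell_side N -> `|y - cell_corner j| <= e * cell_side N ->
  2 * (b + e) <= cell_dist sig i j ->
  cell_dist sig i j * cell_side N / 2 <= sig x y.
Proof.
move=> sx sy hx hy h; have s0 := @cell_side_gt0 R N.
have E : cell_dist sig i j * cell_side N = sig (cell_corner i) (cell_corner j).
  by rewrite /cell_dist divfK// gt_eqF.
have h1 := sx x (cell_corner i) (cell_corner j).
have h2 := sy x y (cell_corner j).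
move: h1 h2; rewrite !ler_norml -E => /andP[h1 _] /andP[h2 _].
have h3 : 2 * (b * cell_side N + e * cell_side N) <= cell_dist sig i j * cell_side N.
  by rewrite -mulrDl mulrA ler_wpM2r// ltW.
lra.
Qed.

(** The kernel is only controlled where the distance is positive, which includes
    the support of the bump; elsewhere the product vanishes nearby. *)
Lemma continuous_kernel_bump (u : X -> R) N (i : G N) (k : nat) :
  (forall y, closed_cell i y -> {for y, continuous u}) ->
  continuous (fun y => u y * cell_bump i k y).
Proof.
move=> cu y; have [cy|ny] := pselect (closed_cell i y).
  by apply: continuousM; [exact: cu|exact: continuous_bump].
have [_ cl] := @compact_closed_cell R n N i.
have /= : \forall z \near y, ~ closed_cell i z.
  by apply: open_nbhs_nbhs; split => //; exact: closed_openC.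
move=> nz; rewrite /continuous_at bump_out// mulr0.
apply: (@cvg_near_cst _ _ _ _ (nbhs y)); apply: filterS nz => z nz.
by rewrite bump_out ?mulr0.
Qed.

Lemma kernel_regular_continuous (A delta c1 : R) k sig x y : 0 <= A -> 0 < delta -> 0 <= c1 ->
  kernel_regular A delta c1 k sig -> 0 < sig x y -> {for y, continuous (k x)}.
Proof.
move=> A0 d0 c0 reg s0; apply/(@cvgrPdist_le _ _ _ (nbhs y)) => e e0.
pose C := A * sig x y `^ (- n%:R - delta) + 1.
have C0 : 0 < C by rewrite ltr_wpDl// mulr_ge0// powR_ge0.
have h1 : 0 < (e / C) `^ (delta^-1) by rewrite powR_gt0// divr_gt0.
have h2 : 0 < sig x y / (c1 + 1) by rewrite divr_gt0// ltr_wpDl.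
near=> z.
have z1 : `|y - z| <= (e / C) `^ (delta^-1).
  by near: z; apply: cvgr_dist_le.
have z2 : `|y - z| <= sig x y / (c1 + 1).
  by near: z; apply: cvgr_dist_le.
apply: le_trans (reg x y z s0 _) _.
  move: z2; rewrite ler_pdivlMr ?ltr_wpDl// => z2; apply: le_trans z2.
  by rewrite mulrDr mulr1 mulrC lerDl.
have z3 : `|y - z| `^ delta <= e / C.
  apply: le_trans (ge0_ler_powR (ltW d0) _ _ z1) _; rewrite ?nnegrE ?(ltW h1)//.
  by rewrite -powRrM mulVf ?gt_eqF// powRr1// ltW// divr_gt0.
rewrite mulrAC; apply: le_trans (ler_wpM2l _ z3) _; first by rewrite mulr_ge0// powR_ge0.
rewrite mulrA ler_pdivrMr// mulrC ler_wpM2l ?(ltW e0)//.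
by rewrite lerDl.
Unshelve. all: by end_near.
Qed.

(** The factors 2 come from the two sides of the comparison in the matrix, the
    diameter 2 d of a pair of cells, and the halving of the distance. *)
Definition osc_const (A delta : R) : R := 2 * (A * 2 `^ delta * 2 `^ (n%:R + delta)).

(** The side of the cells enters with the exponent delta through the displacement,
    - n - delta through the distance and n through the volume of a cell, so it
    disappears from the bound. The constant 8 + 4 c1 makes the distance at the
    corners at least twice what [near_base_far] and the regularity of the kernel
    require. *)
Lemma kernel_osc_le (A delta c1 : R) k sig N (i j : G N) x y d : 0 <= A -> 0 < delta -> 0 <= c1 ->
  (forall x x' y, `|sig x y - sig x' y| <= `|x - x'|) ->
  (forall x y y', `|sig x y - sig x y'| <= `|y - y'|) ->
  kernel_regular A delta c1 k sig -> (0 < d)%N -> (8 + 4 * c1) * d%:R <= cell_dist sig i j ->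
  closed_cell i x -> `|y - cell_corner j| <= 2 * d%:R * cell_side N ->
  0 < sig x y /\
  2 * (`|k x y - k x (cell_corner j)| * cell_vol (n := n) N) <=
    osc_const A delta * d%:R `^ delta * cell_dist sig i j `^ (- n%:R - delta).
Proof.
move=> A0 d0 c0 sx sy reg dg hd ix jy; have s0 := @cell_side_gt0 R N.
have d1 : 1 <= d%:R :> R by rewrite ler1n.
have c1d : 0 <= c1 * d%:R by rewrite mulr_ge0.
have r0 : 0 < cell_dist sig i j by apply: lt_le_trans hd; lra.
have ix' := closed_cell_corner ix.
have ix'' : `|x - cell_corner i| <= 1 * cell_side N by rewrite mul1r.
have f1 : cell_dist sig i j * cell_side N / 2 <= sig x y.
  by apply: near_base_far sx sy ix'' jy _; lra.
have f2 : cell_dist sig i j * cell_side N / 2 <= sig x (cell_corner j).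
  have jy' : `|(cell_corner j : X) - cell_corner j| <= 0 * cell_side N.
    by rewrite subrr normr0 mul0r.
  by apply: near_base_far sx sy ix'' jy' _; lra.
have p0 : 0 < cell_dist sig i j * cell_side N / 2 by rewrite divr_gt0// mulr_gt0.
split; first exact: lt_le_trans f1.
have hc : c1 * `|cell_corner j - y| <= sig x (cell_corner j).
  apply: le_trans f2; rewrite distrC; apply: le_trans (ler_wpM2l c0 jy) _.
  have h := ler_wpM2r (ltW s0) hd; nra.
have := reg _ _ _ (lt_le_trans p0 f2) hc; rewrite distrC (distrC (cell_corner j)) => h.
have h1 : `|y - cell_corner j| `^ delta <= (2 * d%:R * cell_side N) `^ delta.
  by rewrite ge0_ler_powR ?nnegrE ?(ltW d0)// !mulr_ge0// ltW.
have h2 : sig x (cell_corner j) `^ (- n%:R - delta) <=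
    (cell_dist sig i j * cell_side N / 2) `^ (- n%:R - delta).
  have -> : - n%:R - delta = - (n%:R + delta) by rewrite opprD.
  rewrite !powRN lef_pV2 ?posrE ?powR_gt0// ?(lt_le_trans p0 f2)//.
  rewrite ge0_ler_powR ?nnegrE ?(ltW p0)// ?(ltW (lt_le_trans p0 f2))//.
  by rewrite addr_ge0// ltW.
have {}h : `|k x y - k x (cell_corner j)| * cell_vol (n := n) N <= A * (2 * d%:R * cell_side N) `^ delta *
    (cell_dist sig i j * cell_side N / 2) `^ (- n%:R - delta) * cell_vol (n := n) N.
  rewrite ler_wpM2r ?(ltW (cell_vol_gt0 _))//; apply: le_trans h _.
  apply: ler_pM; rewrite ?mulr_ge0 ?powR_ge0//.
  by rewrite ler_wpM2l.
apply: le_trans (ler_wpM2l (ler0n _ 2) h) _.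
move: r0 h; clear -s0; move: (cell_dist sig i j) => w w0 h.
have -> : (2 * d%:R * cell_side N) `^ delta = 2 `^ delta * d%:R `^ delta * cell_side N `^ delta.
  by rewrite !powRM// ?mulr_ge0// ltW.
have -> : (w * cell_side N / 2) `^ (- n%:R - delta) =
    w `^ (- n%:R - delta) * cell_side N `^ (- n%:R - delta) * 2 `^ (n%:R + delta).
  rewrite !powRM ?mulr_ge0 ?(ltW w0) ?(ltW s0) ?invr_ge0//.
  by rewrite -[2^-1](@powR_inv1 R)// -powRrM mulN1r opprD !opprK.
have -> : cell_vol (n := n) N = cell_side N `^ n%:R :> R by rewrite powR_mulrn ?(ltW s0).
have E : cell_side N `^ delta * cell_side N `^ (- n%:R - delta) * cell_side N `^ n%:R = 1.
  by rewrite -!powRD ?(gt_eqF s0) ?implybT// (_ : _ + _ = 0) ?powRr0//; ring.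
rewrite -[leRHS]mulr1 -[X in _ <= _ * X]E /osc_const.
move: (cell_side N `^ delta) (cell_side N `^ (- n%:R - delta)) (cell_side N `^ n%:R) => u v z.
by rewrite le_eqVlt; apply/orP; left; apply/eqP; ring.
Qed.

End cell_kernel.

(** * Real singular integral operators on L^2 *)

(** Cross-multiplying compares the averages a / m' and b / m, both close to e,
    without dividing by masses that might vanish. *)
Lemma cross_bound (R : realType) (m m' a b e eta : R) : 0 <= m -> 0 <= m' ->
  `|b - e * m| <= eta * m -> `|a - e * m'| <= eta * m' ->
  `|m' * b - m * a| <= 2 * eta * (m * m').
Proof.
move=> m0 m0' hb ha.
rewrite (_ : m' * b - m * a = m' * (b - e * m) - m * (a - e * m')); last by ring.
apply: le_trans (ler_normB _ _) _; rewrite !normrM (ger0_norm m0) (ger0_norm m0').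
apply: le_trans (lerD (ler_wpM2l m0' hb) (ler_wpM2l m0 ha)) _.
by rewrite le_eqVlt; apply/orP; left; apply/eqP; ring.
Qed.

Section real_operator.
Context {R : realType} {n : nat}.
Local Notation X := 'rV[R]_n.
Local Notation mu := (@lebesgue_rV R n : {measure set X -> \bar R}).
Local Notation G N := {ffun 'I_n -> 'I_(2 ^ (N + N).+1)}.
Context (U : (X -> R) -> X -> R) (k sig : X -> X -> R) (B A delta c1 C : R) (q : nat).
Context (B0 : 0 < B) (A0 : 0 <= A) (d0 : 0 < delta) (c10 : 0 <= c1) (C0 : 0 <= C).
Context (U_L2 : forall f, L2fun f -> L2fun (U f) /\ (Ip mu 2 (U f) <= B%:E * Ip mu 2 f)%E).
Context (U_lin : forall a f g, L2fun f -> L2fun g ->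
  {ae mu, forall x, U (fun y => a * f y + g y) x = a * U f x + U g x}).
Context (sigx : forall x x' y, `|sig x y - sig x' y| <= `|x - x'|).
Context (sigy : forall x y y', `|sig x y - sig x y'| <= `|y - y'|).
Context (reg_y : kernel_regular A delta c1 k sig).
Context (reg_x : kernel_regular A delta c1 (fun y x => k x y) (fun y x => sig x y)).
Context (cov_y : fibre_cover C q sig) (cov_x : fibre_cover C q (fun y x => sig x y)).
Context (krep : forall N (i : G N) l, {ae mu, forall x,
  (forall y, closed_cell i y -> 0 < sig x y) ->
  U (cell_bump i l) x = (\int[mu]_y (k x y * cell_bump i l y))%R}).

Lemma operator_dist_le f g : L2fun f -> L2fun g ->
  (Ip mu 2 (fun x => U f x - U g x)%R <= B%:E * Ip mu 2 (fun x => f x - g x)%R)%E.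
Proof.
move=> hf hg; have hfg := L2fun_sub hf hg.
have [hU hB] := U_L2 hfg; apply: le_trans hB.
have [m1 _] := L2fun_sub (U_L2 hf).1 (U_L2 hg).1.
have E : (fun y => f y - g y) = (fun y => -1 * g y + f y).
  by apply/funext => x; rewrite mulN1r addrC.
rewrite le_eqVlt; apply/orP; left; apply/eqP.
apply: Ip_ae_eq => //; first exact: hU.1.
have := U_lin (-1) hg hf; rewrite -E; apply: filterS => x ->.
by rewrite mulN1r addrC.
Qed.

Lemma operator_cvg (F : nat -> X -> R) f : (forall l, L2fun (F l)) -> L2fun f ->
  Ip mu 2 (fun x => F l x - f x) @[l --> \oo] --> 0%E ->
  Ip mu 2 (fun x => U (F l) x - U f x) @[l --> \oo] --> 0%E.
Proof.
move=> hF hf Ff.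
apply: (@squeeze_cvge _ _ _ _ (fun=> 0%E) _ (fun l => (B%:E * Ip mu 2 (fun x => F l x - f x)%R)%E)).
- by apply: nearW => l; rewrite Ip_ge0/= (operator_dist_le (hF l) hf).
- exact: cvg_cst.
- by rewrite -[X in _ --> X](mule0 B%:E); apply: cvgeZl.
Qed.

Definition cell_matrix N (i j : G N) : R := cell_mean (U (\1_(cell j))) i.

Lemma L2fun_cell N (j : G N) : L2fun (\1_(cell j) : X -> R).
Proof. by apply: L2fun_indic; [exact: measurable_cell|rewrite lebesgue_cell ltry]. Qed.

(** Allows computing the matrix with bumps, to which the kernel representation
    applies. *)
Lemma cell_matrix_lim N (i j : G N) :
  cell_mean (U (cell_bump j l)) i @[l --> \oo] --> cell_matrix i j.
Proof.
apply: cell_mean_cvg; [by move=> l; exact: (U_L2 (L2fun_bump j l)).1|exact: (U_L2 (L2fun_cell j)).1|].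
apply: operator_cvg; [by move=> l; exact: L2fun_bump|exact: L2fun_cell|exact: bump_cvg].
Qed.

Lemma cell_mean_cross N (i : G N) (a b : R) f g : L2fun f -> L2fun g ->
  cell_mean (fun x => a * f x - b * g x) i = a * cell_mean f i - b * cell_mean g i.
Proof.
move=> hf hg; have h0 : L2fun ((fun=> 0) : X -> R).
  split; first exact: measurable_cst.
  rewrite IpE; under eq_integral do rewrite normr0 powR0 ?pnatr_eq0//.
  by rewrite integral0.
have e0 : cell_mean (fun=> 0) i = 0 :> R by rewrite /cell_mean Rintegral_cst ?mul0r//; exact: measurable_cell.
have hbg := L2fun_lin (- b) hg h0.
have E : (fun x => a * f x - b * g x) = (fun x => a * f x + (- b * g x + 0)).
  by apply/funext => x; rewrite addr0 mulNr.
rewrite E (cell_mean_lin a i hf hbg) (cell_mean_lin (- b) i hg h0) e0.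
by rewrite addr0 mulNr.
Qed.

Lemma L2fun_cross (a b : R) (f g : X -> R) : L2fun f -> L2fun g -> L2fun (fun x => a * f x - b * g x).
Proof.
move=> hf hg; have hh := L2fun_lin (- b) hg (L2fun_lin (a - 1) hf hf).
rewrite (_ : (fun x => _) = (fun x => - b * g x + ((a - 1) * f x + f x)))//.
by apply/funext => x; ring.
Qed.

Local Notation cst0 := (8 + 4 * c1).

Lemma bump_average (u : X -> R) (a e : R) N (h : G N) l :
  (forall y, closed_cell h y -> {for y, continuous u}) ->
  (forall y, closed_cell h y -> `|u y - a| <= e) ->
  `|(\int[mu]_y (u y * cell_bump h l y))%R - a * @bump_mass R n N h l| <= e * @bump_mass R n N h l.
Proof.
move=> cu ua; have cb := @continuous_bump R n N h l; have b0 := @bump_out R n N h l.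
have <- : (\int[mu]_y (a * cell_bump h l y))%R = a * @bump_mass R n N h l.
  by rewrite RintegralZl//; exact: (continuous_cell_integrable cb b0).
apply: (@Rintegral_close _ _ _ h u (fun=> a)) => //.
- exact: continuous_kernel_bump.
- by apply: continuous_kernel_bump => y _; exact: cst_continuous.
- exact: bump_ge0.
Qed.

Lemma corner_in_cell N (i : G N) : closed_cell i (cell_corner i : X).
Proof. by move=> l; rewrite lexx lerDl ltW// cell_side_gt0. Qed.

Lemma near_corner N (i i' : G N) (x : X) d : (0 < d)%N -> (forall l, (`|(i l : int) - i' l| <= d)%N) ->
  closed_cell i x \/ closed_cell i' x -> `|x - cell_corner i| <= 2 * d%:R * cell_side N.
Proof.
move=> dg h hx; have s0 := @cell_side_gt0 R N; have d1 : 1 <= d%:R :> R by rewrite ler1n.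
case: hx => /closed_cell_corner hx.
  by apply: le_trans hx _; rewrite ler_peMl ?(ltW s0)//; lra.
have e0 : 0 <= d%:R * cell_side N :> R by rewrite mulr_ge0// ltW.
have h' : `|(cell_corner i' : X) - cell_corner i| <= d%:R * cell_side N.
  apply/mx_norm_le => // l; rewrite mxE [X in _ + X]mxE cell_corner_sub.
  rewrite normrM (gtr0_norm s0) ler_pM2r// -intr_norm -natr_absz ler_nat.
  by rewrite distnC.
rewrite -(subrKA (cell_corner i')); apply: le_trans (ler_normD _ _) _.
by have := ler_wpM2r (ltW s0) d1; lra.
Qed.

(** On the cell i, away from the singular set, the images of the bumps of the cells
    j and j' are integrals of the kernel, both close to its value at the corner of
    j times the mass of the bump. *)
Lemma cell_matrix_regular_y N (i j j' : G N) d : (0 < d)%N ->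
  (forall l, (`|(j l : int) - j' l| <= d)%N) -> cst0 * d%:R <= cell_dist sig i j ->
  `|cell_matrix i j - cell_matrix i j'| <=
    osc_const (n := n) A delta * d%:R `^ delta * cell_dist sig i j `^ (- n%:R - delta).
Proof.
move=> dg jj' hd; have v0 := @cell_vol_gt0 R n N; set W := leRHS.
pose eta := W / (2 * cell_vol (n := n) N).
have osc x y : closed_cell i x -> closed_cell j y \/ closed_cell j' y ->
    0 < sig x y /\ `|k x y - k x (cell_corner j)| <= eta.
  move=> ix jy; have hy := near_corner dg jj' jy.
  have [h1 h2] := kernel_osc_le A0 d0 c10 sigx sigy reg_y dg hd ix hy.
  by split => //; rewrite /eta ler_pdivlMr ?mulr_gt0// mulrCA.
have eta0 : 0 <= eta.
  have [_] := osc (cell_corner i) (cell_corner j) (@corner_in_cell _ i) (or_introl (@corner_in_cell _ j)).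
  by apply: le_trans.
have cmp l : `|bump_mass j' l * cell_mean (U (cell_bump j l)) i -
    bump_mass j l * cell_mean (U (cell_bump j' l)) i| <= 2 * eta * (bump_mass j l * bump_mass j' l).
  have hj := (U_L2 (L2fun_bump j l)).1; have hj' := (U_L2 (L2fun_bump j' l)).1.
  rewrite -cell_mean_cross// -[X in `|X|]subr0.
  have m0 := bump_mass_ge0 (R := R) j l; have m0' := bump_mass_ge0 (R := R) j' l.
  apply: cell_mean_le.
  - exact: mulr_ge0 (mulr_ge0 (ler0n R 2) eta0) (mulr_ge0 m0 m0').
  - exact: L2fun_cross.
  have kc x y : 0 < sig x y -> {for y, continuous (k x)}.
    exact: kernel_regular_continuous A0 d0 c10 reg_y.
  have close (x : X) (h : G N) : closed_cell i x -> (forall y : X, closed_cell h y -> closed_cell j y \/ closed_cell j' y) ->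
      `|(\int[mu]_y (k x y * cell_bump h l y))%R - k x (cell_corner j) * @bump_mass R n N h l| <= eta * @bump_mass R n N h l.
    move=> ix hh; apply: bump_average => y /hh /(osc _ _ ix)[]//.
    by move=> s0 _; exact: kc.
  apply: filterS2 (krep j l) (krep j' l) => x rj rj' /cell_closed ix.
  rewrite rj; last by move=> y jy; exact: (osc _ _ ix (or_introl jy)).1.
  rewrite rj'; last by move=> y jy; exact: (osc _ _ ix (or_intror jy)).1.
  rewrite subr0.
  have := close x j ix (fun y => @or_introl _ _); have := close x j' ix (fun y => @or_intror _ _).
  by move=> h1 h2; exact: (cross_bound m0 m0' h2 h1).
have lim1 : `|bump_mass j' l * cell_mean (U (cell_bump j l)) i -
    bump_mass j l * cell_mean (U (cell_bump j' l)) i| @[l --> \oo] -->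
   `|cell_vol (n := n) N * cell_matrix i j - cell_vol (n := n) N * cell_matrix i j'|.
  apply: cvg_norm; apply: cvgB; apply: cvgM;
   [exact: bump_mass_cvg|exact: cell_matrix_lim|exact: bump_mass_cvg|exact: cell_matrix_lim].
have lim2 : 2 * eta * (bump_mass j l * bump_mass j' l) @[l --> \oo] -->
    2 * eta * (cell_vol (n := n) N * cell_vol (n := n) N).
  by apply: cvgMl_tmp; apply: cvgM; exact: bump_mass_cvg.
suff : `|cell_vol (n := n) N * cell_matrix i j - cell_vol (n := n) N * cell_matrix i j'| <=
    2 * eta * (cell_vol (n := n) N * cell_vol (n := n) N).
  rewrite -mulrBr normrM gtr0_norm// mulrCA ler_pM2l// => /le_trans; apply.
  rewrite /eta mulrAC le_eqVlt; apply/orP; left; apply/eqP; field.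
  by rewrite gt_eqF.
by apply: ler_cvg_to lim1 lim2 _; exact: nearW.
Qed.

(** Now a single bump is used, and its image is compared on the cells i and i' with
    its value at the corner of i. *)
Lemma cell_matrix_regular_x N (i i' j : G N) d : (0 < d)%N ->
  (forall l, (`|(i l : int) - i' l| <= d)%N) -> cst0 * d%:R <= cell_dist sig i j ->
  `|cell_matrix i j - cell_matrix i' j| <=
    osc_const (n := n) A delta * d%:R `^ delta * cell_dist sig i j `^ (- n%:R - delta).
Proof.
move=> dg ii' hd; have v0 := @cell_vol_gt0 R n N; set W := leRHS.
pose eta := W / (2 * cell_vol (n := n) N).
have osc (x y : X) : closed_cell j y -> closed_cell i x \/ closed_cell i' x ->
    0 < sig x y /\ `|k x y - k (cell_corner i) y| <= eta.
  move=> jy ix; have hx := near_corner dg ii' ix.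
  have sigx' (y' z z' : X) : `|sig z y' - sig z' y'| <= `|z - z'| by exact: sigx.
  have sigy' (z z' y' : X) : `|sig y' z - sig y' z'| <= `|z - z'| by exact: sigy.
  have [h1 h2] := @kernel_osc_le _ _ _ _ _ (fun y x => k x y) (fun y x => sig x y) N j i _ _ _ A0 d0 c10 sigy' sigx' reg_x dg hd jy hx.
  by split => //; rewrite /eta ler_pdivlMr ?mulr_gt0// mulrCA.
have eta0 : 0 <= eta.
  have [_] := osc (cell_corner i) (cell_corner j) (@corner_in_cell _ j) (or_introl (@corner_in_cell _ i)).
  by apply: le_trans.
have kc (x y : X) : 0 < sig x y -> {for y, continuous (k x)}.
  exact: kernel_regular_continuous A0 d0 c10 reg_y.
have cmp l : `|cell_mean (U (cell_bump j l)) i - cell_mean (U (cell_bump j l)) i'| <= 2 * eta * bump_mass j l.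
  have hj := (U_L2 (L2fun_bump j l)).1; have m0 := bump_mass_ge0 (R := R) j l.
  pose c := (\int[mu]_y (k (cell_corner i) y * cell_bump j l y))%R.
  have close (h : G N) : (forall x : X, closed_cell h x -> closed_cell i x \/ closed_cell i' x) ->
      `|cell_mean (U (cell_bump j l)) h - c| <= eta * bump_mass j l.
    move=> hh; apply: cell_mean_le => //; first exact: mulr_ge0 eta0 m0.
    apply: filterS (krep j l) => x rj /cell_closed /hh ix.
    rewrite rj; last by move=> y jy; exact: (osc _ _ jy ix).1.
    apply: (@Rintegral_close _ _ _ j (k x) (k (cell_corner i)) (cell_bump j l)).
    - by apply: continuous_kernel_bump => y jy; exact/kc/(osc _ _ jy ix).1.
    - by apply: continuous_kernel_bump => y jy; exact/kc/(osc _ _ jy (or_introl (@corner_in_cell _ i))).1.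
    - exact: continuous_bump.
    - exact: bump_ge0.
    - exact: bump_out.
    - by move=> y jy; exact: (osc _ _ jy ix).2.
  have h1 := close i (fun y => @or_introl _ _); have h2 := close i' (fun y => @or_intror _ _).
  rewrite (_ : 2 * eta * _ = eta * bump_mass j l + eta * bump_mass j l); last by ring.
  by rewrite -(subrKA c); apply: le_trans (ler_normD _ _) _; rewrite lerD// distrC.
have lim1 : `|cell_mean (U (cell_bump j l)) i - cell_mean (U (cell_bump j l)) i'| @[l --> \oo] -->
   `|cell_matrix i j - cell_matrix i' j|.
  by apply: cvg_norm; apply: cvgB; exact: cell_matrix_lim.
have lim2 : 2 * eta * bump_mass j l @[l --> \oo] --> 2 * eta * (cell_vol (n := n) N).
  by apply: cvgMl_tmp; exact: bump_mass_cvg.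
suff /le_trans : `|cell_matrix i j - cell_matrix i' j| <= 2 * eta * (cell_vol (n := n) N).
  apply; rewrite /eta le_eqVlt; apply/orP; left; apply/eqP; field.
  by rewrite gt_eqF.
by apply: ler_cvg_to lim1 lim2 _; exact: nearW.
Qed.

Lemma cell_mean_U_lin N (i : G N) a f g : L2fun f -> L2fun g ->
  cell_mean (U (fun x => a * f x + g x)) i = a * cell_mean (U f) i + cell_mean (U g) i.
Proof.
move=> hf hg; have [hUf _] := U_L2 hf; have [hUg _] := U_L2 hg.
have [[m1 _] _] := U_L2 (L2fun_lin a hf hg).
rewrite -cell_mean_lin//; apply: cell_mean_ae => //.
  by case: (L2fun_lin a hUf hUg).
exact: U_lin.
Qed.

Lemma cell_matrix_step N (c : G N -> R) i :
  \sum_j cell_matrix i j * c j = cell_mean (U (step c)) i.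
Proof.
have h0 : L2fun ((fun=> 0) : X -> R).
  by have := @L2fun_step R n N (fun=> 0); congr (L2fun _); apply/funext => x; rewrite /step big1// => j _; rewrite mul0r.
have U0 : cell_mean (U (fun=> 0)) i = 0.
  have := cell_mean_U_lin i 1 h0 h0.
  rewrite (_ : (fun x => 1 * 0 + 0) = (fun=> 0) :> (X -> R)); last by apply/funext => x; rewrite mul1r addr0.
  by rewrite mul1r => /eqP; rewrite -subr_eq0 opprD addNKr oppr_eq0 => /eqP.
rewrite /step; have : L2fun (fun x : X => \sum_(j <- index_enum (G N)) c j * \1_(cell j) x) /\
   \sum_(j <- index_enum (G N)) cell_matrix i j * c j =
   cell_mean (U (fun x => \sum_(j <- index_enum (G N)) c j * \1_(cell j) x)) i; last by case.
elim: (index_enum _) => [|j s [IH1 IH2]].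
  rewrite big_nil (_ : (fun x => _) = (fun=> 0) :> (X -> R)); last first.
    by apply/funext => x; rewrite big_nil.
  by rewrite U0.
rewrite (_ : (fun x => _) = (fun x : X => c j * \1_(cell j) x + \sum_(j <- s) c j * \1_(cell j) x)); last first.
  by apply/funext => x; rewrite big_cons.
split; first exact: L2fun_lin (L2fun_cell j) IH1.
by rewrite (cell_mean_U_lin _ _ (L2fun_cell j) IH1) big_cons IH2 mulrC.
Qed.

Lemma cell_matrix_L2 N (f : G N -> R) :
  \sum_(i : G N) (\sum_j cell_matrix i j * f j) ^+ 2 <= B * \sum_j f j ^+ 2.
Proof.
have v0 := @cell_vol_gt0 R n N; rewrite -(ler_pM2l v0).
have [[m1 m2] h] := U_L2 (@L2fun_step R n N f).
have := le_trans (sum_cell_mean_pow N (ler1n R 2) m1 m2) h.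
rewrite Ip_step// -EFinM lee_fin mulrCA.
have E (g : G N -> R) : \sum_i `|g i| `^ 2 = \sum_i g i ^+ 2.
  by apply: eq_bigr => i _; rewrite powR_mulrn// real_normK ?num_real.
by rewrite !E; under eq_bigr do rewrite -cell_matrix_step.
Qed.

Lemma cell_matrix_kernel N :
  discrete_kernel (n := n) B (osc_const (n := n) A delta) delta (q%:R * (4 * C + 1) ^+ n) cst0
    (@cell_matrix N) (@cell_dist _ _ sig N).
Proof.
split; first exact: cell_matrix_L2.
  split; first by move=> t j t1; exact: cell_dist_growth.
  by move=> i j j' d dg jj' h; exact: cell_matrix_regular_y.
split; first by move=> t j t1; exact: (cell_dist_growth j C0 cov_x t1).
by move=> i j j' d dg jj' h; exact: cell_matrix_regular_x.
Qed.

(** The absolute values make these constants nonnegative without unfolding them. *)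
Definition strong_bound p : R := `|strong_const n B (osc_const (n := n) A delta) delta
  (q%:R * (4 * C + 1) ^+ n) cst0 p|.
Definition weak_bound : R := `|weak_const n B (osc_const (n := n) A delta) delta
  (q%:R * (4 * C + 1) ^+ n) cst0|.

Let osc0 : 0 <= osc_const (n := n) A delta.
Proof. by rewrite !mulr_ge0// powR_ge0. Qed.

Let growth0 : 0 <= q%:R * (4 * C + 1) ^+ n.
Proof. by rewrite mulr_ge0// exprn_ge0// addr_ge0// mulr_ge0. Qed.

Let cst1 : 1 <= cst0.
Proof. by move: c10; lra. Qed.

Let F (f : X -> R) N := dyadic_proj N (U (dyadic_proj N f)).

Lemma L2fun_proj N f : L2fun (dyadic_proj N f : X -> R). Proof. exact: L2fun_step. Qed.

(** The compressions of the operator to the step functions of level N converge to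
    it, the projections being contractions that converge to the identity. *)
Lemma compression_cvg f : L2fun f -> Ip mu 2 (fun x => F f N x - U f x) @[N --> \oo] --> 0%E.
Proof.
move=> hf; have [hU _] := U_L2 hf.
pose a N := Ip mu 2 (fun x => dyadic_proj N f x - f x).
pose b N := Ip mu 2 (fun x => dyadic_proj N (U f) x - U f x).
apply: (@squeeze_cvge _ _ _ _ (fun=> 0%E) _ (fun N => ((2 `^ 2)%:E * (B%:E * a N + b N))%E)).
- apply: nearW => N; rewrite Ip_ge0/=.
  have [hV _] := U_L2 (L2fun_proj N f); have hVU := L2fun_sub hV hU.
  have E : (fun x => F f N x - U f x) = (fun x => dyadic_proj N (fun y => U (dyadic_proj N f) y - U f y) x +
      (dyadic_proj N (U f) x - U f x)).
    apply/funext => x.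
    have -> : (fun y => U (dyadic_proj N f) y - U f y) = (fun y => -1 * U f y + U (dyadic_proj N f) y).
      by apply/funext => y; rewrite mulN1r addrC.
    by rewrite (dyadic_proj_lin _ _ _ hU hV) /F; ring.
  rewrite E; apply: le_trans (Ip_add mu (ler0n R 2) (L2fun_proj _ _).1 (L2fun_sub (L2fun_proj _ _) hU).1) _.
  rewrite lee_pmul2l ?lte_fin ?powR_gt0// leeD2r//.
  apply: le_trans (Ip_dyadic_proj N (ler1n R 2) hVU.1 hVU.2) _.
  exact: operator_dist_le (L2fun_proj N f) hf.
- exact: cvg_cst.
- have -> : 0%E = ((2 `^ 2)%:E * (B%:E * 0 + 0))%E :> \bar R by rewrite !mule0 adde0 mule0.
  apply: cvgeZl => //; apply: cvgeD; first by rewrite mule0.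
    by apply: cvgeZl => //; exact: dyadic_proj_cvg.
  exact: dyadic_proj_cvg.
Qed.

(** The compressed operator acts on the means over the cells through the matrix,
    and taking means decreases the norm of L^p. Convergence in L^2 implies
    convergence in measure, for which the norm is lower semicontinuous. *)
Lemma operator_strong_type p f : 1 < p -> L2fun f -> (Ip mu p f < +oo)%E ->
  (Ip mu p (U f) <= (strong_bound p)%:E * Ip mu p f)%E.
Proof.
move=> p1 hf fp; have p0 : 0 < p by exact: lt_trans p1.
have [hU _] := U_L2 hf.
have mF N : measurable_fun setT (F f N) by exact: measurable_step.
apply: (Ip_le_of_cvg_mu p0 mF hU.1 (Ip_cvg_mu (ltr0n R 2) mF hU.1 (compression_cvg hf))) => N.
have fin : Ip mu p f \is a fin_num by rewrite ge0_fin_numE ?Ip_ge0.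
rewrite -(fineK fin) -EFinM /F Ip_step// lee_fin.
under eq_bigr do rewrite -cell_matrix_step.
have v0 := @cell_vol_gt0 R n N.
have := sum_cell_mean_pow N (ltW p1) hf.1 fp; rewrite -(fineK fin) lee_fin => h2.
apply: le_trans (ler_wpM2l (normr_ge0 _) h2); rewrite mulrCA ler_pM2l//.
apply: le_trans (ler_wpM2r _ (ler_norm _)); last by apply: sumr_ge0 => *; exact: powR_ge0.
exact: (discrete_kernel_strong B0 osc0 d0 growth0 cst1 (cell_mean f) p1 (cell_matrix_kernel N)).
Qed.

Lemma level_step (l : R) N (c : G N -> R) : 0 < l ->
  mu [set x | l <= `|step c x|] = (cell_vol (n := n) N * #|finset (fun i => l <= `|c i|)|%:R)%:E.
Proof.
move=> l0; have mA : measurable [set x : X | l <= `|step c x|] by apply: measurable_level; exact: measurable_step.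
rewrite -sum1_card natr_sum big_mkcond/=.
rewrite -[X in mu X]setIT -integral_indic// -(@integral_step_ge0 R n N (fun i => if i \in finset (fun i => l <= `|c i|) then 1%:R else 0)); last by move=> i; case: ifP.
apply: eq_integral => x _; congr (_%:E).
rewrite indicE (_ : (x \in _) = (l <= `|step c x|)); last by apply/idP/idP; rewrite inE.
have [[i ix]|h] := pselect (exists i : G N, cell i x).
  by rewrite !(step_cell _ ix) inE; case: (l <= _).
have {}h (i : G N) : ~ cell i x by move=> ix; apply: h; exists i.
by rewrite !(step_out _ h) normr0 leNgt l0.
Qed.

Lemma operator_weak_type (l : R) f : 0 < l -> L2fun f -> (Ip mu 1 f < +oo)%E ->
  (l%:E * mu [set x | (l <= `|U f x|)%R] <= (2 * weak_bound)%:E * Ip mu 1 f)%E.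
Proof.
move=> l0 hf f1; have [hU _] := U_L2 hf.
have mF N : measurable_fun setT (F f N) by exact: measurable_step.
have fin : Ip mu 1 f \is a fin_num by rewrite ge0_fin_numE ?Ip_ge0.
have l2 : 0 < l / 2 by rewrite divr_gt0.
have h : (mu [set x | (l <= `|U f x|)%R] <= (weak_bound * fine (Ip mu 1 f) / (l / 2))%:E)%E.
  apply: (level_le_of_cvg_mu l0 mF hU.1 (Ip_cvg_mu (ltr0n R 2) mF hU.1 (compression_cvg hf))) => N.
  rewrite level_step// lee_fin ler_pdivlMr//.
  have v0 := @cell_vol_gt0 R n N.
  have h2 : cell_vol (n := n) N * \sum_(i : G N) `|cell_mean f i| `^ 1 <= fine (Ip mu 1 f).
    by rewrite -lee_fin fineK//; exact: sum_cell_mean_pow (lexx 1) hf.1 f1.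
  apply: le_trans (ler_wpM2l (normr_ge0 _) h2).
  rewrite -[leLHS]mulrA [leRHS]mulrCA ler_pM2l// mulrC.
  under eq_finset do rewrite -cell_matrix_step.
  apply: le_trans (discrete_kernel_weak B0 osc0 d0 growth0 cst1 (cell_mean f) l2 (cell_matrix_kernel N)) _.
  under [in leRHS]eq_bigr do rewrite powRr1//.
  by rewrite ler_wpM2r ?sumr_ge0// ler_norm.
apply: le_trans (lee_wpmul2l _ h) _; first by rewrite lee_fin ltW.
rewrite -(fineK fin) -!EFinM lee_fin le_eqVlt; apply/orP; left; apply/eqP; field.
by rewrite gt_eqF.
Qed.

End real_operator.

(** * The distance to the curve *)

Section euclidean_norm.
Context {R : realType}.

Lemma mx_norm_le_enorm n (x : 'rV[R]_n) : `|x| <= enorm x.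
Proof.
apply/mx_norm_le; first exact: sqrtr_ge0.
move=> l; rewrite /enorm -sqrtr_sqr ler_wsqrtr// (bigD1 l)//= lerDl.
by apply: sumr_ge0 => i _; exact: sqr_ge0.
Qed.

Lemma enorm_le n (x : 'rV[R]_n) : enorm x <= n%:R * `|x|.
Proof.
have h : \sum_i x ord0 i ^+ 2 <= (n%:R * `|x|) ^+ 2.
  apply: (@le_trans _ _ (\sum_(i < n) `|x| ^+ 2)).
    apply: ler_sum => i _; rewrite -real_normK ?num_real// lerXn2r ?nnegrE//.
    by have /(mx_norm_le _ (normr_ge0 x)) := lexx `|x|.
  rewrite sumr_const card_ord -[leLHS]mulr_natl exprMn ler_wpM2r ?sqr_ge0//.
  by rewrite -natrX ler_nat; case: (n) => // m; rewrite -mulnn leq_pmulr.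
by rewrite /enorm (le_trans (ler_wsqrtr h))// sqrtr_sqr ger0_norm// mulr_ge0.
Qed.

Lemma mx_norm_row_mx n (x y : 'rV[R]_n) : `|x| <= `|row_mx x y| /\ `|y| <= `|row_mx x y|.
Proof.
have /(mx_norm_le _ (normr_ge0 _)) h := lexx `|row_mx x y|.
split; apply/mx_norm_le => // l.
  by rewrite -[X in `|X|](row_mxEl x y); exact: h.
by rewrite -[X in `|X|](row_mxEr x y); exact: h.
Qed.

End euclidean_norm.

Section curve_distance.
Context {R : realType} {n r : nat}.
Local Notation X := 'rV[R]_n.
Context (D : 'I_r.+1 -> set X) (gam : 'I_r.+1 -> X -> X).

(** Distance to the curve in the sup norm. It is at most [rho], so that the
    kernel bounds persist, and unlike [rho] it is Lipschitz in each variable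
    with respect to the norm that suits the cells. *)
Definition curve_dist (x y : X) : R :=
  inf [set d | exists i x', D i x' /\ d = Num.max `|x - x'| `|y - gam i x'|].

Context (hD : standard_hyper_curve D gam).

Lemma curve_nonempty i : D i !=set0.
Proof.
have [/(_ i)[U [_ _ [x Ux] ->]] _ _ _] := hD.
by exists x; exact: subset_closure.
Qed.

Let dist_has_inf x y : has_inf [set d | exists i x', D i x' /\ d = Num.max `|x - x'| `|y - gam i x'|].
Proof.
split.
  have [x' Dx'] := curve_nonempty ord0.
  by exists (Num.max `|x - x'| `|y - gam ord0 x'|), ord0, x'.
by exists 0 => _ [i [x' [_ ->]]]; rewrite le_max normr_ge0.
Qed.

Lemma curve_dist_le x y i x' : D i x' -> curve_dist x y <= Num.max `|x - x'| `|y - gam i x'|.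
Proof. by move=> Dx'; apply: ge_inf; [exact: (dist_has_inf x y).2|exists i, x']. Qed.

Lemma le_curve_dist x y d : (forall i x', D i x' -> d <= Num.max `|x - x'| `|y - gam i x'|) ->
  d <= curve_dist x y.
Proof.
move=> h; apply: lb_le_inf; first exact: (dist_has_inf x y).1.
by move=> _ [i [x' [Dx' ->]]]; exact: h.
Qed.

Lemma curve_dist_lt x y t : curve_dist x y < t ->
  exists i x', [/\ D i x', `|x - x'| < t & `|y - gam i x'| < t].
Proof.
move=> h; apply: contrapT => nh; move: h; apply/negP; rewrite -leNgt.
apply: le_curve_dist => i x' Dx'; rewrite leNgt; apply/negP; rewrite gt_max => /andP[h1 h2].
by apply: nh; exists i, x'.
Qed.

Lemma curve_dist_lipx x x' y : `|curve_dist x y - curve_dist x' y| <= `|x - x'|.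
Proof.
have h u v : curve_dist u y - curve_dist v y <= `|u - v|.
  rewrite lerBlDr -lerBlDl; apply: le_curve_dist => i z Dz.
  rewrite lerBlDl; apply: le_trans (curve_dist_le u y Dz) _; rewrite ge_max; apply/andP; split.
    rewrite -(subrKA v); apply: le_trans (ler_normD _ _) _.
    by rewrite lerD2l le_max lexx.
  by rewrite -[leLHS]add0r lerD// le_max lexx orbT.
by rewrite ler_norml h andbT lerNl opprB distrC h.
Qed.

Lemma curve_dist_lipy x y y' : `|curve_dist x y - curve_dist x y'| <= `|y - y'|.
Proof.
have h u v : curve_dist x u - curve_dist x v <= `|u - v|.
  rewrite lerBlDr -lerBlDl; apply: le_curve_dist => i z Dz.
  rewrite lerBlDl; apply: le_trans (curve_dist_le x u Dz) _; rewrite ge_max; apply/andP; split.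
    by rewrite -[leLHS]add0r lerD// le_max lexx.
  rewrite -(subrKA v); apply: le_trans (ler_normD _ _) _.
  by rewrite lerD2l le_max lexx orbT.
by rewrite ler_norml h andbT lerNl opprB distrC h.
Qed.

Lemma curve_dist_le_rho x y : curve_dist x y <= rho D gam x y.
Proof.
have h i : curve_dist x y <= rho_branch D gam i x y.
  apply: lb_le_inf.
    by have [x' Dx'] := curve_nonempty i; exists (enorm (row_mx x y - row_mx x' (gam i x'))), (row_mx x' (gam i x')) => //; exists x'.
  move=> _ [_ [x' Dx' <-] <-].
  apply: le_trans (curve_dist_le x y Dx') _; apply: le_trans (mx_norm_le_enorm _).
  rewrite opp_row_mx add_row_mx; have [h1 h2] := mx_norm_row_mx (x - x') (y - gam i x').
  by rewrite ge_max h1.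
by rewrite /rho le_bigmin// h.
Qed.

Lemma off_curve x y : 0 < curve_dist x y -> ~ hyper_curve D gam (row_mx x y).
Proof.
move=> h [i _ [x' Dx' /eq_row_mx[ex ey]]]; move: h; apply/negP; rewrite -leNgt.
by apply: le_trans (curve_dist_le x y Dx') _; rewrite -ex -ey !subrr !normr0 maxxx.
Qed.

(** The class of x records a branch realizing the distance. For two points of the
    same class the second coordinates on the branch are both close to y, and the
    Lipschitz inverse brings the first coordinates close to each other; the other
    cover uses the Lipschitz bound of the branch itself. *)
Lemma curve_dist_cover : exists2 C : R, 0 <= C &
  fibre_cover C r.+1 curve_dist /\ fibre_cover C r.+1 (fun y x => curve_dist x y).
Proof.
have [_ _ _ [c c1 hc]] := hD; have c0 : 0 <= c by rewrite (le_trans ler01)// ltW.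
exists (2 + c * n%:R * 2); first by rewrite addr_ge0// !mulr_ge0.
have bound (a b : X) t : 0 < t -> enorm a <= c * enorm b -> `|b| <= 2 * t -> `|a| <= c * n%:R * 2 * t.
  move=> t0 h1 h2; apply: le_trans (mx_norm_le_enorm _) _; apply: le_trans h1 _.
  rewrite -!mulrA ler_wpM2l//; apply: le_trans (enorm_le _) _.
  by rewrite ler_wpM2l.
have tri (a b a' b' : X) t : `|a - a'| < t -> `|b - b'| < t -> `|a - b| <= 2 * t + `|a' - b'|.
  move=> h1 h2; rewrite -(subrKA a') -[a' - b](subrKA b').
  have h3 : `|b' - b| < t by rewrite distrC.
  apply: le_trans (ler_normD _ _) _; have := ler_normD (a' - b') (b' - b); lra.
have sub2 (a a' u v : X) t : `|a - u| < t -> `|a - v| < t -> `|u - v| <= 2 * t.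
  move=> h1 h2; have h3 : `|u - a| < t by rewrite distrC.
  by rewrite -(subrKA a); have := ler_normD (u - a) (a - v); lra.
split.
- move=> y t t0.
  have w x : exists i, curve_dist x y < t -> exists x', [/\ D i x', `|x - x'| < t & `|y - gam i x'| < t].
    case: (ltP (curve_dist x y) t) => [/curve_dist_lt[i h]|h]; first by exists i.
    by exists ord0.
  have [cls hcls] := choice w; exists cls => x x' /hcls[z [Dz h1 h2]] /hcls[z' [Dz' h1' h2']] e.
  rewrite -e in Dz' h2'; have [_ [g gK gl]] := hc (cls x).
  apply: le_trans (tri _ _ _ _ _ h1 h1') _; rewrite [leRHS]mulrDl lerD2l.
  apply: (bound _ (gam (cls x) z - gam (cls x) z')) => //; last exact: sub2 h2 h2'.
  by rewrite -{1}(gK _ Dz) -{1}(gK _ Dz'); apply: gl; [exists z|exists z'].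
- move=> x t t0.
  have w y : exists i, curve_dist x y < t -> exists x', [/\ D i x', `|x - x'| < t & `|y - gam i x'| < t].
    case: (ltP (curve_dist x y) t) => [/curve_dist_lt[i h]|h]; first by exists i.
    by exists ord0.
  have [cls hcls] := choice w; exists cls => y y' /hcls[z [Dz h1 h2]] /hcls[z' [Dz' h1' h2']] e.
  rewrite -e in Dz' h2'; have [gl _] := hc (cls y).
  apply: le_trans (tri _ _ _ _ _ h2 h2') _; rewrite [leRHS]mulrDl lerD2l.
  by apply: (bound _ (z - z')) => //; [exact: gl|exact: sub2 h1 h1'].
Qed.

(** The exponent of the distance being negative, the bounds in terms of [rho] imply
    those in terms of the smaller curve_dist. The factors n pass from the
    Euclidean norm to the sup norm. *)
Lemma curve_kernel_regular K (A delta : R) (phi : R[i] -> R) : 0 < A -> 0 < delta ->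
  (forall a b, `|phi a - phi b| <= normc (a - b)) -> standard_kernel D gam K A delta ->
  kernel_regular (A * n%:R `^ delta) delta (2 * n%:R) (fun x y => phi (K x y)) curve_dist /\
  kernel_regular (A * n%:R `^ delta) delta (2 * n%:R) (fun y x => phi (K x y)) (fun y x => curve_dist x y).
Proof.
move=> A0 d0 hphi hK.
have main x y (z : X) (a : R) : 0 < curve_dist x y -> 2 * n%:R * `|z| <= curve_dist x y ->
    (enorm z <= 2^-1 * rho D gam x y -> a <= A * enorm z `^ delta * rho D gam x y `^ (- n%:R - delta)) ->
    a <= A * n%:R `^ delta * `|z| `^ delta * curve_dist x y `^ (- n%:R - delta).
  move=> s0 hz h; have sr := curve_dist_le_rho x y; have nz := enorm_le z.
  apply: le_trans (h _) _; first by lra.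
  have -> : A * n%:R `^ delta * `|z| `^ delta = A * (n%:R * `|z|) `^ delta by rewrite powRM// mulrA.
  apply: ler_pM; rewrite ?mulr_ge0 ?powR_ge0// ?(ltW A0)//.
    apply: (ler_wpM2l (ltW A0)); apply: (ge0_ler_powR (ltW d0)) => //; rewrite nnegrE ?mulr_ge0//.
    exact: sqrtr_ge0.
  have -> : - n%:R - delta = - (n%:R + delta) by rewrite opprD.
  rewrite !powRN lef_pV2 ?posrE ?powR_gt0// ?(lt_le_trans s0)//.
  have r0 := lt_le_trans s0 sr.
  by rewrite ge0_ler_powR ?nnegrE ?(ltW s0) ?(ltW r0) ?addr_ge0 ?(ltW d0).
split.
- move=> x y y' s0 hy; have [_ h _] := hK _ _ (off_curve s0).
  by apply: main => // /h; exact: le_trans.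
- move=> y x x' s0 hx; have [_ _ h] := hK _ _ (off_curve s0).
  by apply: main => // /h; exact: le_trans.
Qed.

(** Brings the exceptional set of the kernel representation to the form used for
    real operators. *)
Lemma off_curve_preimage (E : set X) x : (forall y, E y -> 0 < curve_dist x y) ->
  ~ curve_preimage D gam E x.
Proof.
move=> h [i _ [Dx Ex]]; have := off_curve (h _ Ex); apply.
by exists i => //; exists x.
Qed.

End curve_distance.

(** * Complex-valued functions *)

Section complex_norm.
Context {R : realType}.
Implicit Types (z w : R[i]) (a b : R).

Lemma normc_sqrt z : normc z = Num.sqrt (complex.Re z ^+ 2 + complex.Im z ^+ 2).
Proof. by case: z. Qed.

Lemma normc_ge0 z : 0 <= normc z.
Proof. by rewrite normc_sqrt sqrtr_ge0. Qed.

Lemma Re_le_normc z : `|complex.Re z| <= normc z.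
Proof. by rewrite normc_sqrt -sqrtr_sqr ler_wsqrtr// lerDl sqr_ge0. Qed.

Lemma Im_le_normc z : `|complex.Im z| <= normc z.
Proof. by rewrite normc_sqrt -sqrtr_sqr ler_wsqrtr// lerDr sqr_ge0. Qed.

Lemma normc_le_ReIm z : normc z <= `|complex.Re z| + `|complex.Im z|.
Proof.
have h : 0 <= `|complex.Re z| + `|complex.Im z| by rewrite addr_ge0.
rewrite normc_sqrt -[leRHS]ger0_norm// -sqrtr_sqr ler_wsqrtr// sqrrD !real_normK ?num_real//.
by rewrite addrAC lerDl mulrn_wge0// mulr_ge0.
Qed.

Lemma normc_triangle z w : normc (z + w) <= normc z + normc w.
Proof. exact: le_normcD. Qed.

Lemma normc_distC z w : normc (z - w) = normc (w - z).
Proof. by rewrite -opprB normcN. Qed.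

Lemma normc_dist_le z w : `|normc z - normc w| <= normc (z - w).
Proof.
have h (u v : R[i]) : normc u - normc v <= normc (u - v).
  by rewrite lerBlDr; apply: le_trans (normc_triangle _ _); rewrite subrK.
by rewrite ler_norml h andbT lerNl opprB normc_distC h.
Qed.

End complex_norm.

Section complex_Lp.
Context {R : realType} {n : nat}.
Local Notation X := 'rV[R]_n.
Local Notation mu := (@lebesgue_rV R n : {measure set X -> \bar R}).
Implicit Types (f g : X -> R[i]) (p : R).

Definition cnorm f : X -> R := fun x => normc (f x).

Lemma measurable_cnorm f : cmeasurable f -> measurable_fun setT (cnorm f).
Proof.
move=> [mr mi]; rewrite (_ : cnorm f = (fun x => Num.sqrt (complex.Re (f x) ^+ 2 + complex.Im (f x) ^+ 2))); last first.
  by apply/funext => x; rewrite /cnorm normc_sqrt.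
apply: (measurableT_comp (f := @Num.sqrt R)).
  by apply: continuous_measurable_fun; exact: sqrt_continuous.
by apply: measurable_funD; apply: measurable_funX.
Qed.

Lemma cmeasurableB f g : cmeasurable f -> cmeasurable g -> cmeasurable (fun x => f x - g x).
Proof.
move=> [m1 m2] [m3 m4]; split.
  rewrite (_ : (fun x => _) = (fun x => complex.Re (f x) - complex.Re (g x))); first exact: measurable_funB.
  by apply/funext => x; rewrite raddfB.
rewrite (_ : (fun x => _) = (fun x => complex.Im (f x) - complex.Im (g x))); first exact: measurable_funB.
by apply/funext => x; rewrite raddfB.
Qed.

Lemma normr_cnorm f x : `|cnorm f x| = cnorm f x.
Proof. by rewrite ger0_norm// normc_ge0. Qed.

Lemma Lp_norm_ge0 p f : (0 <= Lp_norm p f)%E.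
Proof. exact: Lnorm_ge0. Qed.

Lemma Lp_norm_pow p f : 0 < p -> (Lp_norm p f `^ p)%E = Ip mu p (cnorm f).
Proof.
by move=> p0; rewrite /Lp_norm poweR_Lnorm ?gt_eqF.
Qed.

Lemma lee_poweR p (a b : \bar R) : 0 < p -> (0 <= a)%E -> (0 <= b)%E ->
  (a `^ p <= b `^ p)%E = (a <= b)%E.
Proof.
move=> p0 a0 b0; apply/idP/idP; last first.
  by move=> ab; apply: (gt0_ler_poweR (ltW p0)) => //; rewrite in_itv/= ?a0 ?b0 ?leey.
case: a b a0 b0 => [a| |] [b| |]//=; rewrite ?lee_fin ?leey ?gt_eqF//.
by move=> a0 b0; apply: contraTT; rewrite -!ltNge => h; rewrite gt0_ltr_powR.
Qed.

Lemma Lp_norm_fin p f : 0 < p -> (Lp_norm p f < +oo)%E <-> (Ip mu p (cnorm f) < +oo)%E.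
Proof.
move=> p0; rewrite -Lp_norm_pow//; have := Lp_norm_ge0 p f.
by case: (Lp_norm p f) => [a| |]//=; rewrite ?ltry ?gt_eqF.
Qed.

(** The bridge between norms and the integrals of powers used above; the constant
    appears to the power p. *)
Lemma Lp_norm_le p f g (C : R) : 0 < p -> 0 <= C ->
  (Ip mu p (cnorm g) <= (C `^ p)%:E * Ip mu p (cnorm f))%E =
  (Lp_norm p g <= C%:E * Lp_norm p f)%E.
Proof.
move=> p0 C0; rewrite -!Lp_norm_pow// -poweR_EFin -poweRM//; last exact: Lp_norm_ge0.
by rewrite lee_poweR// ?mule_ge0// Lp_norm_ge0.
Qed.

Lemma Lp_norm_cvg0 p (h : nat -> X -> R[i]) : 0 < p ->
  Lp_norm p (h k) @[k --> \oo] --> 0%E <-> Ip mu p (cnorm (h k)) @[k --> \oo] --> 0%E.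
Proof.
move=> p0; have e (k : nat) (r : R) : 0 <= r -> (Lp_norm p (h k) <= r%:E)%E = (Ip mu p (cnorm (h k)) <= (r `^ p)%:E)%E.
  by move=> r0; rewrite -Lp_norm_pow// -poweR_EFin lee_poweR// Lp_norm_ge0.
split=> h0.
  apply/(cvge0P (fun k => Ip_ge0 mu p _)) => r r0.
  have := (cvge0P (fun k => Lp_norm_ge0 p (h k))).1 h0 _ (powR_gt0 p^-1 r0).
  apply: filterS => k; rewrite e ?powR_ge0// -powRrM mulVf ?gt_eqF// powRr1//.
  exact: ltW.
apply/(cvge0P (fun k => Lp_norm_ge0 p _)) => r r0.
have := (cvge0P (fun k => Ip_ge0 mu p (cnorm (h k)))).1 h0 _ (powR_gt0 p r0).
by apply: filterS => k; rewrite e// ltW.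
Qed.

Lemma in_Lp_Ip p f : 0 < p -> in_Lp p f <-> cmeasurable f /\ (Ip mu p (cnorm f) < +oo)%E.
Proof. by move=> p0; rewrite /in_Lp; split=> -[mf /(Lp_norm_fin _ p0)]. Qed.

Lemma Lp_norm1 f : Lp_norm 1 f = Ip mu 1 (cnorm f).
Proof. by rewrite -Lp_norm_pow// poweRe1// Lp_norm_ge0. Qed.

Lemma cnorm_of_real (f : X -> R) x : cnorm (of_real f) x = `|f x|.
Proof. by rewrite /cnorm normc_sqrt/= expr0n/= addr0 sqrtr_sqr. Qed.

Lemma Ip_of_real p (f : X -> R) : Ip mu p (cnorm (of_real f)) = Ip mu p f.
Proof. by rewrite !IpE; apply: eq_integral => x _; rewrite cnorm_of_real normr_id. Qed.

Lemma of_real_L2 (f : X -> R) : L2fun f -> in_Lp 2 (of_real f).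
Proof.
move=> [mf ff]; apply: (in_Lp_Ip _ (ltr0n R 2)).2; split; last by rewrite Ip_of_real.
by split => //=; exact: measurable_cst.
Qed.

End complex_Lp.

(** * Uniqueness of the extension to L^2 *)

Section pairing.
Context {R : realType} {n : nat}.
Local Notation X := 'rV[R]_n.
Local Notation mu := (@lebesgue_rV R n : {measure set X -> \bar R}).
Local Notation G N := {ffun 'I_n -> 'I_(2 ^ (N + N).+1)}.
Implicit Types (f g u : X -> R).

Lemma powR2 (a : R) : `|a| `^ 2 = a ^+ 2.
Proof. by rewrite powR_mulrn// real_normK ?num_real. Qed.

(** The Cauchy-Schwarz inequality in the form ab <= e a^2 + b^2 / e, which needs no
    square root of an extended real. *)
Lemma pairing_bound f g (e : R) : 0 < e -> L2fun f -> L2fun g ->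
  mu.-integrable setT (EFin \o (fun x => f x * g x)) /\
  (`|\int[mu]_x (f x * g x)|%R%:E <= e%:E * Ip mu 2 f + (e^-1)%:E * Ip mu 2 g)%E.
Proof.
move=> e0 [mf ff] [mg fg]; have ie0 : 0 < e^-1 by rewrite invr_gt0.
have mfg : measurable_fun setT (fun x => f x * g x) by exact: measurable_funM.
have m1 := measurable_pow 2 mf; have m2 := measurable_pow 2 mg.
have E : (e%:E * Ip mu 2 f + (e^-1)%:E * Ip mu 2 g =
    \int[mu]_x (e * `|f x| `^ 2 + e^-1 * `|g x| `^ 2)%:E)%E.
  under eq_integral do rewrite EFinD EFinM [(e^-1 * _)%:E]EFinM.
  rewrite !IpE ge0_integralD//.
  - by rewrite !ge0_integralZl// ?lee_fin ?(ltW e0) ?(ltW ie0)// => x _; rewrite lee_fin powR_ge0.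
  - by move=> x _; rewrite -EFinM lee_fin mulr_ge0 ?(ltW e0) ?powR_ge0.
  - exact: measurable_funeM.
  - by move=> x _; rewrite -EFinM lee_fin mulr_ge0 ?(ltW ie0) ?powR_ge0.
  - exact: measurable_funeM.
have pw x : `|f x * g x| <= e * `|f x| `^ 2 + e^-1 * `|g x| `^ 2.
  rewrite !powR2 normrM -(real_normK (num_real (f x))) -(real_normK (num_real (g x))).
  set a := `|f x|; set b := `|g x|.
  have a0 : 0 <= a by exact: normr_ge0.
  have b0 : 0 <= b by exact: normr_ge0.
  have : 0 <= e^-1 * (e * a - b) ^+ 2 by rewrite mulr_ge0 ?sqr_ge0// ltW.
  have -> : e^-1 * (e * a - b) ^+ 2 = e * a ^+ 2 - 2 * (a * b) + e^-1 * b ^+ 2.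
    by field; rewrite gt_eqF.
  have : 0 <= a * b by exact: mulr_ge0.
  by lra.
have fin : (e%:E * Ip mu 2 f + (e^-1)%:E * Ip mu 2 g < +oo)%E.
  apply: lte_add_pinfty.
    by apply: lte_mul_pinfty _ _ ff => //; rewrite lee_fin ltW.
  by apply: lte_mul_pinfty _ _ fg => //; rewrite lee_fin ltW.
have le : (\int[mu]_x `|f x * g x|%R%:E <= e%:E * Ip mu 2 f + (e^-1)%:E * Ip mu 2 g)%E.
  rewrite E; apply: ge0_le_integral => //.
  - by apply/measurable_EFinP; exact: measurableT_comp.
  - apply/measurable_EFinP; apply: measurable_funD; apply: measurable_funM => //.
      by have /measurable_EFinP := m1.
    by have /measurable_EFinP := m2.
  - by move=> x _; rewrite lee_fin.
have I : mu.-integrable setT (EFin \o (fun x => f x * g x)).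
  apply/integrableP; split; first exact/measurable_EFinP.
  exact: le_lt_trans le fin.
split; first exact: I.
apply: le_trans le; apply: (@le_trans _ _ ((\int[mu]_x `|f x * g x|)%R)%:E).
  by rewrite lee_fin; exact: le_normr_Rintegral.
by rewrite /Rintegral fineK//; apply: integrable_fin_num => //; exact: (integrable_norm I).
Qed.

(** The bumps converge in L^2 to the indicator of the cell. *)
Lemma cell_mean_eq0 u N (i : G N) : L2fun u ->
  (forall l, (\int[mu]_x (u x * cell_bump i l x))%R = 0) -> cell_mean u i = 0.
Proof.
move=> hu h; have mc := @measurable_cell R n N i.
have hc := @L2fun_cell R n N i.
have E l : (\int[mu]_(x in cell i) u x)%R = (\int[mu]_x (u x * (\1_(cell i) x - cell_bump i l x)))%R.
  have [I1 _] := pairing_bound ltr01 hu hc; have [I2 _] := pairing_bound ltr01 hu (L2fun_bump i l).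
  under [RHS]eq_Rintegral do rewrite mulrBr.
  rewrite RintegralB// h subr0 Rintegral_mkcond; apply: eq_Rintegral => x _.
  by rewrite patchE indicE; case: ifP => _; rewrite ?mulr1 ?mulr0.
suff z : (\int[mu]_(x in cell i) u x)%R = 0 by rewrite /cell_mean z mul0r.
apply/eqP; rewrite -normr_eq0; apply: contraT => a_neq0.
set a := `|_|%R in a_neq0 *; have a0 : 0 < a by rewrite lt_neqAle eq_sym a_neq0 normr_ge0.
have fin : Ip mu 2 u \is a fin_num by rewrite ge0_fin_numE ?Ip_ge0; case: hu.
pose v := fine (Ip mu 2 u) + 1; have v0 : 0 < v by rewrite ltr_wpDl// fine_ge0// Ip_ge0.
have [e [e0 ev]] : exists e : R, 0 < e /\ e * v = a / 4.
  by exists (a / (4 * v)); split; [rewrite divr_gt0// mulr_gt0|field; rewrite gt_eqF].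
have ea : 0 < e * (a / 4) by rewrite mulr_gt0// divr_gt0.
have [l _ /(_ l (leqnn l))] := (cvge0P (fun k => Ip_ge0 mu 2 _)).1 (bump_cvg i) _ ea.
rewrite /= Ip_distC => hl.
have [_] := pairing_bound e0 hu (L2fun_sub hc (L2fun_bump i l)); rewrite -E -/a => h1.
have : (a%:E <= (e * v)%:E + (e^-1 * (e * (a / 4)))%:E)%E.
  apply: le_trans h1 _; apply: leeD.
    by rewrite [(e * v)%:E]EFinM lee_pmul2l ?lte_fin// -(fineK fin) lee_fin /v lerDl.
  by rewrite [(e^-1 * _)%:E]EFinM lee_pmul2l ?lte_fin ?invr_gt0.
rewrite -EFinD lee_fin [e^-1 * _]mulrA mulVf ?gt_eqF// mul1r ev.
by move=> h2; exfalso; lra.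
Qed.

Lemma Ip_eq0_ae u : measurable_fun setT u -> Ip mu 2 u = 0%E -> {ae mu, forall x, u x = 0}.
Proof.
move=> mu_ z; have := (@ae_eq_integral_abs _ _ _ mu _ measurableT _ (measurable_pow 2 mu_)).1.
have -> : (\int[mu]_x `|(`|u x| `^ 2)%:E| = 0)%E.
  by rewrite -z IpE; apply: eq_integral => x _; rewrite abse_EFin ger0_norm// powR_ge0.
move=> /(_ erefl); apply: filterS => x /(_ I)[] /powR_eq0_eq0.
by move=> /normr0_eq0.
Qed.

End pairing.

(** Real and imaginary parts are treated by the same proofs. *)
Definition real_coord {R : realType} (phi : R[i] -> R) :=
  phi = @complex.Re R \/ phi = @complex.Im R.

Section coordinates.
Context {R : realType} {n : nat} (phi : R[i] -> R) (hphi : real_coord phi).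
Local Notation X := 'rV[R]_n.
Local Notation mu := (@lebesgue_rV R n : {measure set X -> \bar R}).

Lemma coord_le_normc z : `|phi z| <= normc z.
Proof. by case: hphi => ->; [exact: Re_le_normc|exact: Im_le_normc]. Qed.

Lemma coord_lin (a : R) z w : phi (Complex a 0 * z + w) = a * phi z + phi w.
Proof. by case: hphi => ->; case: z w => [z1 z2] [w1 w2] /=; ring. Qed.

Lemma coordB z w : phi (z - w) = phi z - phi w.
Proof. by case: hphi => ->; rewrite raddfB. Qed.

Lemma measurable_coord (f : X -> R[i]) : cmeasurable f -> measurable_fun setT (fun x => phi (f x)).
Proof. by move=> [mr mi]; case: hphi => ->. Qed.

Lemma coord_integral (h : X -> R[i]) (b : X -> R) :
  phi (cintegral (fun y => h y * of_real b y)) = (\int[mu]_y (phi (h y) * b y))%R.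
Proof.
case: hphi => -> /=; apply: eq_Rintegral => y _; case: (h y) => [u v] /=; ring.
Qed.

End coordinates.

Section coordinate_operators.
Context {R : realType} {n : nat}.
Local Notation X := 'rV[R]_n.
Local Notation mu := (@lebesgue_rV R n : {measure set X -> \bar R}).
Local Notation G N := {ffun 'I_n -> 'I_(2 ^ (N + N).+1)}.
Implicit Types (f g : X -> R) (U V : (X -> R) -> X -> R) (phi : R[i] -> R).

Definition L2_operator (B : R) U :=
  (forall f, L2fun f -> L2fun (U f) /\ (Ip mu 2 (U f) <= B%:E * Ip mu 2 f)%E) /\
  (forall a f g, L2fun f -> L2fun g ->
    {ae mu, forall x, U (fun y => a * f y + g y) x = a * U f x + U g x}).

Definition coord_op phi (S : (X -> R[i]) -> X -> R[i]) f : X -> R := fun x => phi (S (of_real f) x).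

Lemma L2_operatorB (B B' : R) U V : 0 < B -> 0 < B' -> L2_operator B U -> L2_operator B' V ->
  L2_operator (4 * (B + B')) (fun f x => U f x - V f x).
Proof.
move=> B0 B0' [bU lU] [bV lV]; split=> [f hf|a f g hf hg].
  have [hU U2] := bU _ hf; have [hV V2] := bV _ hf; split; first exact: L2fun_sub.
  apply: (le_trans (Ip_sub mu (ler0n R 2) hU.1 hV.1)).
  have -> : (2 : R) `^ 2 = 4 by rewrite powR_mulrn//; ring.
  rewrite EFinM -muleA lee_pmul2l ?lte_fin//.
  rewrite EFinD ge0_muleDl ?lee_fin ?(ltW B0) ?(ltW B0')//.
  exact: leeD.
apply: filterS2 (lU a _ _ hf hg) (lV a _ _ hf hg) => x -> ->; ring.
Qed.

(** The means over cells of the images of bumps vanish, hence so does the matrix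
    at every level, and the operator is the limit of its compressions. *)
Lemma L2_operator_eq0 (B : R) U : L2_operator B U ->
  (forall N (i j : G N) l l', (\int[mu]_x (U (cell_bump j l) x * cell_bump i l' x))%R = 0) ->
  forall f, L2fun f -> {ae mu, forall x, U f x = 0}.
Proof.
move=> [bU lU] h f hf; have [hU _] := bU _ hf; apply: Ip_eq0_ae; first exact: hU.1.
have m0 N (i j : G N) : cell_matrix U i j = 0.
  have := cell_matrix_lim bU lU (i := i) (j := j).
  under eq_fun do rewrite (cell_mean_eq0 (bU _ (L2fun_bump _ _)).1 (h _ _ _ _)).
  by move=> /(@cvg_unique _ _ _ _ _ _ (cvg_cst (0 : R))) ->.
have := compression_cvg bU lU hf.
have E N : (fun x => dyadic_proj N (U (dyadic_proj N f)) x - U f x) = (fun x => - U f x).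
  apply/funext => x; rewrite [X in X - _](_ : _ = 0) ?sub0r//; apply: big1 => i _.
  by rewrite -(cell_matrix_step bU lU) big1 ?mul0r// => j _; rewrite m0 mul0r.
under eq_fun do rewrite E Ip_opp.
by move=> z; exact: (cvg_unique _ (cvg_cst (Ip mu 2 (U f))) z).
Qed.

Lemma L2_extension_operator T S : L2_extension T S ->
  exists2 B : R, 0 < B & forall phi, real_coord phi -> L2_operator B (coord_op phi S).
Proof.
move=> [[B0 hB] hlin _]; exists (`|B0| `^ 2 + 1); first by rewrite ltr_wpDl// powR_ge0.
move=> phi hphi; split=> [f hf|a f g hf hg].
  have [Sf Sle] := hB _ (of_real_L2 hf).
  have [mSf fSf] := (in_Lp_Ip _ (ltr0n R 2)).1 Sf.
  have m : measurable_fun setT (coord_op phi S f) by exact: measurable_coord.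
  have le : (Ip mu 2 (coord_op phi S f) <= Ip mu 2 (cnorm (S (of_real f))))%E.
    apply: (Ip_le _ (ler0n R 2) m (measurable_cnorm mSf)) => x.
    by rewrite normr_cnorm; exact: coord_le_normc.
  split; first by split; [exact: m|exact: le_lt_trans le fSf].
  apply: (le_trans le).
  have Sle' : (Lp_norm 2 (S (of_real f)) <= `|B0|%:E * Lp_norm 2 (of_real f))%E.
    apply: (le_trans Sle); apply: lee_wpmul2r; first exact: Lp_norm_ge0.
    by rewrite lee_fin ler_norm.
  move: Sle'; rewrite -(Lp_norm_le _ _ (ltr0n R 2) (normr_ge0 B0)) Ip_of_real => /le_trans; apply.
  by apply: lee_wpmul2r; [exact: Ip_ge0|rewrite lee_fin lerDl].
have := hlin (Complex a 0) _ _ (of_real_L2 hf) (of_real_L2 hg).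
have -> : (fun y => Complex a 0 * of_real f y + of_real g y) = of_real (fun y => a * f y + g y).
  by apply/funext => y; rewrite /of_real; apply/eqP; rewrite eq_complex/=; apply/andP; split; apply/eqP; ring.
by apply: filterS => x e; rewrite /coord_op e coord_lin.
Qed.

(** Test functions being available only as bumps, this is where the pairings
    prescribed by T determine the operator on the whole of L^2. *)
Lemma L2_extension_unique T S S' phi : (0 < n)%N -> L2_extension T S -> L2_extension T S' ->
  real_coord phi -> forall f, L2fun f -> {ae mu, forall x, coord_op phi S f x = coord_op phi S' f x}.
Proof.
move=> n0 hS hS' hphi f hf.
have [B B0 /(_ _ hphi) hB] := L2_extension_operator hS.
have [B' B0' /(_ _ hphi) hB'] := L2_extension_operator hS'.
suff : {ae mu, forall x, coord_op phi S f x - coord_op phi S' f x = 0}.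
  by apply: filterS => x /eqP; rewrite subr_eq0 => /eqP.
apply: (L2_operator_eq0 (L2_operatorB B0 B0' hB hB') _ hf) => N i j l l'.
have hb := @L2fun_bump R n N; have [I1 _] := pairing_bound ltr01 (hB.1 _ (hb j l)).1 (hb i l').
have [I2 _] := pairing_bound ltr01 (hB'.1 _ (hb j l)).1 (hb i l').
under eq_Rintegral do rewrite mulrBl.
rewrite RintegralB//; apply/eqP; rewrite subr_eq0; apply/eqP.
have [_ _ e1] := hS; have [_ _ e2] := hS'.
have t h k := @test_fun_bump R n N h k n0.
have := e1 _ _ (t j l) (t i l'); rewrite (e2 _ _ (t j l) (t i l')) => /(congr1 phi).
by rewrite !coord_integral.
Qed.

End coordinate_operators.

(** * Bounds for the real coordinates *)

Section singular_bounds.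
Context {R : realType} {n r : nat}.
Local Notation X := 'rV[R]_n.
Local Notation mu := (@lebesgue_rV R n : {measure set X -> \bar R}).
Local Notation G N := {ffun 'I_n -> 'I_(2 ^ (N + N).+1)}.
Context (D : 'I_r.+1 -> set X) (gam : 'I_r.+1 -> X -> X) (T : (X -> R[i]) -> (X -> R[i]) -> R[i]).

(** The L^2 bound and the kernel representation are taken from the extension S0
    given with the kernel and transported to S by uniqueness, so that the constant
    is the same for all S. *)
Lemma coord_op_bounds (p : R) : (0 < n)%N -> standard_hyper_curve D gam -> CZO D gam T -> 1 < p ->
  exists2 C : R, 0 < C & forall S phi, L2_extension T S -> real_coord phi -> forall f, L2fun f ->
    (forall l : R, 0 < l -> (Ip mu 1 f < +oo)%E ->
       (l%:E * mu [set x | (l <= `|coord_op phi S f x|)%R] <= C%:E * Ip mu 1 f)%E) /\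
    ((Ip mu p f < +oo)%E -> (Ip mu p (coord_op phi S f) <= C%:E * Ip mu p f)%E).
Proof.
move=> n0 hD [_ [S0 [_ [K [A [delta [hS0 _ _ [A0 d0] [hK hrep]]]]]]]] p1.
have [B B0 hB] := L2_extension_operator hS0.
have [Cg Cg0 [cov_y cov_x]] := curve_dist_cover hD.
have A'0 : 0 <= A * n%:R `^ delta by rewrite mulr_ge0 ?powR_ge0// ltW.
have c10 : 0 <= 2 * n%:R :> R by rewrite mulr_ge0.
pose W := weak_bound (n := n) B (A * n%:R `^ delta) delta (2 * n%:R) Cg r.+1.
pose Z := strong_bound (n := n) B (A * n%:R `^ delta) delta (2 * n%:R) Cg r.+1 p.
have W0 : 0 <= W by exact: normr_ge0.
have Z0 : 0 <= Z by exact: normr_ge0.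
exists (2 * W + Z + 1); first by rewrite ltr_wpDl// addr_ge0// mulr_ge0.
move=> S phi hS hphi f hf.
have [bU0 lU0] := hB _ hphi.
have [B1 _ /(_ _ hphi)[bU1 lU]] := L2_extension_operator hS.
have bU g : L2fun g -> L2fun (coord_op phi S g) /\ (Ip mu 2 (coord_op phi S g) <= B%:E * Ip mu 2 g)%E.
  move=> hg; have [hS1 _] := bU1 _ hg; have [hS2 h2] := bU0 _ hg; split; first exact: hS1.
  rewrite (Ip_ae_eq (ler0n R 2) hS1.1 hS2.1 (L2_extension_unique n0 hS hS0 hphi hg)).
  exact: h2.
have hp a b : `|phi a - phi b| <= normc (a - b) by rewrite -coordB//; exact: coord_le_normc.
have [reg_y reg_x] := curve_kernel_regular hD A0 d0 hp hK.
have krep N (i : G N) l : {ae mu, forall x, (forall y, closed_cell i y -> 0 < curve_dist D gam x y) ->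
    coord_op phi S (cell_bump i l) x = (\int[mu]_y (phi (K x y) * cell_bump i l y))%R}.
  have t := @test_fun_bump R n N i l n0.
  apply: filterS2 (L2_extension_unique n0 hS hS0 hphi (L2fun_bump i l)) (hrep _ t) => x -> e off.
  rewrite /coord_op e ?coord_integral//; apply: (off_curve_preimage hD) => y /supp_bump; exact: off.
have weak := operator_weak_type B0 A'0 d0 c10 Cg0 bU lU (curve_dist_lipx hD) (curve_dist_lipy hD) reg_y reg_x cov_y cov_x krep.
have strong := operator_strong_type B0 A'0 d0 c10 Cg0 bU lU (curve_dist_lipx hD) (curve_dist_lipy hD) reg_y reg_x cov_y cov_x krep p1 hf.
split=> [l l0 f1|fp].
  apply: (le_trans (weak _ _ l0 hf f1)); apply: lee_wpmul2r; first exact: Ip_ge0.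
  by rewrite lee_fin -/W; lra.
apply: (le_trans (strong fp)); apply: lee_wpmul2r; first exact: Ip_ge0.
by rewrite lee_fin -/Z; lra.
Qed.

End singular_bounds.

(** * Completeness in measure and truncation *)

Section complete_in_measure.
Context {d : measure_display} {T : measurableType d} {R : realType}.
Variable mu : {measure set T -> \bar R}.
Implicit Types (a : nat -> T -> R).

Lemma measure_ae_le (A B : set T) : measurable A -> measurable B ->
  {ae mu, forall x, A x -> B x} -> (mu A <= mu B)%E.
Proof.
move=> mA mB AB; rewrite -[A]setIT -[B]setIT -!integral_indic//.
apply: ae_ge0_le_integral => //.
- by apply/measurable_EFinP; exact: measurable_indic.
- by apply/measurable_EFinP; exact: measurable_indic.
apply: filterS AB => x AB _; rewrite lee_fin !indicE.
by case: (boolP (x \in A)) => //; rewrite inE => /AB xB; rewrite (mem_set xB).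
Qed.

Let e_ j : R := (2 ^+ j)^-1.
Let e_gt0 j : 0 < e_ j. Proof. by rewrite invr_gt0 exprn_gt0. Qed.
Let e_S j : e_ j = 2 * e_ j.+1.
Proof. by rewrite /e_ exprS invfM mulrA divff ?mul1r. Qed.
Let e_small (e : R) : 0 < e -> exists j, 3 * e_ j < e.
Proof.
move=> e0; have [K hK] := dyadic_bound (3 / e) (ltr01 : (0 : R) < 1).
exists K; rewrite mul1r ltr_pdivrMr// in hK.
by rewrite /e_ ltr_pdivrMr ?exprn_gt0// mulrC.
Qed.

(** Borel-Cantelli: off the tail union B j of the exceptional sets, whose measure
    is at most 2 e_j, the sequence is uniformly Cauchy, and its distance to the
    limit is at most 2 e_k from the index j on. *)
Lemma cauchy_cvg_mu a : (forall j, measurable_fun setT (a j)) ->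
  (forall j, (mu [set x | ((2 ^+ j)^-1 <= `|a j.+1 x - a j x|)%R] <= ((2 ^+ j)^-1)%:E)%E) ->
  exists2 b, measurable_fun setT b & cvg_mu mu a b.
Proof.
move=> ma small; pose E j := [set x | e_ j <= `|a j.+1 x - a j x|].
have mE j : measurable (E j).
  by apply: measurable_level; exact: measurable_funB.
pose B j := \bigcup_k E (j + k)%N.
have mB j : measurable (B j) by apply: bigcup_measurable => k _; exact: mE.
have muB j : (mu (B j) <= (2 * e_ j)%:E)%E.
  apply: le_trans (measure_sigma_subadditive mu (fun k => mE (j + k)%N) (mB j) _) _; first by [].
  apply: (@le_trans _ _ (\sum_(0 <= k <oo) (0 + (2 * e_ j / (2 ^ k.+1)%:R)%:E))%E).
    apply: lee_nneseries => [k _ _|k _]; first exact: measure_ge0.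
    rewrite add0e; apply: le_trans (small _) _; rewrite lee_fin.
    rewrite /e_ exprD natrX exprS le_eqVlt; apply/orP; left; apply/eqP; field.
    by rewrite !gt_eqF// exprn_gt0.
  apply: le_trans (epsilon_trick _ _ _) _ => //; first by rewrite mulr_ge0// ltW.
  by rewrite eseries0 ?add0e.
have step_le j x : ~ B j x -> forall k, (j <= k)%N -> `|a k.+1 x - a k x| <= e_ k.
  move=> nB k jk; rewrite leNgt; apply/negP => h; apply: nB.
  by exists (k - j)%N => //; rewrite /E /= subnKC// ltW.
have dist j x : ~ B j x -> forall k m, (j <= k)%N -> `|a (k + m)%N x - a k x| <= 2 * e_ k.
  move=> nB k m jk.
  suff : `|a (k + m)%N x - a k x| <= 2 * e_ k - 2 * e_ (k + m)%N.
    by have := e_gt0 (k + m)%N; lra.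
  elim: m => [|m IH]; first by rewrite addn0 !subrr normr0.
  have := step_le _ _ nB (k + m)%N (leq_trans jk (leq_addr _ _)).
  rewrite addnS [e_ (k + m)%N]e_S in IH *.
  have := ler_normD (a (k + m).+1 x - a (k + m)%N x) (a (k + m)%N x - a k x).
  by rewrite subrKA; lra.
have cvga j x : ~ B j x -> cvgn (fun k => a k x).
  move=> nB; apply: cauchy_cvg; apply: cauchy_exP => e e0 /=.
  have [i hi] := e_small e0; pose k := maxn i j.
  have hk : 2 * e_ k < e.
    apply: le_lt_trans hi; apply: (@le_trans _ _ (2 * e_ i)); last by have := e_gt0 i; lra.
    by rewrite ler_pM2l// lef_pV2 ?posrE ?exprn_gt0// ler_weXn2l ?leq_maxl// ler1n.
  exists (a k x); exists k => // m /= km; rewrite -ball_normE/= distrC -(subnKC km).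
  by apply: le_lt_trans hk; apply: dist nB _ _ _; exact: leq_maxr.
pose Good := ~` \bigcap_j B j.
have mG : measurable Good by apply: measurableC; exact: bigcap_measurable.
(* multiplying by the indicator makes the limit exist everywhere, hence measurable *)
pose b x := limn (fun k => \1_Good x * a k x).
have ab j x : ~ B j x -> a k x @[k --> \oo] --> b x.
  move=> nB; have Gx : Good x by move=> /(_ j I).
  rewrite /b indicE mem_set// (_ : (fun k => _) = (fun k => a k x)); first exact: cvga nB.
  by apply/funext => k; rewrite mul1r.
have mb : measurable_fun setT b.
  apply: (@measurable_fun_cvg _ _ _ setT (fun k x => \1_Good x * a k x)).
    by move=> k; apply: measurable_funM => //; exact: measurable_indic.
  move=> x _; have [Gx|nG] := pselect (Good x).
    have [j nB] : exists j, ~ B j x by apply: contrapT => h; apply: Gx => j _; apply: contrapT => nB; apply: h; exists j.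
    have z : (fun k => \1_Good x * a k x) = (fun k => a k x).
      by apply/funext => k; rewrite indicE mem_set// mul1r.
    by rewrite z; exact: ab nB.
  have z : (fun k => \1_Good x * a k x) = (fun=> 0).
    by apply/funext => k; rewrite indicE memNset// mul0r.
  by rewrite /b z lim_cst//; exact: cvg_cst.
have close k x : ~ B k x -> `|a k x - b x| <= 2 * e_ k.
  move=> nB; have l1 : `|a m x - a k x| @[m --> \oo] --> `|b x - a k x|.
    by apply: cvg_norm; apply: cvgB; [exact: ab nB|exact: cvg_cst].
  rewrite distrC; apply: (ler_cvg_to l1 (cvg_cst (2 * e_ k))).
  by exists k => // m /= km; rewrite -(subnKC km); exact: dist nB _ _ _.
exists b => // e e0; have [i hi] := e_small e0.
apply/(cvge0P (fun k => measure_ge0 mu _)) => eta eta0.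
have [j hj] := e_small eta0.
exists (maxn i j) => // k /=; rewrite geq_max => /andP[ik jk].
have mono l : (l <= k)%N -> e_ k <= e_ l.
  by move=> lk; rewrite lef_pV2 ?posrE ?exprn_gt0// ler_weXn2l// ler1n.
apply: (@le_trans _ _ (mu (B k))).
  apply: le_measure; rewrite ?inE//.
    by apply: measurable_level; exact: measurable_funB.
  move=> x /= ex; apply: contrapT => /close; apply/negP; rewrite -ltNge.
  by have := mono _ ik; have := e_gt0 k; lra.
apply: le_trans (muB k) _; rewrite lee_fin.
by have := mono _ jk; have := e_gt0 k; lra.
Qed.

End complete_in_measure.

Section complex_convergence.
Context {R : realType} {n : nat}.
Local Notation X := 'rV[R]_n.
Local Notation mu := (@lebesgue_rV R n : {measure set X -> \bar R}).
Implicit Types (f g h w : X -> R[i]) (u : nat -> X -> R[i]) (p : R).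

Lemma measurable_clevel f (e : R) : cmeasurable f -> measurable [set x | e <= normc (f x)].
Proof.
move=> mf; have := measurable_level e (measurable_cnorm mf).
by congr (measurable _); apply/seteqP; split => x /=; rewrite normr_cnorm.
Qed.

Lemma mu_cover2 (A B C : set X) : measurable A -> measurable B -> measurable C ->
  A `<=` B `|` C -> (mu A <= mu B + mu C)%E.
Proof.
move=> mA mB mC ABC; apply: (@le_trans _ _ (mu (B `|` C))).
  by apply: le_measure; rewrite ?inE//; exact: measurableU.
exact: measureU2.
Qed.

Lemma ccauchy_cvg_mu u : (forall j, cmeasurable (u j)) ->
  (forall j, (mu [set x | ((2 ^+ j)^-1 <= normc (u j.+1 x - u j x))%R] <= ((2 ^+ j)^-1)%:E)%E) ->
  exists2 g, cmeasurable g & cvg_in_measure u g.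
Proof.
move=> um small.
have part (phi : R[i] -> R) : real_coord phi ->
    exists2 b, measurable_fun setT b & cvg_mu mu (fun j x => phi (u j x)) b.
  move=> hphi; apply: cauchy_cvg_mu => j; first exact: measurable_coord.
  apply: le_trans (small j); apply: le_measure; rewrite ?inE.
  - by apply: measurable_level; apply: measurable_funB; exact: measurable_coord.
  - by apply: measurable_clevel; exact: cmeasurableB.
  - by move=> x /= /le_trans; apply; rewrite -coordB//; exact: coord_le_normc.
have [a ma ca] := part _ (or_introl erefl); have [b mb cb] := part _ (or_intror erefl).
exists (fun x => Complex (a x) (b x)); first by split.
move=> e e0; have e2 : 0 < e / 2 by rewrite divr_gt0.
apply: (@squeeze_cvge _ _ _ _ (fun=> 0%E) _ (fun k => (mu [set x | (e / 2 <= `|complex.Re (u k x) - a x|)%R] +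
    mu [set x | (e / 2 <= `|complex.Im (u k x) - b x|)%R])%E)).
- apply: nearW => k; rewrite measure_ge0/=.
  have [m1 m2] := um k; apply: mu_cover2.
  + by apply: measurable_clevel; apply: cmeasurableB => //; split.
  + by apply: measurable_level; exact: measurable_funB.
  + by apply: measurable_level; exact: measurable_funB.
  + move=> x /= h; apply/orP; have := normc_le_ReIm (u k x - Complex (a x) (b x)).
    rewrite !raddfB/= => h'; rewrite -[_ || _]negbK negb_or -!ltNge; apply/negP => /andP[h1 h2].
    by move: h; apply/negP; rewrite -ltNge; apply: le_lt_trans h' _; lra.
- exact: cvg_cst.
- by rewrite -[X in _ --> X]adde0; apply: cvgeD => //; [exact: ca|exact: cb].
Qed.

Lemma cnorm_cvg_mu u g w : (forall j, cmeasurable (u j)) -> cmeasurable g -> cmeasurable w ->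
  cvg_in_measure u g -> cvg_mu mu (fun k x => normc (w x - u k x)) (fun x => normc (w x - g x)).
Proof.
move=> um mg mw ug e e0.
apply: (@squeeze_cvge _ _ _ _ (fun=> 0%E) _ (fun k => mu [set x | (e <= normc (u k x - g x))%R])).
- apply: nearW => k; rewrite measure_ge0/=; apply: le_measure; rewrite ?inE.
  + apply: measurable_level; apply: measurable_funB; apply: measurable_cnorm; exact: cmeasurableB.
  + by apply: measurable_clevel; exact: cmeasurableB.
  + move=> x /= /le_trans; apply; apply: le_trans (normc_dist_le _ _) _.
    by rewrite opprB addrC subrKA normc_distC.
- exact: cvg_cst.
- exact: ug.
Qed.

(** The truncation to this set is bounded with bounded support, hence in L^2, and
    dominated by f, hence convergent to f in L^p. *)
Definition trunc_set f (k : nat) : set X := big_box k `&` ~` [set x | k%:R <= normc (f x)].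

Definition truncate f (k : nat) : X -> R[i] := fun x => if x \in trunc_set f k then f x else 0.

Lemma measurable_trunc_set f k : cmeasurable f -> measurable (trunc_set f k).
Proof.
move=> mf; apply: measurableI; first exact: measurable_big_box.
by apply: measurableC; exact: measurable_clevel.
Qed.

Lemma truncate_le f k x : cnorm (truncate f k) x <= cnorm f x.
Proof.
rewrite /cnorm /truncate; case: ifP => // _.
by rewrite ComplexField.Normc.normc0 normc_ge0.
Qed.

Lemma cmeasurable_truncate f k : cmeasurable f -> cmeasurable (truncate f k).
Proof.
move=> mf; have mA := measurable_trunc_set k mf.
have part (phi : R[i] -> R) : real_coord phi -> measurable_fun setT (fun x => phi (truncate f k x)).
  move=> hphi; rewrite (_ : (fun x => _) = (fun x => \1_(trunc_set f k) x * phi (f x))); last first.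
    apply/funext => x; rewrite /truncate indicE; case: ifP => _; rewrite ?mul1r ?mul0r//.
    by case: hphi => ->.
  by apply: measurable_funM; [exact: measurable_indic|exact: measurable_coord].
by split; apply: part; [left|right].
Qed.

Lemma truncate_L2 f k : cmeasurable f -> in_Lp 2 (truncate f k).
Proof.
move=> mf; apply: (in_Lp_Ip _ (ltr0n R 2)).2; split; first exact: cmeasurable_truncate.
have mb := @measurable_big_box R n k.
have [m1 f1] := L2fun_indic mb (@lebesgue_big_box R n k).
have m2 : measurable_fun setT (fun x : X => k%:R * \1_(big_box k) x : R) by exact: measurable_funM.
apply: (@le_lt_trans _ _ (Ip mu 2 (fun x => k%:R * \1_(big_box k) x))).
  apply: (Ip_le mu (ler0n R 2) (measurable_cnorm (cmeasurable_truncate k mf)) m2) => x.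
  rewrite normr_cnorm; apply: le_trans (ler_norm _).
  rewrite /cnorm /truncate; case: ifPn => [|_].
    rewrite inE => -[bx /negP]; rewrite -ltNge => /ltW h.
    by rewrite indicE mem_set// mulr1.
  by rewrite ComplexField.Normc.normc0 mulr_ge0.
by rewrite Ip_scale// lte_mul_pinfty// lee_fin powR_ge0.
Qed.

Lemma truncate_cvg f x : \forall k \near \oo, truncate f k x = f x.
Proof.
have [K hK] := dyadic_bound `|x| (ltr01 : (0 : R) < 1).
have [M hM] := dyadic_bound (normc (f x)) (ltr01 : (0 : R) < 1).
exists (maxn K (2 ^ M)) => // k /=; rewrite geq_max => /andP[Kk Mk].
rewrite /truncate ifT// inE; split.
  move=> l; have /(mx_norm_le _ (normr_ge0 x))/(_ l) := lexx `|x|; rewrite ler_norml => /andP[h1 h2].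
  have hk : (2 : R) ^+ K <= 2 ^+ k by rewrite ler_weXn2l// ler1n.
  by rewrite mul1r in hK; apply/andP; split; lra.
apply/negP; rewrite -ltNge; rewrite mul1r in hM; apply: (lt_le_trans hM).
by rewrite -natrX ler_nat.
Qed.

Lemma truncate_Lp p f : 0 < p -> in_Lp p f ->
  (forall k, in_Lp p (truncate f k) /\ in_Lp 2 (truncate f k)) /\
  (forall k, (Ip mu p (cnorm (truncate f k)) <= Ip mu p (cnorm f))%E) /\
  Ip mu p (cnorm (fun x => truncate f k x - f x)) @[k --> \oo] --> 0%E.
Proof.
move=> p0 /(in_Lp_Ip _ p0)[mf ff]; have mt k := cmeasurable_truncate k mf.
have le k : (Ip mu p (cnorm (truncate f k)) <= Ip mu p (cnorm f))%E.
  apply: (Ip_le mu (ltW p0) (measurable_cnorm (mt k)) (measurable_cnorm mf)) => x.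
  by rewrite !normr_cnorm truncate_le.
split; first by move=> k; split; [apply: (in_Lp_Ip _ p0).2; split; [exact: mt|exact: le_lt_trans (le k) ff]|exact: truncate_L2].
split => //.
have m0 : measurable_fun setT (cst 0 : X -> R) by exact: measurable_cst.
pose F k : X -> R := cnorm (fun x => truncate f k x - f x).
have mF k : measurable_fun setT (F k) by apply: measurable_cnorm; exact: cmeasurableB.
have -> : (fun k => Ip mu p (cnorm (fun x => truncate f k x - f x))) =
    (fun k => Ip mu p (fun x => F k x - cst 0 x)).
  by apply/funext => k; congr (Ip _ _ _); apply/funext => x; rewrite subr0.
apply: (Ip_dominated p0 mF m0 (measurable_cnorm mf)).
- apply: nearW => x; apply: cvg_near_cst; apply: filterS (truncate_cvg f x) => k e.
  by rewrite /F /cnorm e subrr ComplexField.Normc.normc0.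
- move=> k x; rewrite !normr_cnorm /F /cnorm /truncate; case: ifP => _.
    by rewrite subrr ComplexField.Normc.normc0 normc_ge0.
  by rewrite sub0r normcN.
- by move=> x; rewrite normr0.
- exact: ff.
Qed.

End complex_convergence.

(** * Extension by density *)

Section extension_by_density.
Context {R : realType} {n : nat}.
Local Notation X := 'rV[R]_n.
Local Notation mu := (@lebesgue_rV R n : {measure set X -> \bar R}).
Implicit Types (f g h : X -> R[i]) (H : nat -> X -> R[i]).

Lemma Ip_csub p f g h : 0 < p -> cmeasurable f -> cmeasurable g -> cmeasurable h ->
  (Ip mu p (cnorm (fun x => f x - g x)%R) <=
   (2 `^ p)%:E * (Ip mu p (cnorm (fun x => f x - h x)%R) + Ip mu p (cnorm (fun x => g x - h x)%R)))%E.
Proof.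
move=> p0 mf mg mh; have m1 := measurable_cnorm (cmeasurableB mf mh).
have m2 := measurable_cnorm (cmeasurableB mg mh).
apply: le_trans (Ip_add mu (ltW p0) m1 m2).
apply: (Ip_le mu (ltW p0) (measurable_cnorm (cmeasurableB mf mg)) (measurable_funD m1 m2)) => x.
rewrite normr_cnorm; apply: le_trans (ler_norm _); rewrite /cnorm -(subrKA (h x)).
by rewrite /= (normc_distC (g x)); exact: normc_triangle.
Qed.

Lemma in_LpB p f g : 0 < p -> in_Lp p f -> in_Lp p g -> in_Lp p (fun x => f x - g x).
Proof.
move=> p0 /(in_Lp_Ip _ p0)[mf ff] /(in_Lp_Ip _ p0)[mg fg]; apply: (in_Lp_Ip _ p0).2.
split; first exact: cmeasurableB.
have m0 : cmeasurable ((fun=> 0) : X -> R[i]) by split; exact: measurable_cst.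
apply: (le_lt_trans (Ip_csub p0 mf mg m0)).
have E (u : X -> R[i]) : (fun x => u x - 0) = u by apply/funext => x; rewrite subr0.
rewrite !E; apply: lte_mul_pinfty _ _ (lte_add_pinfty ff fg) => //.
Qed.

Context (S : (X -> R[i]) -> X -> R[i]) (q C : R) (q0 : 0 < q) (C0 : 0 <= C).
Context (S_meas : forall h, in_Lp 2 h -> cmeasurable (S h)).
Context (S_sub : forall h h', in_Lp 2 h -> in_Lp 2 h' ->
  {ae mu, forall x, S (fun y => h y - h' y) x = S h x - S h' x}).
Context (S_weak : forall h, in_Lp 2 h -> in_Lp q h -> forall l : R, 0 < l ->
  ((l `^ q)%:E * mu [set x | (l <= normc (S h x))%R] <= C%:E * Ip mu q (cnorm h))%E).

Let approx f H := (forall k, in_Lp q (H k) /\ in_Lp 2 (H k)) /\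
  Ip mu q (cnorm (fun x => H k x - f x)) @[k --> \oo] --> 0%E.

Lemma weak_type_dist h h' f (l : R) : 0 < l -> in_Lp q h /\ in_Lp 2 h -> in_Lp q h' /\ in_Lp 2 h' ->
  cmeasurable f ->
  (mu [set x | (l <= normc (S h x - S h' x))%R] <= (C * 2 `^ q / l `^ q)%:E *
    (Ip mu q (cnorm (fun x => h x - f x)%R) + Ip mu q (cnorm (fun x => h' x - f x)%R)))%E.
Proof.
move=> l0 [hq h2] [hq' h2'] mf; have lq : 0 < l `^ q by exact: powR_gt0.
have d2 := in_LpB (ltr0n R 2) h2 h2'; have dq := in_LpB q0 hq hq'.
have := S_weak d2 dq l0.
have -> : mu [set x | (l <= normc (S (fun y => h y - h' y) x))%R] = mu [set x | (l <= normc (S h x - S h' x))%R].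
  have m1 := measurable_clevel l (S_meas d2).
  have m2 := measurable_clevel l (cmeasurableB (S_meas h2) (S_meas h2')).
  by apply/eqP; rewrite eq_le; apply/andP; split; apply: measure_ae_le => //;
    apply: filterS (S_sub h2 h2') => x /= ->.
move=> h1; have := le_trans h1 (lee_wpmul2l _ (Ip_csub q0 hq.1 hq'.1 mf)).
rewrite lee_fin => /(_ C0); rewrite muleA -EFinM -lee_pdivlMl// muleA -EFinM.
by rewrite [_^-1 * _]mulrC.
Qed.

(** Along a sequence converging fast enough to f the images satisfy the hypothesis
    of [ccauchy_cvg_mu]; any other approximating sequence is compared with it term
    by term. *)
Lemma density_value f : in_Lp q f -> exists2 g, cmeasurable g &
  forall H, approx f H -> cvg_in_measure (fun k => S (H k)) g.
Proof.
move=> fq; have [mf _] := fq; have [tL [_ tcvg]] := truncate_Lp q0 fq.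
pose I0 k := Ip mu q (cnorm (fun x => truncate f k x - f x)).
pose K := 2 * (C * 2 `^ q) + 1.
have K0 : 0 < K by rewrite ltr_wpDl// !mulr_ge0// powR_ge0.
pose e j : R := (2 ^+ j)^-1.
have e0 j : 0 < e j by rewrite invr_gt0 exprn_gt0.
(* the first e j is the measure of the exceptional set that is aimed at, the
   second one the level *)
pose eta j := e j * e j `^ q / K.
have eta0 j : 0 < eta j by rewrite divr_gt0// mulr_gt0// powR_gt0.
have pick j : exists k, (I0 k <= (eta j)%:E)%E.
  have [k _ /(_ k (leqnn k)) hk] := (cvge0P (fun k => Ip_ge0 mu q _)).1 tcvg _ (eta0 j).
  by exists k.
have [s hs] := choice pick.
have etaS j : eta j.+1 <= eta j.
  have ee : e j.+1 <= e j by rewrite lef_pV2 ?posrE ?exprn_gt0// ler_weXn2l// ler1n.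
  rewrite /eta ler_pM2r ?invr_gt0//; apply: ler_pM; rewrite ?(ltW (e0 _)) ?powR_ge0//.
  by apply: (ge0_ler_powR (ltW q0)) => //; rewrite nnegrE ltW.
pose u j := S (truncate f (s j)).
have um j : cmeasurable (u j) by apply: S_meas; exact: truncate_L2.
have [g mg ug] : exists2 g, cmeasurable g & cvg_in_measure u g.
  apply: ccauchy_cvg_mu => // j.
  apply: le_trans (weak_type_dist (e0 j) (tL (s j.+1)) (tL (s j)) mf) _.
  apply: (@le_trans _ _ ((C * 2 `^ q / e j `^ q)%:E * (eta j + eta j)%:E)%E).
    apply: lee_wpmul2l; first by rewrite lee_fin divr_ge0 ?powR_ge0// mulr_ge0// powR_ge0.
    rewrite EFinD; apply: leeD; last exact: hs.
    by apply: (le_trans (hs _)); rewrite lee_fin.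
  rewrite -EFinM lee_fin -/(e j) /eta.
  have -> : C * 2 `^ q / e j `^ q * (e j * e j `^ q / K + e j * e j `^ q / K) =
      e j * (2 * (C * 2 `^ q) / K).
    by field; rewrite !gt_eqF// powR_gt0.
  rewrite -[leRHS]mulr1 ler_pM2l// ler_pdivrMr// mul1r /K.
  by rewrite lerDl.
exists g => // H [HL Hcvg] l l0; have l2 : 0 < l / 2 by rewrite divr_gt0.
have es (eps : R) : 0 < eps -> \forall j \near \oo, eta j < eps.
  move=> eps0; have [M hM] := dyadic_bound (eps * K)^-1 (ltr01 : (0 : R) < 1).
  exists M => // j /= Mj; rewrite mul1r in hM.
  have e1 : e j <= 1 by rewrite invf_le1 ?exprn_gt0// exprn_ege1// ler1n.
  have eM : e j <= e M by rewrite lef_pV2 ?posrE ?exprn_gt0// ler_weXn2l// ler1n.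
  have eK : e M < eps * K by rewrite invf_plt ?posrE ?exprn_gt0// mulr_gt0.
  rewrite /eta ltr_pdivrMr//; apply: le_lt_trans (le_lt_trans eM eK).
  have one : (1 : R) `^ q = 1 by rewrite powR1.
  rewrite -[leRHS]mulr1 ler_pM2l// -[leRHS]one; apply: (ge0_ler_powR (ltW q0)) => //.
    by rewrite nnegrE ltW.
  by rewrite nnegrE.
have I0s : I0 (s j) @[j --> \oo] --> 0%E.
  apply/(cvge0P (fun j => Ip_ge0 mu q _)) => eps eps0.
  apply: filterS (es _ eps0) => j h; apply: (le_trans (hs j)).
  by rewrite lee_fin ltW.
apply: (@squeeze_cvge _ _ _ _ (fun=> 0%E) _ (fun k =>
  ((C * 2 `^ q / (l / 2) `^ q)%:E * (Ip mu q (cnorm (fun x => H k x - f x)%R) + I0 (s k)) +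
  mu [set x | (l / 2 <= normc (u k x - g x))%R])%E)).
- apply: nearW => k; rewrite measure_ge0/=.
  have mH := S_meas (HL k).2.
  apply: le_trans (leeD2r _ (weak_type_dist l2 (HL k) (tL (s k)) mf)); apply: mu_cover2.
  + by apply: measurable_clevel; exact: cmeasurableB.
  + exact: (measurable_clevel _ (cmeasurableB mH (um k))).
  + by apply: measurable_clevel; exact: cmeasurableB.
  + move=> x /= h; apply/orP; rewrite -[_ || _]negbK negb_or -!ltNge; apply/negP => /andP[h1 h2].
    move: h; apply/negP; rewrite -ltNge -(subrKA (u k x)).
    by apply: le_lt_trans (normc_triangle _ _) _; lra.
- exact: cvg_cst.
- have -> : 0%E = ((C * 2 `^ q / (l / 2) `^ q)%:E * (0 + 0) + 0)%E :> \bar R by rewrite !adde0 mule0.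
  apply: cvgeD => //; last exact: ug.
  apply: cvgeZl; first by [].
  by apply: (cvgeD _ Hcvg I0s).
Qed.

Lemma weak_value_bound f g (l : R) : 0 < l -> in_Lp q f -> cmeasurable g ->
  (forall H, approx f H -> cvg_in_measure (fun k => S (H k)) g) ->
  ((l `^ q)%:E * mu [set x | (l <= normc (g x))%R] <= (2 `^ q * C)%:E * Ip mu q (cnorm f))%E.
Proof.
move=> l0 fq mg hg; have [tL [tle tcvg]] := truncate_Lp q0 fq.
have ug := hg _ (conj tL tcvg).
have um k : cmeasurable (S (truncate f k)) by apply: S_meas; case: (tL k).
have m0 : cmeasurable ((fun=> 0) : X -> R[i]) by split; exact: measurable_cst.
have c := cnorm_cvg_mu um mg m0 ug.
have nE (v : X -> R[i]) x : normc (0 - v x) = normc (v x) by rewrite sub0r normcN.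
have fin : Ip mu q (cnorm f) \is a fin_num.
  by rewrite ge0_fin_numE ?Ip_ge0//; case/(in_Lp_Ip _ q0): fq.
have l2 : 0 < l / 2 by rewrite divr_gt0.
have lq : 0 < (l / 2) `^ q by exact: powR_gt0.
pose I := fine (Ip mu q (cnorm f)); have fE : Ip mu q (cnorm f) = I%:E by rewrite fineK.
pose M := C * I / (l / 2) `^ q.
have mF k : measurable_fun setT (fun x => normc (0 - S (truncate f k) x)).
  exact: (measurable_cnorm (cmeasurableB m0 (um k))).
have mg' : measurable_fun setT (fun x => normc (0 - g x)).
  exact: (measurable_cnorm (cmeasurableB m0 mg)).
have : (mu [set x | (l <= `|normc (0 - g x)|)%R] <= M%:E)%E.
  apply: (level_le_of_cvg_mu l0 mF mg' c) => k.
  have -> : [set x | l / 2 <= `|normc (0 - S (truncate f k) x)|] = [set x | l / 2 <= normc (S (truncate f k) x)].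
    by apply/seteqP; split => x /=; rewrite nE ger0_norm// normc_ge0.
  have := S_weak (tL k).2 (tL k).1 l2.
  rewrite -lee_pdivlMl// => /le_trans; apply.
  have -> : M%:E = (((l / 2) `^ q)^-1%:E * (C%:E * Ip mu q (cnorm f)))%E.
    by rewrite fE -!EFinM /M mulrC.
  apply: lee_wpmul2l; first by rewrite lee_fin invr_ge0 ltW.
  exact: lee_wpmul2l.
have -> : [set x | l <= `|normc (0 - g x)|] = [set x | l <= normc (g x)].
  by apply/seteqP; split => x /=; rewrite nE ger0_norm// normc_ge0.
move=> h; apply: (@le_trans _ _ ((l `^ q)%:E * M%:E)%E).
  by apply: lee_wpmul2l => //; rewrite lee_fin powR_ge0.
rewrite fE -!EFinM lee_fin /M powRM ?(ltW l0)// ?invr_ge0//.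
have -> : 2^-1 `^ q = (2 `^ q)^-1 :> R by rewrite -powR_inv1// -powRrM mulN1r powRN.
rewrite le_eqVlt; apply/orP; left; apply/eqP; field.
by rewrite !gt_eqF// powR_gt0.
Qed.

Context (S_strong : forall h, in_Lp 2 h -> in_Lp q h ->
  (Ip mu q (cnorm (S h)) <= C%:E * Ip mu q (cnorm h))%E).

Lemma strong_type_dist h h' f : in_Lp q h /\ in_Lp 2 h -> in_Lp q h' /\ in_Lp 2 h' ->
  cmeasurable f ->
  (Ip mu q (cnorm (fun x => S h x - S h' x)%R) <= (C * 2 `^ q)%:E *
    (Ip mu q (cnorm (fun x => h x - f x)%R) + Ip mu q (cnorm (fun x => h' x - f x)%R)))%E.
Proof.
move=> [hq h2] [hq' h2'] mf.
have d2 := in_LpB (ltr0n R 2) h2 h2'; have dq := in_LpB q0 hq hq'.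
have m1 := measurable_cnorm (S_meas d2).
have m2 := measurable_cnorm (cmeasurableB (S_meas h2) (S_meas h2')).
rewrite (Ip_ae_eq (ltW q0) m2 m1); last first.
  by apply: filterS (S_sub h2 h2') => x; rewrite /cnorm => ->.
have h1 := lee_wpmul2l (C0 : (0 <= C%:E)%E) (Ip_csub q0 hq.1 hq'.1 mf).
apply: (le_trans (S_strong d2 dq)); apply: (le_trans h1).
by rewrite muleA -EFinM.
Qed.

(** With k fixed, S (H k) - S (t m) converges in measure to S (H k) - g as m grows,
    and its norm is controlled by the distances of H k and t m to f. Starting the
    truncations at a large index M makes the second one small for all m. *)
Lemma strong_value_cvg f g : in_Lp q f -> cmeasurable g ->
  (forall H, approx f H -> cvg_in_measure (fun k => S (H k)) g) ->
  forall H, approx f H -> Ip mu q (cnorm (fun x => S (H k) x - g x)) @[k --> \oo] --> 0%E.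
Proof.
move=> fq mg hg H [HL Hcvg]; have [mf _] := fq; have [tL [_ tcvg]] := truncate_Lp q0 fq.
apply/(cvge0P (fun k => Ip_ge0 mu q _)) => e e0.
pose K := C * 2 `^ q; have K0 : 0 <= K by rewrite mulr_ge0// powR_ge0.
have K1 : 0 < 2 * K + 1 by rewrite ltr_wpDl// mulr_ge0.
pose e' := e / (2 * K + 1); have e'0 : 0 < e' by rewrite divr_gt0.
have [M _ hM] := (cvge0P (fun k => Ip_ge0 mu q _)).1 tcvg _ e'0.
apply: filterS ((cvge0P (fun k => Ip_ge0 mu q _)).1 Hcvg _ e'0) => k hk.
pose t m := truncate f (m + M)%N.
have ht : approx f t.
  split; first by move=> m; exact: tL.
  apply/(cvge0P (fun k => Ip_ge0 mu q _)) => a a0.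
  have [L _ hL] := (cvge0P (fun k => Ip_ge0 mu q _)).1 tcvg _ a0.
  exists L => [//|m /= Lm].
  exact: hL (m + M)%N (leq_trans Lm (leq_addr _ _)).
have um m : cmeasurable (S (t m)) by apply: S_meas; exact: (tL _).2.
have mH := S_meas (HL k).2.
apply: (Ip_le_of_cvg_mu q0 (fun m => measurable_cnorm (cmeasurableB mH (um m)))
  (measurable_cnorm (cmeasurableB mH mg)) (cnorm_cvg_mu um mg mH (hg _ ht))) => m.
apply: (le_trans (strong_type_dist (HL k) (tL _) mf)).
apply: (@le_trans _ _ (K%:E * (e'%:E + e'%:E))%E).
  apply: lee_wpmul2l; first by rewrite lee_fin.
  exact: leeD hk (hM (m + M)%N (leq_addl _ _)).
rewrite -EFinD -EFinM lee_fin.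
have -> : K * (e' + e') = e * (2 * K / (2 * K + 1)) by rewrite /e'; field; rewrite gt_eqF.
rewrite -[leRHS]mulr1 ler_pM2l// ler_pdivrMr// mul1r.
by rewrite lerDl.
Qed.

(** Convergence in L^q being assumed here, g need not be the function of
    [density_value]. *)
Lemma strong_value_bound f g : in_Lp q f -> cmeasurable g ->
  (forall H, approx f H -> Ip mu q (cnorm (fun x => S (H k) x - g x)) @[k --> \oo] --> 0%E) ->
  (Ip mu q (cnorm g) <= C%:E * Ip mu q (cnorm f))%E.
Proof.
move=> fq mg hg; have [tL [tle tcvg]] := truncate_Lp q0 fq.
have c := hg _ (conj tL tcvg).
have um k : cmeasurable (S (truncate f k)) by apply: S_meas; exact: (tL k).2.
have cm : cvg_mu mu (fun k => cnorm (S (truncate f k))) (cnorm g).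
  apply: (Ip_cvg_mu q0 (fun k => measurable_cnorm (um k)) (measurable_cnorm mg)).
  apply: (@squeeze_cvge _ _ _ _ (fun=> 0%E) _ (fun k =>
    Ip mu q (cnorm (fun x => S (truncate f k) x - g x)))) => //; last exact: cvg_cst.
  apply: nearW => k; rewrite Ip_ge0/=.
  have m1 := measurable_funB (measurable_cnorm (um k)) (measurable_cnorm mg).
  apply: (Ip_le mu (ltW q0) m1 (measurable_cnorm (cmeasurableB (um k) mg))) => x.
  by rewrite normr_cnorm; exact: normc_dist_le.
apply: (Ip_le_of_cvg_mu q0 (fun k => measurable_cnorm (um k)) (measurable_cnorm mg) cm) => k.
apply: (le_trans (S_strong (tL k).2 (tL k).1)).
exact: lee_wpmul2l.
Qed.

End extension_by_density.

(** * Weak type and L^p bounds *)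

Section complex_bounds.
Context {R : realType} {n : nat}.
Local Notation X := 'rV[R]_n.
Local Notation mu := (@lebesgue_rV R n : {measure set X -> \bar R}).
Context (T : (X -> R[i]) -> (X -> R[i]) -> R[i]) (S : (X -> R[i]) -> X -> R[i]).
Context (hS : L2_extension T S).
Implicit Types (h : X -> R[i]).

Lemma L2_extension_measurable h : in_Lp 2 h -> cmeasurable (S h).
Proof. by move=> h2; have [[B /(_ _ h2)[[]]]] := hS. Qed.

Lemma L2_extensionB h h' : in_Lp 2 h -> in_Lp 2 h' ->
  {ae mu, forall x, S (fun y => h y - h' y) x = S h x - S h' x}.
Proof.
move=> h2 h2'; have [_ lin _] := hS; have := lin (-1) _ _ h2' h2.
rewrite (_ : (fun y => -1 * h' y + h y) = (fun y => h y - h' y)); last first.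
  by apply/funext => y; rewrite mulN1r addrC.
by apply: filterS => x ->; rewrite mulN1r addrC.
Qed.

Lemma in_Lp_coord p phi h : 0 < p -> real_coord phi -> in_Lp p h ->
  [/\ measurable_fun setT (fun x => phi (h x)), (Ip mu p (fun x => phi (h x)) < +oo)%E
    & (Ip mu p (fun x => phi (h x)) <= Ip mu p (cnorm h))%E].
Proof.
move=> p0 hphi /(in_Lp_Ip _ p0)[mh fh]; have m := measurable_coord hphi mh.
have le : (Ip mu p (fun x => phi (h x)) <= Ip mu p (cnorm h))%E.
  apply: (Ip_le mu (ltW p0) m (measurable_cnorm mh)) => x.
  by rewrite normr_cnorm; exact: coord_le_normc.
by split; [exact: m|exact: le_lt_trans le fh|exact: le].
Qed.

Let re : real_coord (@complex.Re R) := or_introl erefl.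
Let im : real_coord (@complex.Im R) := or_intror erefl.
Let hRe h x := complex.Re (h x).
Let hIm h x := complex.Im (h x).

Let L2_coord phi h : real_coord phi -> in_Lp 2 h -> L2fun (fun x => phi (h x)).
Proof. by move=> hphi h2; have [m f _] := in_Lp_coord (ltr0n R 2) hphi h2. Qed.

(** S is linear over the complex numbers, so S h is i times the image of the
    imaginary part plus the image of the real part. *)
Lemma normc_S_le h : in_Lp 2 h -> {ae mu, forall x, normc (S h x) <=
  (`|coord_op (@complex.Re R) S (hRe h) x| + `|coord_op (@complex.Im R) S (hRe h) x|) +
  (`|coord_op (@complex.Re R) S (hIm h) x| + `|coord_op (@complex.Im R) S (hIm h) x|)}.
Proof.
move=> h2; have [_ lin _] := hS.
have h2R := of_real_L2 (L2_coord re h2); have h2I := of_real_L2 (L2_coord im h2).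
have := lin (Complex 0 1) _ _ h2I h2R.
rewrite (_ : (fun y => _) = h); last first.
  by apply/funext => y; rewrite /of_real; case: (h y) => a b; apply/eqP; rewrite eq_complex/=; apply/andP; split; apply/eqP; ring.
apply: filterS => x ->; apply: le_trans (normc_triangle _ _) _.
rewrite addrC lerD//; first exact: normc_le_ReIm.
rewrite ComplexField.Normc.normcM [normc (Complex 0 1)](_ : _ = 1); last first.
  by rewrite normc_sqrt/= expr0n expr1n add0r sqrtr1.
by rewrite mul1r; exact: normc_le_ReIm.
Qed.

Context (p C : R) (p1 : 1 < p) (C0 : 0 < C).
Context (bounds : forall phi, real_coord phi -> forall f : X -> R, L2fun f ->
    (forall l : R, 0 < l -> (Ip mu 1 f < +oo)%E ->
       (l%:E * mu [set x | (l <= `|coord_op phi S f x|)%R] <= C%:E * Ip mu 1 f)%E) /\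
    ((Ip mu p f < +oo)%E -> (Ip mu p (coord_op phi S f) <= C%:E * Ip mu p f)%E)).

Let measurable_op phi f : real_coord phi -> L2fun f -> measurable_fun setT (coord_op phi S f).
Proof.
by move=> hphi hf; apply: (measurable_coord hphi); apply: L2_extension_measurable; exact: of_real_L2.
Qed.

(** One of the four terms is at least a quarter of their sum. *)
Lemma complex_weak h l : in_Lp 2 h -> in_Lp 1 h -> 0 < l ->
  (l%:E * mu [set x | (l <= normc (S h x))%R] <= (16 * C)%:E * Ip mu 1 (cnorm h))%E.
Proof.
move=> h2 h1 l0; have l4 : 0 < l / 4 by rewrite divr_gt0.
have ms := L2_extension_measurable h2.
have fin : Ip mu 1 (cnorm h) \is a fin_num.
  by rewrite ge0_fin_numE ?Ip_ge0//; case/(in_Lp_Ip _ ltr01): h1.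
pose I := fine (Ip mu 1 (cnorm h)); have fE : Ip mu 1 (cnorm h) = I%:E by rewrite fineK.
have part phi psi : real_coord phi -> real_coord psi ->
    measurable [set x | l / 4 <= `|coord_op phi S (fun x => psi (h x)) x|] /\
    (mu [set x | (l / 4 <= `|coord_op phi S (fun x => psi (h x)) x|)%R] <= (C * I / (l / 4))%:E)%E.
  move=> hphi hpsi; have hL := L2_coord hpsi h2.
  split; first by apply: measurable_level; exact: measurable_op.
  have [_ f1 le1] := in_Lp_coord ltr01 hpsi h1.
  have := (bounds hphi hL).1 _ l4 f1; rewrite -lee_pdivlMl// => /le_trans; apply.
  have -> : ((C * I / (l / 4))%:E = ((l / 4)^-1)%:E * (C%:E * Ip mu 1 (cnorm h)))%E.
    by rewrite fE -!EFinM mulrC.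
  apply: lee_wpmul2l; first by rewrite lee_fin invr_ge0 ltW.
  by apply: lee_wpmul2l => //; rewrite lee_fin ltW.
have [m1 b1] := part _ _ re re; have [m2 b2] := part _ _ im re.
have [m3 b3] := part _ _ re im; have [m4 b4] := part _ _ im im.
move: m1 b1 m2 b2 m3 b3 m4 b4.
set E1 := (X in measurable X -> _) => m1 b1; set E2 := (X in measurable X -> _) => m2 b2.
set E3 := (X in measurable X -> _) => m3 b3; set E4 := (X in measurable X -> _) => m4 b4.
have m12 : measurable (E1 `|` E2) by exact: measurableU.
have m34 : measurable (E3 `|` E4) by exact: measurableU.
have le : (mu [set x | (l <= normc (S h x))%R] <= (4 * (C * I / (l / 4)))%:E)%E.
  apply: (@le_trans _ _ (mu ((E1 `|` E2) `|` (E3 `|` E4)))).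
    apply: measure_ae_le; [exact: measurable_clevel|exact: measurableU|].
    apply: filterS (normc_S_le h2) => x hx /= lx; apply: contrapT => /not_orP[/not_orP[n1 n2] /not_orP[n3 n4]].
    move: lx; apply/negP; rewrite -ltNge; apply: le_lt_trans hx _.
    move: n1 n2 n3 n4; rewrite /E1 /E2 /E3 /E4 /= => /negP + /negP + /negP + /negP.
    by rewrite -!ltNge /hRe /hIm; lra.
  apply: (le_trans (measureU2 _ m12 m34)).
  apply: (le_trans (leeD (measureU2 _ m1 m2) (measureU2 _ m3 m4))).
  apply: (le_trans (leeD (leeD b1 b2) (leeD b3 b4))).
  by rewrite -!EFinD lee_fin; lra.
apply: (le_trans (lee_wpmul2l _ le)); first by rewrite lee_fin ltW.
rewrite fE -!EFinM lee_fin le_eqVlt; apply/orP; left; apply/eqP; field.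
by rewrite gt_eqF.
Qed.

(** Four terms, added two by two with a factor 2^p each time. *)
Definition strong_factor : R := 2 `^ p * (4 * 2 `^ p * C).

Lemma complex_strong h : in_Lp 2 h -> in_Lp p h ->
  (Ip mu p (cnorm (S h)) <= strong_factor%:E * Ip mu p (cnorm h))%E.
Proof.
move=> h2 hp; have p0 : 0 < p by exact: lt_trans p1.
have ms := measurable_cnorm (L2_extension_measurable h2).
have fin : Ip mu p (cnorm h) \is a fin_num.
  by rewrite ge0_fin_numE ?Ip_ge0//; case/(in_Lp_Ip _ p0): hp.
pose I := fine (Ip mu p (cnorm h)); have fE : Ip mu p (cnorm h) = I%:E by rewrite fineK.
pose N phi psi x := `|coord_op phi S (fun x => psi (h x)) x|.
have part phi psi : real_coord phi -> real_coord psi ->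
    measurable_fun setT (N phi psi) /\ (Ip mu p (N phi psi) <= (C * I)%:E)%E.
  move=> hphi hpsi; have hL := L2_coord hpsi h2.
  split; first by apply: measurableT_comp => //; exact: measurable_op.
  have [_ f1 le1] := in_Lp_coord p0 hpsi hp.
  have -> : Ip mu p (N phi psi) = Ip mu p (coord_op phi S (fun x => psi (h x))).
    by rewrite !IpE; apply: eq_integral => x _; rewrite normr_id.
  apply: (le_trans ((bounds hphi hL).2 f1)); rewrite EFinM -fE.
  by apply: lee_wpmul2l => //; rewrite lee_fin ltW.
have [m1 b1] := part _ _ re re; have [m2 b2] := part _ _ im re.
have [m3 b3] := part _ _ re im; have [m4 b4] := part _ _ im im.
have m12 := measurable_funD m1 m2; have m34 := measurable_funD m3 m4.
have m := measurable_funD m12 m34.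
have tp : (0 <= (2 `^ p)%:E :> \bar R)%E by rewrite lee_fin powR_ge0.
have two b c : measurable_fun setT b -> measurable_fun setT c -> (Ip mu p b <= (C * I)%:E)%E ->
    (Ip mu p c <= (C * I)%:E)%E -> (Ip mu p (fun x => b x + c x)%R <= (2 `^ p * (2 * (C * I)))%:E)%E.
  move=> mb mc hb hc; apply: (le_trans (Ip_add mu (ltW p0) mb mc)).
  rewrite EFinM; apply: lee_wpmul2l => //.
  by rewrite mulrDl mul1r EFinD; exact: leeD hb hc.
have b12 := two _ _ m1 m2 b1 b2; have b34 := two _ _ m3 m4 b3 b4.
apply: (@le_trans _ _ (Ip mu p (fun x => (N (@complex.Re R) (@complex.Re R) x + N (@complex.Im R) (@complex.Re R) x) +
   (N (@complex.Re R) (@complex.Im R) x + N (@complex.Im R) (@complex.Im R) x)))).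
  apply: (Ip_ae_le (ltW p0) ms m); apply: filterS (normc_S_le h2) => x hx.
  by rewrite normr_cnorm; apply: le_trans (ler_norm _).
apply: (le_trans (Ip_add mu (ltW p0) m12 m34)).
apply: (le_trans (lee_wpmul2l tp (leeD b12 b34))).
rewrite fE -EFinD -!EFinM lee_fin /strong_factor le_eqVlt; apply/orP; left; apply/eqP; ring.
Qed.

End complex_bounds.

Theorem theorem3p4 (R : realType) (n r : nat)
    (D : 'I_r.+1 -> set 'rV[R]_n) (gam : 'I_r.+1 -> 'rV[R]_n -> 'rV[R]_n)
    (T : ('rV[R]_n -> R[i]) -> ('rV[R]_n -> R[i]) -> R[i]) (p : R) :
  (0 < n)%N -> standard_hyper_curve D gam -> CZO D gam T -> 1 < p ->
  exists2 C : R, 0 < C & forall S, L2_extension T S ->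
    (forall f, in_Lp 1 f ->
       (exists g, L1_value S f g) /\
       forall g, L1_value S f g ->
         (weak_L1_norm g <= C%:E * Lp_norm 1 f)%E) /\
    (forall f, in_Lp p f ->
       (exists g, Lp_value p S f g) /\
       forall g, Lp_value p S f g ->
         (Lp_norm p g <= C%:E * Lp_norm p f)%E).
Proof.
move=> n0 hD hT p1; have [C C0 bounds] := coord_op_bounds n0 hD hT p1.
have p0 : 0 < p by exact: lt_trans p1.
pose K := strong_factor p C.
have K0 : 0 < K by rewrite !mulr_gt0// powR_gt0.
have C16 : 0 <= 16 * C by rewrite mulr_ge0// ltW.
pose M := 32 * C + K `^ p^-1; have M0 : 0 < M by rewrite addr_gt0 ?powR_gt0 ?mulr_gt0.
exists M => // S hS; pose b phi hphi := bounds S phi hS hphi.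
have wk h : in_Lp 2 h -> in_Lp 1 h -> forall l : R, 0 < l ->
    ((l `^ 1)%:E * lebesgue_rV [set x | (l <= normc (S h x))%R] <= (16 * C)%:E * Ip (lebesgue_rV (n:=n)) 1 (cnorm h))%E.
  by move=> h2 h1 l l0; rewrite powRr1 ?(ltW l0)//; exact: (complex_weak hS C0 b).
have st h (h2 : in_Lp 2 h) (hp : in_Lp p h) := complex_strong hS p1 C0 b h2 hp.
have meas := L2_extension_measurable hS; have sub := L2_extensionB hS.
have wkp h : in_Lp 2 h -> in_Lp p h -> forall l : R, 0 < l ->
    ((l `^ p)%:E * lebesgue_rV [set x | (l <= normc (S h x))%R] <= K%:E * Ip (lebesgue_rV (n:=n)) p (cnorm h))%E.
  move=> h2 hp l l0; apply: le_trans (st _ h2 hp).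
  have := chebyshev_Ip (lebesgue_rV (n := n)) p0 l0 (measurable_cnorm (meas _ h2)).
  by under eq_set do rewrite normr_cnorm.
split=> f hf.
  split.
    have [g mg hg] := density_value ltr01 C16 meas sub wk hf.
    exists g; split => // h hL /(Lp_norm_cvg0 _ ltr01) hcvg; exact: hg.
  move=> g [mg hg]; apply: ge_ereal_sup => _ [l l0 <-].
  have hg' H : (forall k, in_Lp 1 (H k) /\ in_Lp 2 (H k)) /\
      Ip (lebesgue_rV (n:=n)) 1 (cnorm (fun x => H k x - f x)) @[k --> \oo] --> 0%E ->
      cvg_in_measure (fun k => S (H k)) g.
    by move=> [hL hcvg]; apply: hg => //; exact/(Lp_norm_cvg0 _ ltr01).
  have := weak_value_bound ltr01 C16 meas wk l0 hf mg hg'.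
  rewrite !powRr1 ?(ltW l0)// => /le_trans; apply; rewrite Lp_norm1.
  by apply: lee_wpmul2r; [exact: Ip_ge0|rewrite lee_fin /M mulrA -natrM lerDl powR_ge0].
have KM : K <= M `^ p.
  have -> : K = (K `^ p^-1) `^ p by rewrite -powRrM mulVf ?gt_eqF// powRr1// ltW.
  apply: (ge0_ler_powR (ltW p0)); rewrite ?nnegrE ?powR_ge0 ?(ltW M0)//.
  by rewrite lerDr mulr_ge0// ltW.
have K0' := ltW K0.
split.
  have [g mg hg] := density_value p0 K0' meas sub wkp hf.
  have cv := strong_value_cvg p0 K0' meas sub st hf mg hg.
  have hg' H := cv H.
  have gb := strong_value_bound p0 K0' meas st hf mg cv.
  exists g; split.
    apply: (in_Lp_Ip _ p0).2; split => //; apply: le_lt_trans gb _.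
    by apply: lte_mul_pinfty => //; case/(in_Lp_Ip _ p0): hf.
  move=> h hL /(Lp_norm_cvg0 _ p0) hcvg; apply/(Lp_norm_cvg0 _ p0); exact: cv.
move=> g [[mg _] hg]; rewrite -(Lp_norm_le _ _ p0 (ltW M0)).
have cv H : (forall k, in_Lp p (H k) /\ in_Lp 2 (H k)) /\
    Ip (lebesgue_rV (n:=n)) p (cnorm (fun x => H k x - f x)) @[k --> \oo] --> 0%E ->
    Ip (lebesgue_rV (n:=n)) p (cnorm (fun x => S (H k) x - g x)) @[k --> \oo] --> 0%E.
  by move=> [hL hcvg]; apply/(Lp_norm_cvg0 _ p0); apply: hg => //; exact/(Lp_norm_cvg0 _ p0).
apply: (le_trans (strong_value_bound p0 K0' meas st hf mg cv)).
by apply: lee_wpmul2r; [exact: Ip_ge0|rewrite lee_fin].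
Qed.
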